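(* Let $n\ge2$, $1\le k<n$, $u\in S_n$, and let $a,b\ge1$ be integers with $a\le k$ and $b\le n-k$. Then in $qH^*\mathbb{F}\ell_n$, $$\mathfrak{S}_u\ast s^q_{(b,1^{a-1})}(x_1,\dots,x_k)\ =\ \sum \binom{s(wu^{-1})-1}{\mathrm{ht}(wu^{-1})-a}\, q^\alpha\,\mathfrak{S}_w\,,$$ the sum over all minimal intervals $[u,q^\alpha w]_k^q$ in the quantum $k$-Bruhat order (with $w\in S_n$, $\alpha\in\mathbb{N}^{n-1}$) such that $\ell(q^\alpha w)-\ell(u)=a+b-1$.
   Context: Permutations are composed as functions, $(i,j)$ is a transposition, $[n]=\{1,\dots,n\}$, $\mathbb{N}=\{0,1,2,\dots\}$, $\ell(u)=\#\{i<j\mid u(i)>u(j)\}$. A binomial coefficient $\binom{m}{j}$ is $0$ if $j<0$ or $j>m$. Quantum cohomology: $\mathbb{Z}[q]=\mathbb{Z}[q_1,\dots,q_{n-1}]$, $q^\alpha=q_1^{\alpha_1}\cdots q_{n-1}^{\alpha_{n-1}}$, and $q_{i,j}=q_iq_{i+1}\cdots q_{j-1}$ for $i<j$. $qH^*\mathbb{F}\ell_n$ is the small quantum cohomology ring of the manifold of complete flags in $\mathbb{C}^n$: it is a commutative associative $\mathbb{Z}[q]$-algebra, free as a $\mathbb{Z}[q]$-module with basis the Schubert classes $\{\mathfrak{S}_w\}_{w\in S_n}$ and unit $\mathfrak{S}_e$, whose product $\ast$ is determined by the quantum Monk formula, for $u\in S_n$, $1\le k<n$: $$\mathfrak{S}_u*\mathfrak{S}_{(k,k+1)}=\sum_{\substack{1\le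 i\le k<j\le n\\ \ell(u(i,j))=\ell(u)+1}}\mathfrak{S}_{u(i,j)}+\sum_{\substack{1\le i\le k<j\le n\\ \ell(u)+1=\ell(u(i,j))+2(j-i)}}q_{i,j}\,\mathfrak{S}_{u(i,j)}\,.$$ Quantum Schur polynomials: for a partition $\lambda=(\lambda_1\ge\dots\ge\lambda_k\ge0)$ with $\lambda_1\le n-k$, $v(\lambda,k)\in S_n$ is the permutation with $v(i)=i+\lambda_{k+1-i}$ for $i\le k$ and $v(k+1)<\dots<v(n)$. The quantum Schur polynomial $s^q_\lambda(x_1,\dots,x_k)$ is the quantum Schubert polynomial of $v(\lambda,k)$; it represents the class $\mathfrak{S}_{v(\lambda,k)}$, so $\mathfrak{S}_u*s^q_\lambda(x_1,\dots,x_k)=\mathfrak{S}_u*\mathfrak{S}_{v(\lambda,k)}$. Here $(b,1^{a-1})$ is the hook partition with $a$ parts, the first equal to $b$ and the others equal to $1$. Quantum $k$-Bruhat order $\le_k^q$ on $S_n[q]=\{q^\alpha u\mid u\in S_n,\ \alpha\in\mathbb{N}^{n-1}\}$: the partial order generated by the covers $u\lessdot_k^q u(i,j)$ if $i\le k<j$ and $\ell(u(i,j))=\ell(u)+1$; $u\lessdot_k^q q_{i,j}u(i,j)$ if $i\le k<j$ and $\ell(u)+1=\ell(u(i,j))+2(j-i)$; and extended $q$-multiplicatively ($q^\alpha u\le^q_k q^{\alpha+\beta}w$ iff $u\le_k^q q^\beta w$). It is graded by $\ell(q^\alpha u)=2\sum_i\alpha_i+\ell(u)$. For $u\le_k^q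 q^\alpha w$, $[u,q^\alpha w]_k^q$ is the interval, with rank $\ell(q^\alpha w)-\ell(u)$. For a permutation $\zeta\in S_n$: $\mathrm{supp}(\zeta)=\{i\mid\zeta(i)\ne i\}$, $\mathrm{ht}(\zeta)=\#\{i\in[n]\mid i<\zeta(i)\}$, and $s(\zeta)$ is the number of nontrivial cycles of $\zeta$. The interval $[u,q^\alpha w]_k^q$ is minimal if its rank equals $\#\mathrm{supp}(wu^{-1})-s(wu^{-1})$. *)

(* Defs.v *)
(* The index set [n] = {1, ..., n} is rendered as 'I_n = {0, ..., n-1}: the
   paper's i is the ordinal of value i - 1.  Hence i <= k < j becomes
   (i < k <= j)%N, and the paper's q_m is the variable 'X_(m-1) of
   {mpoly int[n.-1]}. *)
From HB Require Import structures.
From mathcomp Require Import all_boot all_order all_algebra all_fingroup.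
From mathcomp Require Import boolp mpoly.

Set Implicit Arguments.
Unset Strict Implicit.
Unset Printing Implicit Defensive.

Import GRing.Theory.
Local Open Scope nat_scope.

(* Composition of permutations as functions; the group law of {perm T} composes
   in the opposite order. *)
Definition pcomp (T : finType) (u v : {perm T}) : {perm T} := (v * u)%g.

Notation "u '∘p' v" := (pcomp u v) (at level 40, left associativity).

Lemma pcompE (T : finType) (u v : {perm T}) (x : T) : (u ∘p v) x = u (v x).
Proof. by rewrite /pcomp permM. Qed.

Definition ell (n : nat) (u : 'S_n) : nat :=
  #|[set p : 'I_n * 'I_n | (p.1 < p.2) && (u p.2 < u p.1)]|.

Definition psupp (n : nat) (z : 'S_n) : {set 'I_n} := [set i | z i != i].

Definition ht (n : nat) (z : 'S_n) : nat := #|[set i : 'I_n | i < z i]|.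

Definition ncyc (n : nat) (z : 'S_n) : nat :=
  #|[set C in porbits z | 1 < #|C|]|.

(* Binomial coefficient with an integer lower index, 0 outside 0 <= j <= m. *)
Definition binz (m : nat) (j : int) : nat :=
  match j with Posz i => 'C(m, i) | Negz _ => 0 end.

Definition Zq (n : nat) := {mpoly int[n.-1]}.

(* Exponent of q_{i,j} = q_i q_{i+1} ... q_{j-1}. *)
Definition qexp (n : nat) (i j : 'I_n) : 'X_{1..n.-1} :=
  [multinom (i <= m < j : nat) | m < n.-1].

Definition bruhat_step (n : nat) (u : 'S_n) (i j : 'I_n) : bool :=
  ell (u ∘p tperm i j) == (ell u).+1.

Definition quantum_step (n : nat) (u : 'S_n) (i j : 'I_n) : bool :=
  (ell u).+1 == ell (u ∘p tperm i j) + 2 * (j - i).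

(* qH^* Fl_n: a commutative Z[q]-algebra R with a family of Schubert classes
   satisfying the properties that characterise the quantum cohomology ring.
   In the Monk formula the two ordinals p, r = p + 1 are the paper's k, k + 1. *)
Record qH_flag (n : nat) (R : comAlgType (Zq n)) (S : 'S_n -> R) : Prop := {
  qH_basis : forall x : R,
    exists! c : {ffun 'S_n -> Zq n}, x = (\sum_w c w *: S w)%R;
  qH_unit : S 1%g = 1%R;
  qH_monk : forall (u : 'S_n) (p r : 'I_n), r = p.+1 :> nat ->
    (S u * S (tperm p r) =
       \sum_(i < n | (i <= p)%N) \sum_(j < n | (r <= j)%N && bruhat_step u i j)
          S (u ∘p tperm i j)
     + \sum_(i < n | (i <= p)%N) \sum_(j < n | (r <= j)%N && quantum_step u i j)
          'X_[qexp i j] *: S (u ∘p tperm i j))%R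
}.

(* v(lam, k): the paper's v(i) = i + lam_{k+1-i} (i <= k) reads, from 0,
   v(i) = i + lam`_(k-1-i) (i < k); missing parts of lam count as 0.  The
   default value 1 is not reached when lam is a partition in a k x (n-k)
   rectangle, by grass_permP below. *)
Definition is_grass (n k : nat) (lam : seq nat) (v : 'S_n) : bool :=
  [forall i : 'I_n, (i < k) ==> (v i == i + nth 0 lam (k.-1 - i) :> nat)] &&
  [forall i : 'I_n, forall j : 'I_n, (k <= i < j) ==> (v i < v j)].

Definition grass_perm (n k : nat) (lam : seq nat) : 'S_n :=
  odflt 1%g [pick v : 'S_n | is_grass k lam v].

Lemma grass_permP (n k : nat) (lam : seq nat) :
  k <= n -> sorted geq lam -> size lam <= k -> head 0 lam <= n - k ->
  is_grass k lam (grass_perm n k lam).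
Proof.
move=> le_kn srt szl hdl; rewrite /grass_perm; case: pickP => //= noP.
have mono i j : i <= j -> nth 0 lam j <= nth 0 lam i.
  move=> le_ij; case: (ltnP j (size lam)) => hj; last by rewrite nth_default.
  have tr : transitive geq by move=> y x z /= xy yz; exact: leq_trans yz xy.
  by apply: (sorted_leq_nth tr (fun x => leqnn x) 0 srt);
     rewrite ?inE //; apply: leq_ltn_trans hj.
pose g i := i + nth 0 lam (k.-1 - i).
have gmono i j : i < j -> j < k -> g i < g j.
  move=> lt_ij lt_jk; rewrite /g -addSn leq_add // mono //.
  by rewrite leq_sub2l // ltnW.
have glt i : i < k -> g i < n.
  move=> lt_ik; rewrite -(subnKC le_kn) /g -addSn leq_add //.
  by apply: leq_trans hdl; rewrite -nth0 mono.
pose L1 := map g (iota 0 k).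
pose L2 := [seq x <- iota 0 n | x \notin L1].
have uL1 : uniq L1.
  rewrite map_inj_in_uniq ?iota_uniq // => i j; rewrite !mem_iota /= !add0n.
  move=> ik jk eg; case: (ltngtP i j) => // lt.
  - by have := gmono _ _ lt jk; rewrite eg ltnn.
  - by have := gmono _ _ lt ik; rewrite eg ltnn.
have L1n : {subset L1 <= iota 0 n}.
  move=> x /mapP[i]; rewrite mem_iota add0n /= => lt_ik ->.
  by rewrite mem_iota add0n /= glt.
have pL : perm_eq (L1 ++ L2) (iota 0 n).
  apply: uniq_perm; rewrite ?iota_uniq //.
    rewrite cat_uniq uL1 filter_uniq ?iota_uniq // andbT.
    by apply/hasPn => x; rewrite mem_filter => /andP[].
  move=> x; rewrite mem_cat mem_filter.
  by case h: (x \in L1) => //=; rewrite L1n.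
pose L := L1 ++ L2.
have szL : size L = n by rewrite (perm_size pL) size_iota.
have szL1 : size L1 = k by rewrite size_map size_iota.
have uL : uniq L by rewrite (perm_uniq pL) iota_uniq.
have Llt (i : 'I_n) : nth 0 L i < n.
  have : nth 0 L i \in L by rewrite mem_nth // szL.
  by rewrite (perm_mem pL) mem_iota add0n.
pose f (i : 'I_n) := Ordinal (Llt i).
have finj : injective f.
  move=> i j /(congr1 val) /= /eqP.
  by rewrite nth_uniq ?szL // => /eqP /val_inj.
have /negP[] := negbT (noP (perm finj)).
apply/andP; split.
  apply/forallP => i; apply/implyP => lt_ik; rewrite permE /= nth_cat szL1 lt_ik.
  by rewrite (nth_map 0) ?size_iota // nth_iota.
apply/forallP => i; apply/forallP => j; apply/implyP => /andP[le_ki lt_ij].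
rewrite !permE /= !nth_cat szL1 !ltnNge le_ki (leq_trans le_ki (ltnW lt_ij)) /=.
rewrite -ltnNge.
have srt2 : sorted ltn L2 by apply: sorted_filter (iota_ltn_sorted 0 n); exact: ltn_trans.
have szL2 : size L2 = n - k by rewrite -szL size_cat szL1 addKn.
have kj : k <= j by apply: leq_trans (ltnW lt_ij).
apply: (sorted_ltn_nth ltn_trans 0 srt2); rewrite ?inE ?szL2.
- by rewrite ltn_sub2r // (leq_ltn_trans le_ki).
- by rewrite ltn_sub2r // (leq_ltn_trans kj).
- by rewrite ltn_sub2r // (leq_ltn_trans le_ki).
Qed.

(* The class represented by the quantum Schur polynomial
   s^q_lam(x_1, ..., x_k), the quantum Schubert polynomial of v(lam, k). *)
Definition qSchur (n : nat) (R : comAlgType (Zq n)) (S : 'S_n -> R)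
  (k : nat) (lam : seq nat) : R := S (grass_perm n k lam).

Definition hook (b a : nat) : seq nat := b :: nseq a.-1 1.

(* S_n[q]; the pair (alpha, u) stands for q^alpha u. *)
Definition qperm (n : nat) := ('X_{1..n.-1} * 'S_n)%type.

Definition qell (n : nat) (x : qperm n) : nat := 2 * mdeg x.1 + ell x.2.

(* The generating covers, together with all their q-multiples. *)
Definition qk_cover (n k : nat) (x y : qperm n) : Prop :=
  exists i j : 'I_n, [/\ i < k <= j, y.2 = x.2 ∘p tperm i j &
    (bruhat_step x.2 i j /\ y.1 = x.1) \/
    (quantum_step x.2 i j /\ y.1 = (x.1 + qexp i j)%MM)].

Inductive qk_le (n k : nat) (x : qperm n) : qperm n -> Prop :=
| qk_le_refl : qk_le k x x
| qk_le_cover y z : qk_le k x y -> qk_cover k y z -> qk_le k x z.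

Definition embed (n : nat) (u : 'S_n) : qperm n := (0%MM, u).

(* The interval [u, q^alpha w]_k^q is given by its top element y = q^alpha w;
   qell is monotone for qk_le, so the subtraction giving the rank is exact. *)
Definition interval_rank (n : nat) (u : 'S_n) (y : qperm n) : nat :=
  qell y - ell u.

Definition minimal_interval (n k : nat) (u : 'S_n) (y : qperm n) : Prop :=
  let z := y.2 ∘p u^-1%g in
  qk_le k (embed u) y /\ interval_rank u y = #|psupp z| - ncyc z.

(* Main.v *)
From HB Require Import structures.
From mathcomp Require Import all_boot all_order all_algebra all_fingroup.
From mathcomp Require Import boolp mpoly zify ring.
Require Import Defs.

(** Why the theorem holds.

    A permutation u maps positions to values. By the quantum Monk formula,
    multiplication by a divisor class is a sum of elementary moves, each of which
    exchanges the values at two positions. Multiplication by the difference of two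
    consecutive divisors, the Chern root x_m, is therefore the Dunkl-type element
    sum_(l!=m) tau m l, where tau i j is the move at positions i, j, with a sign that
    changes with the order of i and j. These signed moves satisfy the quadratic
    relations of Fomin and Kirillov (tau_comm4, tau_rel3, tau_sq), with tau i j ^ 2
    nonzero only when i and j are adjacent.

    A star with center b and leaf set Y is the sum, over the orderings of Y, of the
    products of the moves between the leaves and b; Phi B A distributes the leaves A
    among the centers B. In the algebra of those relations, Phi (~ A) A satisfies the
    recursion of a continuant (Phi_recursion), so it is multiplication by a quantization
    of the squarefree monomial of the Chern roots indexed by A (mult_by_sqfree). Fix the
    cut k. Summed over the sets A of a variables before the cut, or of b variables after
    it, these operators lose their cancellations (sum_sqfree_mx) and give nonnegative
    Pieri formulas for e_a and h_b (e_mxE, h_mxE). For sets A of a variables before the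
    cut and b after it, the sum is e_a h_b up to terms that are reached by shorter words
    (eh_mxE, eh_corr_ent).

    Let s be the number of cycles of the permutation of positions from u to w, and h, g
    the numbers of positions that it moves before and after the cut. The entries (u, w)
    of the operators Phi (~ A) A factor over the cycles, and in each cycle all the
    elements but one belong to A (orbit_expansion). So the generating polynomial of
    these entries, with the exponent of X counting the variables before the cut, is a
    product over the cycles C of (c_C) X^(h_C - 1) (1 + X). A sum of stars over the
    possible centers in C is 0, which makes c_C a partial sum, over the centers before
    the cut; it is nonnegative since e_a h_b is, and the values of c_C for two
    successive cuts add up to a single star, which is 0 or one monomial. Hence c_C is
    itself 0 or a monomial (cycle_val_monomial), and the generating polynomial is
    q^alpha X^(h-s) (1+X)^s or 0 (gen_structure). The exponents also show how often the
    values wrap around, whence h is the height of w u^-1 (turns_ht).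

    The hook class is the alternating sum of the quantizations of e_(a+i) h_(b-1-i); on
    X^(h-s) (1+X)^s it extracts binomial (s-1, h-a) (hook_binomial). That the monomial
    is nonzero exactly for minimal intervals (minimal_intervalP) is seen as follows. A
    nonzero entry of e_h h_(g-s) gives a path of minimal length. Conversely, the edges
    of a path of minimal length form a forest; some pendant edge of the forest can be
    moved to one end of the path (forest_pendant), where it is absorbed into e or into h
    according to the side of its leaf (fan_front, fan_back), and induction applies.
    Finally, minimal paths from the identity run through the Grassmannian permutations
    of hooks only (forest_hooks), so that the hook class is the Schubert class of the
    hook (hook_class_schubert). *)

Set Implicit Arguments.
Unset Strict Implicit.
Unset Printing Implicit Defensive.

Import Order.TTheory GRing.Theory Num.Theory.
Local Open Scope ring_scope.

(** * Sums over nested subsets *)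

Section SubsetSums.
Variables (I : finType) (A : nmodType).
Implicit Types (X Y Z : {set I}) (F : {set I} -> A) (G : {set I} -> {set I} -> A).

Lemma big_subset_in F X a : a \in X ->
  \sum_(X1 : {set I} | (X1 \subset X) && (a \in X1)) F X1
  = \sum_(Y : {set I} | Y \subset X :\ a) F (a |: Y).
Proof.
move=> aX; rewrite (reindex_onto (fun Y => a |: Y) (fun Z => Z :\ a)) /=.
  2: by move=> Z /andP[_ aZ]; rewrite setD1K.
apply: eq_bigl => Y; rewrite subUset sub1set aX setU11 /= andbT subsetD1.
apply/andP/andP => -[YX]; last by move=> aY; rewrite setU1K.
move=> /eqP e; split=> //; apply/negP => aY.
by move: (setD11 a (a |: Y)); rewrite e aY.
Qed.

Lemma exchange_subset G X :
  \sum_(Y : {set I} | Y \subset X) \sum_(Z : {set I} | Z \subset X :\: Y) G Y Z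
  = \sum_(Z : {set I} | Z \subset X) \sum_(Y : {set I} | Y \subset X :\: Z) G Y Z.
Proof.
rewrite (exchange_big_dep (fun Z : {set I} => Z \subset X)) /=.
  2: by move=> Y Z YX; rewrite subsetD => /andP[].
apply: eq_bigr => Z ZX; apply: eq_bigl => Y.
by rewrite !subsetD ZX (disjoint_sym Z Y) /=.
Qed.

Lemma nested_subset (H : {set I} -> {set I} -> {set I} -> A) X :
  \sum_(Y : {set I} | Y \subset X) \sum_(Z : {set I} | Z \subset Y)
     H Z (Y :\: Z) (X :\: Y)
  = \sum_(Z : {set I} | Z \subset X) \sum_(W : {set I} | W \subset X :\: Z)
     H Z W (X :\: Z :\: W).
Proof.
rewrite (exchange_big_dep (fun Z : {set I} => Z \subset X)) /=.
  2: by move=> Y Z YX ZY; apply: subset_trans YX.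
apply: eq_bigr => Z ZX.
rewrite (reindex_onto (fun W => Z :|: W) (fun Y => Y :\: Z)) /=.
  2: by move=> Y /andP[_ ZY]; apply/setP => i; rewrite !inE;
     case: (boolP (i \in Z)) => // iZ /=; rewrite (subsetP ZY).
have DU (W : {set I}) : W \subset X :\: Z -> (Z :|: W) :\: Z = W.
  move=> /subsetP WX; apply/setP => i; rewrite !inE.
  by case: (boolP (i \in Z)) => // iZ /=; apply/esym/negP => /WX; rewrite inE iZ.
apply: eq_big => [W|W /andP[_ /eqP e]]; last by rewrite e setDDl.
rewrite subUset ZX subsetUl /= andbT; apply/andP/idP => [[WX /eqP e]|WX].
  by apply/subsetP => i iW; rewrite inE (subsetP WX) // andbT; move: iW; rewrite -e inE => /andP[].
by rewrite DU // eqxx; move: WX; rewrite subsetD => /andP[].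
Qed.

Lemma sum_in_subset (K : I -> {set I} -> A) X :
  \sum_(Y : {set I} | Y \subset X) \sum_(a in Y) K a Y
  = \sum_(a in X) \sum_(Y : {set I} | Y \subset X :\ a) K a (a |: Y).
Proof.
rewrite (exchange_big_dep (mem X)) /=; last by move=> Y a /subsetP YX /YX.
by apply: eq_bigr => a aX; rewrite -big_subset_in.
Qed.

Lemma sum_notin_subset (K : I -> {set I} -> A) X :
  \sum_(Y : {set I} | Y \subset X) \sum_(a in X :\: Y) K a Y
  = \sum_(a in X) \sum_(Y : {set I} | Y \subset X :\ a) K a Y.
Proof.
rewrite (exchange_big_dep (mem X)) /=; last by move=> Y a _ /setDP[].
by apply: eq_bigr => a aX; apply: eq_bigl => Y; rewrite subsetD1 inE aX andbT.
Qed.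

End SubsetSums.

(** * Stars, and products of stars *)

Section Stars.
Variables (I : finType) (A : pzRingType) (t : I -> I -> A).
Implicit Types (X Y Z : {set I}) (a b c m e : I).

(** The fuel r is the cardinal of Y. *)
Fixpoint star_rec (r : nat) (b : I) (Y : {set I}) : A :=
  if r is r'.+1 then \sum_(y in Y) t y b * star_rec r' b (Y :\ y) else 1.

Definition star b Y := star_rec #|Y| b Y.

Lemma star0 b : star b set0 = 1.
Proof. by rewrite /star cards0. Qed.

Lemma star_recl b Y : Y != set0 ->
  star b Y = \sum_(y in Y) t y b * star b (Y :\ y).
Proof.
rewrite /star -card_gt0; case e: #|Y| => [//|r] _ /=.
by apply: eq_bigr => y yY; rewrite -[r]/(r.+1.-1) -e (cardsD1 y Y) yY.
Qed.

Lemma star_recr b Y : Y != set0 ->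
  star b Y = \sum_(y in Y) star b (Y :\ y) * t y b.
Proof.
have [r] := ubnP #|Y|; elim: r Y => // r IH Y; rewrite ltnS => leYr Y0.
rewrite star_recl //.
have [/cards1P[y ->]|Y1] := boolP (#|Y| == 1%N).
  by rewrite !big_set1 setDv star0 mul1r mulr1.
have Yy y : y \in Y -> Y :\ y != set0.
  move=> yY; apply: contra Y1 => /eqP e.
  by rewrite (cardsD1 y) yY e cards0.
under eq_bigr => y yY.
  rewrite IH ?Yy //; last by move: leYr; rewrite (cardsD1 y) yY.
  rewrite mulr_sumr.
over.
under [RHS]eq_bigr => y yY do rewrite star_recl ?Yy // mulr_suml.
rewrite [RHS](exchange_big_dep (mem Y)) /=; last by move=> y z yY /setD1P[].
apply: eq_bigr => y yY; apply: eq_big => [z|z zY].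
  by rewrite !inE yY andbT eq_sym andbC.
by rewrite -mulrA !setDDl setUC.
Qed.

Lemma star_rec0 b Y :
  star b Y = (Y == set0)%:R + \sum_(y in Y) t y b * star b (Y :\ y).
Proof.
have [->|Y0] := eqVneq Y set0; first by rewrite star0 big_set0 addr0.
by rewrite star_recl // add0r.
Qed.

(** The factor of the leaf a splits each ordering of Y in two. *)
Lemma star_split b a Y : a \in Y ->
  star b Y = \sum_(Z : {set I} | Z \subset Y :\ a)
               star b Z * t a b * star b (Y :\ a :\: Z).
Proof.
have [r] := ubnP #|Y|; elim: r Y => // r IH Y; rewrite ltnS => leYr aY.
rewrite star_recl; last by apply/set0Pn; exists a.
rewrite (big_setD1 a) //=.
under [RHS]eq_bigr => Z _ do rewrite star_rec0 !mulrDl.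
rewrite big_split /=; congr (_ + _).
  rewrite (bigD1 set0) ?sub0set //= eqxx !mul1r setD0 big1 ?addr0 // => Z.
  by case/andP=> _ /negbTE->; rewrite !mul0r.
under [RHS]eq_bigr => Z _ do rewrite !mulr_suml.
rewrite (sum_in_subset (fun x Z => t x b * star b (Z :\ x) * t a b * star b (Y :\ a :\: Z))).
apply: eq_bigr => x /setD1P[xa xY]; rewrite IH; first last.
- by rewrite !inE eq_sym xa.
- by move: leYr; rewrite (cardsD1 x) xY.
rewrite mulr_sumr setDDl setUC -setDDl; apply: eq_bigr => Z.
by rewrite subsetD1 => /andP[_ xZ]; rewrite setU1K // -!setDDl !mulrA.
Qed.

(** The leaves X are distributed among the centers B; a center may get none. *)
Fixpoint Phi (B : seq I) (X : {set I}) : A :=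
  if B is b :: B' then \sum_(Y : {set I} | Y \subset X) star b Y * Phi B' (X :\: Y)
  else (X == set0)%:R.

Lemma Phi_cons b B X :
  Phi (b :: B) X = \sum_(Y : {set I} | Y \subset X) star b Y * Phi B (X :\: Y).
Proof. by []. Qed.

Lemma big_subset0 (F : {set I} -> A) : \sum_(Y : {set I} | Y \subset set0) F Y = F set0.
Proof. by rewrite (big_pred1 set0) // => Y; rewrite subset0. Qed.

Lemma Phi_set0 B : Phi B set0 = 1.
Proof.
by elim: B => [|b B IH] /=; rewrite ?eqxx // big_subset0 star0 set0D IH mul1r.
Qed.

Lemma Phi_cat B1 B2 X : Phi (B1 ++ B2) X =
  \sum_(Y : {set I} | Y \subset X) Phi B1 Y * Phi B2 (X :\: Y).
Proof.
elim: B1 X => [|b B1 IH] X /=.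
  rewrite (bigD1 set0) ?sub0set //= eqxx mul1r setD0 big1 ?addr0 // => Y.
  by case/andP=> _ /negbTE->; rewrite mul0r.
under eq_bigr => Y _ do rewrite IH mulr_sumr.
rewrite -(nested_subset (fun Z W R => star b Z * (Phi B1 W * Phi B2 R))).
by apply: eq_bigr => Y _; rewrite mulr_suml; apply: eq_bigr => Z _; rewrite mulrA.
Qed.

(* Far commutation alone makes the order of the centers irrelevant. *)
Hypothesis comm4 : forall a b c e, uniq [:: a; b; c; e] ->
  t a b * t c e = t c e * t a b.

Lemma star_comm1 a c b Y : a != c -> a \notin b |: Y -> c \notin b |: Y -> b \notin Y ->
  t a c * star b Y = star b Y * t a c.
Proof.
move=> ac; have [r] := ubnP #|Y|; elim: r Y => // r IH Y; rewrite ltnS => leYr aY cY bY.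
have [->|Y0] := eqVneq Y set0; first by rewrite star0 mulr1 mul1r.
rewrite star_recl // mulr_sumr mulr_suml; apply: eq_bigr => y yY.
have sub z : z \notin b |: Y -> z \notin b |: (Y :\ y).
  by apply: contra; rewrite !inE => /orP[->//|/andP[_ ->]]; rewrite orbT.
rewrite mulrA -comm4 //; last first.
  move: aY cY; rewrite /= !inE !negb_or ac /= => /andP[ab aY] /andP[cb cY].
  rewrite !(eq_sym b) ab cb !andbT /= (memPn aY) // (memPn cY) // !andbT.
  by apply: contraNneq bY => <-.
rewrite -mulrA IH ?mulrA ?sub //; last by rewrite !inE negb_and bY orbT.
by move: leYr; rewrite (cardsD1 y) yY.
Qed.

Lemma star_comm b c Y Z : b \notin Y -> c \notin Z -> [disjoint b |: Y & c |: Z] ->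
  star b Y * star c Z = star c Z * star b Y.
Proof.
move=> bY; have [r] := ubnP #|Z|; elim: r Z => // r IH Z; rewrite ltnS => leZr cZ dYZ.
have [->|Z0] := eqVneq Z set0; first by rewrite star0 mulr1 mul1r.
rewrite (star_recl c) // mulr_sumr mulr_suml; apply: eq_bigr => z zZ.
have nY x : x \in c |: Z -> x \notin b |: Y.
  by move=> xZ; rewrite (disjointFl dYZ).
rewrite mulrA -star_comm1 ?nY ?inE ?zZ ?eqxx ?orbT //; last by apply: contraNneq cZ => <-.
rewrite -!mulrA IH ?inE ?negb_and ?cZ ?orbT //.
  by move: leZr; rewrite (cardsD1 z) zZ.
by apply: disjointWr dYZ; rewrite setUS // subD1set.
Qed.

(** The configurations for which Phi B X is meaningful: distinct centers, none of which
    is a leaf. *)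
Definition apart (B : seq I) (X : {set I}) := uniq B /\ {in B, forall b, b \notin X}.

Lemma apartS B X Y : Y \subset X -> apart B X -> apart B Y.
Proof. by move=> YX [uB dB]; split=> // b /dB; apply: contra; apply: (subsetP YX). Qed.

Lemma apart_cons b B X : apart (b :: B) X -> [/\ b \notin X, b \notin B & apart B X].
Proof.
case=> /= /andP[bB uB] dB; split=> //; first by apply: dB; rewrite inE eqxx.
by split=> // c cB; apply: dB; rewrite inE cB orbT.
Qed.

Lemma Phi_comm1 a c B X : a != c -> a \notin B -> c \notin B -> a \notin X -> c \notin X ->
  apart B X -> t a c * Phi B X = Phi B X * t a c.
Proof.
move=> ac; elim: B X => [|b B IH] X aB cB aX cX.
  by rewrite /=; case: (X == set0); rewrite ?mulr1 ?mul1r ?mulr0 ?mul0r.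
case/apart_cons=> bX bB wB; rewrite /= mulr_sumr mulr_suml.
move: aB cB; rewrite !inE !negb_or => /andP[ab aB] /andP[cb cB].
apply: eq_bigr => Y YX.
have nY x : x \notin X -> x \notin Y by apply: contra; apply: (subsetP YX).
rewrite mulrA star_comm1 ?inE ?negb_or ?ab ?cb ?nY //.
rewrite -!mulrA IH ?inE ?negb_and ?aX ?cX ?orbT //.
by apply: apartS wB; rewrite subsetDl.
Qed.

Lemma star_Phi_comm b Y B X : b \notin Y -> b \notin B -> b \notin X ->
  [disjoint Y & X] -> {in B, forall c, c \notin Y} -> apart B X ->
  star b Y * Phi B X = Phi B X * star b Y.
Proof.
move=> bY; elim: B X => [|c B IH] X bB bX dYX BY.
  by rewrite /=; case: (X == set0); rewrite ?mulr1 ?mul1r ?mulr0 ?mul0r.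
case/apart_cons=> cX cB wB; rewrite /= mulr_sumr mulr_suml.
move: bB; rewrite !inE negb_or => /andP[bc bB].
apply: eq_bigr => Z ZX.
have nZ x : x \notin X -> x \notin Z by apply: contra; apply: (subsetP ZX).
rewrite mulrA star_comm ?nZ //.
  rewrite -!mulrA IH ?inE ?negb_and ?bX ?orbT //.
  - by apply: disjointWr dYX; rewrite subsetDl.
  - by move=> x xB; apply: BY; rewrite inE xB orbT.
  - by apply: apartS wB; rewrite subsetDl.
rewrite -setI_eq0 -subset0; apply/subsetP => x; rewrite !inE.
case/andP=> /orP[/eqP->|xY] /orP[/eqP e|xZ].
- by rewrite e eqxx in bc.
- by rewrite (negbTE (nZ _ bX)) in xZ.
- by have := BY c; rewrite -e inE eqxx xY => /(_ isT).
- by have := subsetP ZX x xZ; rewrite (disjointFr dYX xY).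
Qed.

Lemma Phi_pull b B X : b \in B -> apart B X ->
  Phi B X = \sum_(Y : {set I} | Y \subset X) star b Y * Phi (rem b B) (X :\: Y).
Proof.
elim: B X => // c B IH X; rewrite inE.
have [->|bc] /= := eqVneq b c; first by rewrite eqxx.
rewrite eq_sym (negbTE bc) => bB /apart_cons[cX cB wB].
have [uB dB] := wB.
have wBD Z : apart B (X :\: Z) by apply: apartS wB; rewrite subsetDl.
under eq_bigr => Z _ do rewrite IH // mulr_sumr.
rewrite exchange_subset; apply: eq_bigr => Y YX; rewrite mulr_sumr.
apply: eq_bigr => Z; rewrite subsetD => /andP[ZX ZY].
rewrite !mulrA (setDDl X) (setUC Z) -(setDDl X) star_comm //.
- by apply: contra cX; apply: (subsetP ZX).
- by apply: contra (dB b bB); apply: (subsetP YX).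
rewrite -setI_eq0 -subset0; apply/subsetP => x; rewrite !inE.
case/andP=> /orP[/eqP->|xZ] /orP[/eqP e|xY].
- by rewrite e eqxx in bc.
- by rewrite (subsetP YX) in cX.
- by have := dB b bB; rewrite -e (subsetP ZX).
- by rewrite (disjointFr ZY xZ) in xY.
Qed.

(** Stars on disjoint sets commute. *)
Lemma Phi_perm B B' X : perm_eq B B' -> apart B X -> Phi B X = Phi B' X.
Proof.
elim: B B' X => [|b B IH] B' X eB wB.
  by move: eB; rewrite perm_sym => /perm_nilP->.
have bB' : b \in B' by rewrite -(perm_mem eB) inE eqxx.
have wB' : apart B' X.
  by case: wB => uB dB; split=> [|c]; rewrite -?(perm_uniq eB) // -(perm_mem eB); apply: dB.
rewrite (Phi_pull bB') //= ; apply: eq_bigr => Y YX; congr (_ * _); apply: IH.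
  by rewrite -(perm_cons b) (permPl eB) perm_to_rem.
by case/apart_cons: wB => _ _ wB; apply: apartS wB; rewrite subsetDl.
Qed.

Hypothesis rel3 : forall i j k, uniq [:: i; j; k] ->
  t i j * t j k = t j k * t i k + t i k * t i j.

(** The new leaf m is moved through the star from the left by the three-term relation:
    it stops at some place of the ordering, or it replaces a leaf a, and the move (m, a)
    comes out on the right. *)
Lemma star_insert m b Y : m != b -> m \notin Y -> b \notin Y ->
  (t m b + \sum_(a in Y) t m a) * star b Y =
  star b (m |: Y) + \sum_(a in Y) star b (m |: (Y :\ a)) * t m a.
Proof.
move=> mb; have [r] := ubnP #|Y|; elim: r Y => // r IH Y; rewrite ltnS => leYr mY bY.
have [->|Y0] := eqVneq Y set0.
  rewrite !big_set0 setU0 star0 !addr0 mulr1 star_recl ?big_set1 ?setDv ?star0 ?mulr1 //.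
  by apply/set0Pn; exists m; rewrite inE.
have mYc c : c \in Y -> m != c by move=> cY; apply: contraNneq mY => ->.
have bYc c : c \in Y -> c != b by move=> cY; apply: contraNneq bY => <-.
(* peel off the first factor of each ordering of Y *)
have -> : (t m b + \sum_(a in Y) t m a) * star b Y =
  \sum_(c in Y) (t m b * t c b * star b (Y :\ c) + t m b * star b (Y :\ c) * t m c
     + t c b * ((t m b + \sum_(a in Y :\ c) t m a) * star b (Y :\ c))).
  rewrite star_recl // mulr_sumr; apply: eq_bigr => c cY.
  rewrite mulrA mulrDl mulr_suml (big_setD1 c) //=.
  rewrite rel3; last by rewrite /= !inE negb_or (mYc c) // mb /= andbT bYc.
  under [X in _ + (_ + X)]eq_bigr => a /setD1P[ac aY].
    rewrite comm4; last first.
      by rewrite /= !inE !negb_or (mYc a) // (mYc c) // mb ac !bYc.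
    over.
  rewrite -mulr_sumr -[t m b * star b _ * _]mulrA -star_comm1; first last.
  - by rewrite inE negb_and bY orbT.
  - by rewrite !inE eqxx orbF bYc.
  - by rewrite !inE negb_or mb negb_and mY orbT.
  - exact: mYc.
  by rewrite [t c b * (_ * _)]mulrA mulrDr !mulrDl !mulrA -!addrA; congr (_ + _); rewrite addrCA.
under eq_bigr => c cY.
  rewrite IH; first last.
  - by rewrite inE negb_and bY orbT.
  - by rewrite inE negb_and mY orbT.
  - by move: leYr; rewrite (cardsD1 c) cY.
  rewrite mulrDr mulr_sumr; over.
rewrite !big_split /=.
rewrite [star b (m |: Y)]star_recl; last by apply/set0Pn; exists m; rewrite setU11.
rewrite big_setU1 //= setU1K //.
have -> : \sum_(i in Y) t m b * t i b * star b (Y :\ i) = t m b * star b Y.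
  by rewrite [in RHS]star_recl // mulr_sumr; apply: eq_bigr => i _; rewrite mulrA.
have -> : \sum_(i in Y) t i b * star b ((m |: Y) :\ i) = \sum_(i in Y) t i b * star b (m |: (Y :\ i)).
  apply: eq_bigr => i iY; congr (_ * star b _); apply/setP => x; rewrite !inE.
  by have [->|] := eqVneq x m; rewrite ?mYc.
rewrite -!addrA; congr (_ + _); rewrite addrCA; congr (_ + _).
under [RHS]eq_bigr => a aY.
  rewrite [star _ _]star_recl; last by apply/set0Pn; exists m; rewrite setU11.
  rewrite big_setU1 /= ?setU1K ?inE ?negb_and ?mY ?orbT // mulrDl.
over.
rewrite big_split /=; congr (_ + _).
under [RHS]eq_bigr => a aY do rewrite mulr_suml.
rewrite (exchange_big_dep (mem Y)) /=; last by move=> a c aY /setD1P[].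
apply: eq_bigr => a aY; apply: eq_big => [c|c /andP[cY ca]].
  by rewrite !inE aY andbT andbC eq_sym.
rewrite mulrA; congr (_ * star b _ * _); apply/setP => x; rewrite !inE.
have [->|] /= := eqVneq x m; last by rewrite andbCA.
by rewrite mYc //; case/setD1P: ca.
Qed.

Lemma Phi_consU b B m X : m \notin X ->
  Phi (b :: B) (m |: X) =
    \sum_(Y : {set I} | Y \subset X) star b (m |: Y) * Phi B (X :\: Y)
  + \sum_(Y : {set I} | Y \subset X) star b Y * Phi B (m |: (X :\: Y)).
Proof.
move=> mX; rewrite /= (bigID (fun Y : {set I} => m \in Y)) /=; congr (_ + _).
  rewrite big_subset_in ?setU11 // setU1K //; apply: eq_bigr => Y YX.
  congr (_ * Phi _ _); apply/setP => x; rewrite !inE.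
  by have [->|] := eqVneq x m; rewrite //= (negbTE mX) andbF.
apply: eq_big => [Y|Y /andP[_ mY]].
  by rewrite -[in RHS](setU1K mX) subsetD1.
congr (_ * Phi _ _); apply/setP => x; rewrite !inE.
by have [->|] := eqVneq x m; rewrite ?mY.
Qed.

(** The same for several centers: m becomes a leaf of any of them. *)
Lemma Phi_insert m B X : m \notin B -> m \notin X -> apart B X ->
  (\sum_(b <- B) t m b + \sum_(a in X) t m a) * Phi B X =
  Phi B (m |: X) + \sum_(a in X) Phi B (m |: (X :\ a)) * t m a.
Proof.
elim: B X => [|b B IH] X mB mX wB.
  rewrite big_nil add0r /=.
  have -> (Y : {set I}) : m |: Y == set0 = false.
    by apply/negbTE/set0Pn; exists m; rewrite setU11.
  rewrite add0r [RHS]big1 => [|a aX]; last first.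
    by rewrite (_ : _ == _ = false) ?mul0r //; apply/negbTE/set0Pn; exists m; rewrite setU11.
  by have [->|] := eqVneq; rewrite ?mulr0 // big_set0 mul0r.
case/apart_cons: wB => bX bB wB; move: mB; rewrite !inE negb_or => /andP[mb mB].
have sX Y x : Y \subset X -> x \notin X -> x \notin Y.
  by move=> YX; apply: contra; apply: (subsetP YX).
have mXc c : c \in X -> m != c by move=> cX; apply: contraNneq mX => ->.
have [uB dB] := wB.
have -> : (\sum_(b0 <- b :: B) t m b0 + \sum_(a in X) t m a) * Phi (b :: B) X =
  \sum_(Y : {set I} | Y \subset X)
   ((star b (m |: Y) * Phi B (X :\: Y) + star b Y * Phi B (m |: (X :\: Y)))
   + (\sum_(a in Y) star b (m |: (Y :\ a)) * Phi B (X :\: Y) * t m a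
    + \sum_(a in X :\: Y) star b Y * Phi B (m |: (X :\: Y :\ a)) * t m a)).
  rewrite Phi_cons mulr_sumr; apply: eq_bigr => Y YX.
  have wBY : apart B (X :\: Y) by apply: apartS wB; rewrite subsetDl.
  rewrite big_cons (big_setID Y) /= (setIidPr YX) addrACA mulrDl !mulrA.
  rewrite star_insert ?(sX Y) // mulrDl.
  have -> : (\sum_(j <- B) t m j + \sum_(a in X :\: Y) t m a) * star b Y =
            star b Y * (\sum_(j <- B) t m j + \sum_(a in X :\: Y) t m a).
    rewrite mulrDl mulrDr !mulr_suml !mulr_sumr; congr (_ + _).
      rewrite !big_seq; apply: eq_bigr => c cB.
      have mc : m != c by apply: (memPnC mB).
      have cb : c != b by apply: (memPn bB).
      rewrite star_comm1 // ?inE ?negb_or ?mb ?cb //=; apply: sX => //; exact: dB.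
    apply: eq_bigr => c /setDP[cX cY].
    have cb : c != b by apply: contraNneq bX => <-.
    by rewrite star_comm1 ?mXc ?inE ?negb_or ?mb ?cb ?cY ?(sX Y).
  rewrite -[X in _ + X = _]mulrA IH //; last by rewrite inE negb_and mX orbT.
  rewrite mulrDr -!addrA; congr (_ + _); rewrite addrCA; congr (_ + _).
  rewrite mulr_suml mulr_sumr; congr (_ + _); last by apply: eq_bigr => a _; rewrite mulrA.
  apply: eq_bigr => a aY; rewrite -!mulrA; congr (_ * _).
  rewrite Phi_comm1 ?inE ?negb_and ?mX ?aY ?orbT //.
    by apply: mXc; apply: (subsetP YX).
  by apply: contraL aY => aB; apply: sX => //; apply: dB.
set R := (X in _ = _ + X).
rewrite 3!big_split /= -Phi_consU //; congr (_ + _); rewrite {}/R.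
rewrite sum_in_subset sum_notin_subset -big_split; apply: eq_bigr => a aX.
rewrite Phi_consU; last by rewrite inE negb_and mX orbT.
rewrite mulrDl !mulr_suml; congr (_ + _); apply: eq_bigr => Y.
  by rewrite subsetD1 => /andP[YX aY]; rewrite setU1K // setDDl.
by move=> _; rewrite !setDDl (setUC Y).
Qed.

Hypothesis anti : forall i j, i != j -> t j i = - t i j.

Definition weighted_stars (p : I -> A) X := \sum_(l in X) p l * star l (X :\ l).

(** Dropping an element e from the index set expresses the sum by itself on smaller
    sets: by antisymmetry the terms in which e is the center cancel. *)
Lemma weighted_stars_rot p e Y : (forall l x, p l * x = x * p l) ->
  e \notin Y -> Y != set0 ->
  (\sum_(c in Y) t e c) * weighted_stars p Y =
  weighted_stars p (e |: Y) + \sum_(a in Y) weighted_stars p (e |: (Y :\ a)) * t e a.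
Proof.
move=> pC eY Y0; rewrite /weighted_stars.
have eYc c : c \in Y -> e != c by move=> cY; apply: contraNneq eY => ->.
have -> : (\sum_(c in Y) t e c) * (\sum_(l in Y) p l * star l (Y :\ l)) =
  \sum_(l in Y) p l * star l (e |: (Y :\ l))
  + \sum_(l in Y) \sum_(a in Y :\ l) p l * (star l (e |: (Y :\ l :\ a)) * t e a).
  rewrite -big_split mulr_sumr; apply: eq_bigr => l lY.
  rewrite mulrA -pC -mulrA (big_setD1 l) //= star_insert ?eYc ?inE ?negb_and ?eqxx ?eY ?orbT //.
  by rewrite mulrDr mulr_sumr.
have e1 Z : e \notin Z -> \sum_(l in e |: Z) p l * star l ((e |: Z) :\ l) =
  p e * star e Z + \sum_(l in Z) p l * star l (e |: (Z :\ l)).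
  move=> eZ; rewrite big_setU1 //= setU1K //; congr (_ + _); apply: eq_bigr => l lZ.
  congr (_ * star l _); apply/setP => x; rewrite !inE.
  by have [->|] := eqVneq x e; rewrite //= andbT; apply: contraNneq eZ => ->.
rewrite e1 //; under [X in _ = _ + X]eq_bigr => a aY do
  rewrite e1 ?inE ?negb_and ?eY ?orbT // mulrDl mulr_suml.
rewrite big_split /=.
have -> : \sum_(i in Y) p e * star e (Y :\ i) * t e i = - (p e * star e Y).
  rewrite star_recr // mulr_sumr -sumrN; apply: eq_bigr => i iY.
  by rewrite (anti (eYc _ iY)) !mulrN opprK mulrA.
rewrite addrACA addrN add0r; congr (_ + _).
rewrite (exchange_big_dep (mem Y)) /=; last by move=> a c aY /setD1P[].
apply: eq_bigr => a aY; apply: eq_big => [c|c /andP[cY ca]].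
  by rewrite !inE aY andbT andbC eq_sym.
by rewrite mulrA !setDDl (setUC [set c]).
Qed.

(** A single orbit can be swept from any of its elements taken as a center, with signs
    that cancel. The preceding recursion, with all weights 1, gives it by induction. *)
Lemma sum_stars0 (C : {set I}) : (1 < #|C|)%N -> \sum_(b in C) star b (C :\ b) = 0.
Proof.
have -> : \sum_(b in C) star b (C :\ b) = weighted_stars (fun _ => 1) C.
  by apply: eq_bigr => b _; rewrite mul1r.
have [r] := ubnP #|C|; elim: r C => // r IH C; rewrite ltnS => leC C1.
have [e eC] : exists e, e \in C by apply/card_gt0P; apply: ltn_trans C1.
have eY : e \notin C :\ e by rewrite !inE eqxx.
have cY : #|C| = #|C :\ e|.+1 by rewrite (cardsD1 e) eC.
have Y0 : C :\ e != set0 by rewrite -card_gt0 -ltnS -cY.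
have p1 (l : I) (x : A) : 1 * x = x * 1 by rewrite mul1r mulr1.
have := weighted_stars_rot p1 eY Y0; rewrite setD1K // => /esym.
move/(canRL (addrK _)) => ->.
have [/cards1P[y ey]|ny] := boolP (#|C :\ e| == 1%N).
  rewrite ey !big_set1 setDv setU0 /weighted_stars !big_set1 !setDv !star0.
  by rewrite !mul1r mulr1 subrr.
have Y1 : (1 < #|C :\ e|)%N by rewrite ltn_neqAle eq_sym ny card_gt0.
rewrite IH //; last by rewrite -cY.
rewrite mulr0 sub0r big1 ?oppr0 // => a aY.
have ecard : #|e |: (C :\ e) :\ a| = #|C :\ e|.
  by rewrite cardsU1 inE negb_and eY orbT (cardsD1 a (C :\ e)) aY.
by rewrite IH ?ecard -?cY ?mul0r.
Qed.

Section Squares.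
Variable p : I -> I -> A.
Hypothesis pC : forall i j x, p i j * x = x * p i j.
Hypothesis sq : forall i j, i != j -> t i j * t i j = p i j.

(** The first and the last letter of each word use the same leaf. *)
Definition closed_stars m X := \sum_(y in X) t y m * star m (X :\ y) * t y m.

(** Closed stars obey the same recursion as weighted stars, so the two agree as soon as
    they agree on singletons, which is the relation for squares. *)
Lemma closed_stars_rot m e Y : e != m -> e \notin Y -> m \notin Y -> Y != set0 ->
  (\sum_(c in Y) t e c) * closed_stars m Y =
  closed_stars m (e |: Y) + \sum_(a in Y) closed_stars m (e |: (Y :\ a)) * t e a.
Proof.
move=> em eY mY Y0; rewrite /closed_stars.
have eYc c : c \in Y -> e != c by move=> cY; apply: contraNneq eY => ->.
have mYc c : c \in Y -> c != m by move=> cY; apply: contraNneq mY => <-.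
have comY y c : y \in Y -> c \in Y :\ y -> t e c * t y m = t y m * t e c.
  move=> yY /setD1P[cy cY]; apply: comm4.
  by rewrite /= !inE !negb_or (eYc c) // (eYc y) // em cy !mYc.
have -> : (\sum_(c in Y) t e c) * (\sum_(y in Y) t y m * star m (Y :\ y) * t y m) =
  \sum_(y in Y) (t y m * star m (e |: (Y :\ y)) * t y m
     + \sum_(a in Y :\ y) t y m * star m (e |: (Y :\ y :\ a)) * t y m * t e a
     + (t e m * star m (Y :\ y) * t y m * t e m
     + t e m * star m (Y :\ y) * t e m * t e y)).
  rewrite mulr_sumr; apply: eq_bigr => y yY.
  have key : (\sum_(c in Y) t e c) * t y m =
      t y m * (t e m + \sum_(a in Y :\ y) t e a) + t e m * t e y.
    rewrite (big_setD1 y) //= mulrDl rel3; last first.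
      by rewrite /= !inE negb_or (eYc y) // em mYc.
    rewrite mulr_suml; under [X in _ + X]eq_bigr => c cY do rewrite comY //.
    by rewrite -mulr_sumr mulrDr addrAC.
  have cey : t e y * star m (Y :\ y) = star m (Y :\ y) * t e y.
    rewrite star_comm1 ?eYc ?inE ?negb_or ?negb_and ?em ?eY ?mY ?orbT ?eqxx //=.
    by rewrite andbT mYc.
  rewrite !mulrA key !mulrDl; congr (_ + _).
    rewrite -[X in X * t y m = _]mulrA star_insert ?inE ?negb_and ?eY ?mY ?orbT //.
    rewrite mulrDr mulrDl mulr_sumr mulr_suml; congr (_ + _); apply: eq_bigr => a aY.
    by rewrite -!mulrA comY.
  rewrite -[_ * t e y * _]mulrA cey -!mulrA rel3; last first.
    by rewrite /= !inE negb_or (eYc y) // em mYc.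
  by rewrite !mulrDr !mulrA.
rewrite !big_split /=.
have e1 Z : e \notin Z -> \sum_(y in e |: Z) t y m * star m ((e |: Z) :\ y) * t y m =
  t e m * star m Z * t e m + \sum_(y in Z) t y m * star m (e |: (Z :\ y)) * t y m.
  move=> eZ; rewrite big_setU1 //= setU1K //; congr (_ + _); apply: eq_bigr => y yZ.
  congr (_ * star m _ * _); apply/setP => x; rewrite !inE.
  by have [->|] := eqVneq x e; rewrite //= andbT; apply: contraNneq eZ => ->.
rewrite e1 //.
have -> : \sum_(i in Y) t e m * star m (Y :\ i) * t i m * t e m = t e m * star m Y * t e m.
  by rewrite (star_recr _ Y0) mulr_sumr mulr_suml; apply: eq_bigr => i _; rewrite !mulrA.
rewrite addrACA [X in X + _ = _]addrC; congr (_ + _); rewrite addrC.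
under [RHS]eq_bigr => a aY do rewrite e1 ?inE ?negb_and ?eY ?orbT // mulrDl mulr_suml.
rewrite big_split /=; congr (_ + _).
rewrite (exchange_big_dep (mem Y)) /=; last by move=> a c aY /setD1P[].
apply: eq_bigr => a aY; apply: eq_big => [c|c /andP[cY ca]].
  by rewrite !inE aY andbT andbC eq_sym.
by rewrite !setDDl (setUC [set c]).
Qed.

Lemma closed_starsE m X : m \notin X -> closed_stars m X = weighted_stars (p^~ m) X.
Proof.
have [r] := ubnP #|X|; elim: r X => // r IH X; rewrite ltnS => leX mX.
have [->|/set0Pn[e eX]] := eqVneq X set0.
  by rewrite /closed_stars /weighted_stars !big_set0.
have em : e != m by apply: contraNneq mX => <-.
have [eY|Y0] := eqVneq (X :\ e) set0.
  have -> : X = [set e] by rewrite -[LHS](setD1K eX) eY setU0.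
  by rewrite /closed_stars /weighted_stars !big_set1 /= setDv !star0 !mulr1 sq.
have eY : e \notin X :\ e by rewrite !inE eqxx.
have mY : m \notin X :\ e by rewrite inE negb_and mX orbT.
have cX : (#|X :\ e| < r)%N by move: leX; rewrite (cardsD1 e) eX.
have := closed_stars_rot em eY mY Y0; have := @weighted_stars_rot (p^~ m) e _ _ eY Y0.
rewrite !setD1K // IH // => -> // /esym; rewrite addrC [RHS]addrC.
set S := \sum_(a in _) _; set S' := \sum_(a in _) _ * _.
have -> : S' = S; last by move/addrI.
apply: eq_bigr => a aY; rewrite IH //; last first.
  by rewrite !inE !negb_or eq_sym em negb_and mX !orbT.
by rewrite cardsU1 inE negb_and eY orbT; move: cX; rewrite (cardsD1 a) aY.
Qed.

(** A move (a, m) that closes up with the occurrence of a in the star splits off a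
    closed star; replacing the latter by weighted stars leaves two stars and one square. *)
Lemma loop_stars m X : m \notin X ->
  \sum_(a in X) t a m * star m X =
  \sum_(l in X) p l m * \sum_(Z : {set I} | Z \subset X :\ l)
     star l Z * star m (X :\ l :\: Z).
Proof.
move=> mX.
under eq_bigr => a aX.
  rewrite (star_split m aX) mulr_sumr.
  under eq_bigr => Y.
    rewrite subsetD1 => /andP[YX aY]; rewrite !mulrA -[Y in star m Y](setU1K aY) setDDl; over.
over.
rewrite -(sum_in_subset (fun a Z => t a m * star m (Z :\ a) * t a m * star m (X :\: Z))).
under eq_bigr => Z ZX.
  rewrite -mulr_suml -/(closed_stars m Z) closed_starsE; last first.
    by apply: contra mX; apply: (subsetP ZX).
  rewrite mulr_suml; over.
rewrite (sum_in_subset (fun l Z => p l m * star l (Z :\ l) * star m (X :\: Z))).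
apply: eq_bigr => l lX; rewrite mulr_sumr; apply: eq_bigr => Z.
by rewrite subsetD1 => /andP[_ lZ]; rewrite setU1K // -setDDl mulrA.
Qed.

(** One more index m: the analogue for products of stars of the expansion of a
    continuant, that is of a tridiagonal determinant, along its last row. *)
Lemma Phi_recursion m B X : m \notin B -> m \notin X -> apart B X ->
  Phi B (m |: X) =
    (\sum_(b <- B) t m b + \sum_(a in X) t m a) * Phi (m :: B) X
    + \sum_(l in X) p l m * Phi (l :: m :: B) (X :\ l).
Proof.
move=> mB mX wB; have [uB dB] := wB.
have sX Y x : Y \subset X -> x \notin X -> x \notin Y.
  by move=> YX; apply: contra; apply: (subsetP YX).
have mXc c : c \in X -> m != c by move=> cX; apply: contraNneq mX => ->.
have sPC c Y W : c \notin B -> c \notin X :\: W -> c \notin Y -> Y \subset W -> W \subset X ->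
    star c Y * Phi B (X :\: W) = Phi B (X :\: W) * star c Y.
  move=> cB cW cY YW WX; rewrite star_Phi_comm //.
  - by apply: disjointWl YW _; rewrite disjoint_sym disjoints_subset setDE subsetIr.
  - by move=> x xB; apply: (sX Y); [apply: subset_trans WX | apply: dB].
  - by apply: apartS wB; rewrite subsetDl.
have -> : (\sum_(b <- B) t m b + \sum_(a in X) t m a) * Phi (m :: B) X =
  \sum_(Y : {set I} | Y \subset X)
   (Phi B (m |: (X :\: Y)) * star m Y
    + \sum_(a in X :\: Y) Phi B (m |: (X :\: Y :\ a)) * t m a * star m Y
    + Phi B (X :\: Y) * \sum_(a in Y) t m a * star m Y).
  rewrite Phi_cons mulr_sumr; apply: eq_bigr => Y YX.
  have mY : m \notin Y by apply: sX.
  have mXY : m \notin X :\: Y by rewrite inE negb_and mX orbT.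
  have wBY : apart B (X :\: Y) by apply: apartS wB; rewrite subsetDl.
  rewrite sPC // mulrA (big_setID Y) /= (setIidPr YX) addrCA addrC mulrDl Phi_insert //.
  rewrite !mulrDl -mulr_suml; congr (_ + _).
  rewrite -mulrA mulr_suml mulr_sumr; apply: eq_bigr => a aY.
  have aX : a \in X by apply: (subsetP YX).
  rewrite !mulrA Phi_comm1 ?mXc ?inE ?negb_and ?aY ?mX ?orbT //.
  by apply: contraL aX => aB; apply: dB.
set R := (X in _ = _ + X).
rewrite !big_split /=.
have -> : \sum_(Y : {set I} | Y \subset X)
    \sum_(a in X :\: Y) Phi B (m |: (X :\: Y :\ a)) * t m a * star m Y =
  Phi B (m |: X) - \sum_(Y : {set I} | Y \subset X) Phi B (m |: (X :\: Y)) * star m Y.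
  rewrite sum_notin_subset; apply/eqP; rewrite eq_sym subr_eq eq_sym addrC; apply/eqP.
  under eq_bigr => Y _ do rewrite star_rec0 mulrDr.
  rewrite big_split /= -addrA -[RHS]addr0; congr (_ + _).
    rewrite (bigD1 set0) ?sub0set //= eqxx mulr1 setD0 big1 ?addr0 // => Y.
    by case/andP=> _ /negbTE->; rewrite mulr0.
  under eq_bigr => Y _ do rewrite mulr_sumr.
  rewrite (sum_in_subset (fun a Y => Phi B (m |: (X :\: Y)) * (t a m * star m (Y :\ a)))).
  rewrite -big_split big1 //= => a aX; rewrite -big_split big1 //= => Y.
  rewrite subsetD1 => /andP[_ aY]; rewrite setU1K // setDDl (setUC Y) (anti (mXc _ aX)).
  by rewrite mulNr mulrN mulrA addNr.
rewrite addrCA subrr addr0 -addrA -[LHS]addr0; congr (_ + _); apply/esym; rewrite {}/R.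
under eq_bigr => Y YX.
  have -> : \sum_(a in Y) t m a * star m Y = - \sum_(a in Y) t a m * star m Y.
    rewrite -sumrN; apply: eq_bigr => a aY.
    by rewrite (anti (mXc _ (subsetP YX _ aY))) mulNr opprK.
  rewrite loop_stars ?(sX Y) // mulrN mulr_sumr; over.
rewrite sumrN (sum_in_subset (fun l Y => Phi B (X :\: Y) * (p l m * \sum_(Z : {set I} | Z \subset Y :\ l)
     star l Z * star m (Y :\ l :\: Z)))).
apply/eqP; rewrite addrC subr_eq0; apply/eqP; apply: eq_bigr => l lX.
under [RHS]eq_bigr => Y.
  rewrite subsetD1 => /andP[YX lY]; rewrite mulrA -pC -mulrA setU1K //; over.
rewrite -mulr_sumr; congr (_ * _); rewrite Phi_cons.
under eq_bigr => Z _ do rewrite Phi_cons mulr_sumr.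
rewrite -(nested_subset (fun Z W R => star l Z * (star m W * Phi B R))).
apply: eq_bigr => Y; rewrite subsetD1 => /andP[YX lY]; rewrite mulr_sumr.
apply: eq_bigr => Z ZY.
have lB : l \notin B by apply: contraL lX; apply: dB.
have lYX : l |: Y \subset X by rewrite subUset sub1set lX.
have nl : l \notin X :\: (l |: Y) by rewrite !inE eqxx.
have nm W : m \notin X :\: W by rewrite inE negb_and mX orbT.
have mYZ : m \notin Y :\: Z by rewrite inE negb_and (sX Y) ?orbT.
rewrite setDDl sPC //; last by apply: subset_trans (subsetDl _ _) (subsetUr _ _).
rewrite mulrA sPC ?mulrA //; first by apply: contra lY; apply: (subsetP ZY).
exact: subset_trans ZY (subsetUr _ _).
Qed.

End Squares.

End Stars.

(** * The steps of the Monk formula *)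

Section Arcs.
Variable n : nat.
Implicit Types (u v w : 'S_n) (i j k l a b c : 'I_n).

(** Going up cyclically from x, the value y is met strictly before z. *)
Definition arc (x y z : nat) : bool :=
  ((x < y < z) || (z <= x) && ((x < y) || (y < z)))%N.

Definition free_arc u i j : bool :=
  [forall l : 'I_n, (i < l < j)%N ==> ~~ arc (u i) (u l) (u j)].

Lemma free_arcP u i j :
  reflect (forall l : 'I_n, (i < l)%N -> (l < j)%N -> ~~ arc (u i) (u l) (u j)) (free_arc u i j).
Proof.
apply: (iffP forallP) => H l; first by move=> il lj; have := H l; rewrite il lj.
by apply/implyP => /andP[il lj]; apply: H.
Qed.

Lemma perm_val_neq u i j : i != j -> (u i != u j :> nat).
Proof. by move=> ij; rewrite (inj_eq val_inj) (inj_eq perm_inj). Qed.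

Lemma pcomp_tpermL u i j : (u ∘p tperm i j) i = u j.
Proof. by rewrite pcompE tpermL. Qed.
Lemma pcomp_tpermR u i j : (u ∘p tperm i j) j = u i.
Proof. by rewrite pcompE tpermR. Qed.
Lemma pcomp_tpermD u i j l : l != i -> l != j -> (u ∘p tperm i j) l = u l.
Proof. by move=> li lj; rewrite pcompE tpermD // eq_sym. Qed.

Lemma ellE u : ell u = (\sum_(p < n) \sum_(q < n) ((p < q) && (u q < u p)))%N.
Proof.
rewrite /ell -sum1dep_card pair_big /= big_mkcond /=.
by apply: eq_bigr => -[p q] _; case: ifP.
Qed.

Lemma sum_two_out (F : 'I_n -> 'I_n -> nat) i j : i != j ->
  (\sum_(p < n) \sum_(q < n) F p q =
   F i i + F i j + F j i + F j j
   + \sum_(l < n | (l != i) && (l != j)) (F i l + F l i + F j l + F l j)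
   + \sum_(p < n | (p != i) && (p != j)) \sum_(q < n | (q != i) && (q != j)) F p q)%N.
Proof.
move=> ij; have ji : j != i by rewrite eq_sym.
have e (G : 'I_n -> nat) :
  (\sum_(q < n) G q = G i + G j + \sum_(q < n | (q != i) && (q != j)) G q)%N.
  by rewrite (bigD1 i) //= (bigD1 j) //= addnA.
rewrite e !e; under [X in (_ + X = _)%N]eq_bigr => p _ do rewrite e.
rewrite !big_split /=; lia.
Qed.

(** Exchanging an ascent u i < u j creates the inversion (i, j), and two more for each
    intermediate position that carries an intermediate value. *)
Lemma ell_tperm u i j : (i < j)%N -> (u i < u j)%N ->
  ell (u ∘p tperm i j) =
  (ell u + 1 + 2 * #|[set l : 'I_n | (i < l < j) && (u i < u l < u j)]|)%N.
Proof.
move=> ij uij; have nij : i != j by rewrite -val_eqE /=; lia.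
rewrite !ellE !(sum_two_out _ nij) pcomp_tpermL pcomp_tpermR.
rewrite [X in (2 * X)%N](_ : _ = \sum_(l < n | (l != i) && (l != j))
    ((i < l < j) && (u i < u l < u j)))%N; last first.
  rewrite -sum1dep_card big_mkcond [RHS]big_mkcond /=; apply: eq_bigr => l _.
  by rewrite -!val_eqE /=; case: ifP => h; case: ifP => h'; move: h h'; lia.
have -> : (\sum_(p < n | (p != i) && (p != j)) \sum_(q < n | (q != i) && (q != j))
   ((p < q) && ((u ∘p tperm i j) q < (u ∘p tperm i j) p)) =
   \sum_(p < n | (p != i) && (p != j)) \sum_(q < n | (q != i) && (q != j))
   ((p < q) && (u q < u p)))%N.
  apply: eq_bigr => p /andP[pi pj]; apply: eq_bigr => q /andP[qi qj].
  by rewrite !pcomp_tpermD.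
set R := (\sum_(p < n | _) \sum_(q < n | _) _)%N.
have -> : (\sum_(l < n | (l != i) && (l != j))
   ((i < l) && ((u ∘p tperm i j) l < u j) + (l < i) && (u j < (u ∘p tperm i j) l) +
    (j < l) && ((u ∘p tperm i j) l < u i) + (l < j) && (u i < (u ∘p tperm i j) l)) =
  \sum_(l < n | (l != i) && (l != j))
   ((i < l) && (u l < u i) + (l < i) && (u i < u l) +
    (j < l) && (u l < u j) + (l < j) && (u j < u l)) +
  2 * \sum_(l < n | (l != i) && (l != j)) ((i < l < j) && (u i < u l < u j)))%N.
  rewrite big_distrr -big_split /=; apply: eq_bigr => l /andP[li lj].
  rewrite !pcomp_tpermD //.
  have := perm_val_neq u li; have := perm_val_neq u lj; move: li lj; rewrite -!val_eqE /=.
  lia.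
lia.
Qed.

Lemma card_between i j : #|[set l : 'I_n | (i < l < j)%N]| = (j - i).-1.
Proof.
rewrite -sum1dep_card -(big_mkord (fun l : nat => (i < l < j)%N) (fun=> 1%N)).
rewrite (big_cat_nat _ (ltnW (ltn_ord j))) //= [X in (_ + X)%N]big_nat_cond [X in (_ + X)%N]big1.
  rewrite addn0; case: (ltnP i j) => ij.
    rewrite (big_cat_nat _ ij) //= big_nat_cond big1 ?add0n; last by move=> l; lia.
    rewrite big_nat_cond (eq_bigl (fun l : nat => (i.+1 <= l < j)%N && true)); last by move=> l; lia.
    rewrite -big_nat_cond sum_nat_const_nat; lia.
  by rewrite big_nat_cond big1; lia.
move=> l; lia.
Qed.

(** Both kinds of covers of the quantum Bruhat order are described by the same
    condition: no position between i and j carries a value in the cyclic interval from u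
    i to u j. *)
Lemma bruhat_stepE u i j : (i < j)%N -> bruhat_step u i j = (u i < u j)%N && free_arc u i j.
Proof.
move=> ij; have nij : i != j by rewrite -val_eqE /=; lia.
have := perm_val_neq u nij; rewrite /bruhat_step neq_ltn => /orP[uij|uji].
  rewrite ell_tperm // uij /=; set E := [set l | _].
  have -> : (ell u + 1 + 2 * #|E| == (ell u).+1)%N = (#|E| == 0)%N by lia.
  rewrite cards_eq0; apply/eqP/free_arcP => [e l il lj|H].
    have : l \notin E by rewrite e inE.
    rewrite inE il lj /= /arc; lia.
  apply/eqP; rewrite -subset0; apply/subsetP => l; rewrite inE => /andP[/andP[il lj] h].
  have := H l il lj; rewrite /arc; lia.
have := @ell_tperm (u ∘p tperm i j) i j ij.
rewrite pcomp_tpermL pcomp_tpermR => /(_ uji).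
have -> : u ∘p tperm i j ∘p tperm i j = u.
  by apply/permP => x; rewrite !pcompE tpermK.
lia.
Qed.

Lemma quantum_stepE u i j : (i < j)%N -> quantum_step u i j = (u j < u i)%N && free_arc u i j.
Proof.
move=> ij; have nij : i != j by rewrite -val_eqE /=; lia.
have := perm_val_neq u nij; rewrite /quantum_step neq_ltn => /orP[uij|uji].
  rewrite ell_tperm //; lia.
have := @ell_tperm (u ∘p tperm i j) i j ij.
rewrite pcomp_tpermL pcomp_tpermR => /(_ uji).
have -> : u ∘p tperm i j ∘p tperm i j = u.
  by apply/permP => x; rewrite !pcompE tpermK.
set E := [set l | _] => ->.
have cb := card_between i j.
have -> : ((ell (u ∘p tperm i j) + 1 + 2 * #|E|).+1 == ell (u ∘p tperm i j) + 2 * (j - i))%N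
   = (#|[set l : 'I_n | (i < l < j)%N]| <= #|E|)%N.
  have : (#|E| <= #|[set l : 'I_n | (i < l < j)%N]|)%N.
    by apply: subset_leq_card; apply/subsetP => l; rewrite !inE => /andP[].
  rewrite cb; lia.
have sE : E \subset [set l : 'I_n | (i < l < j)%N] by apply/subsetP => l; rewrite !inE => /andP[].
rewrite uji /= (geq_leqif (subset_leqif_cards sE)); apply/eqP/free_arcP => [e l il lj|H].
  have : l \in E by rewrite e inE il lj.
  rewrite inE il lj pcomp_tpermD -?val_eqE /=; [|lia|lia].
  rewrite /arc; lia.
apply/setP => l; rewrite !inE; apply/andP/idP => [[]//|/[dup] ilj /andP[il lj]]; split=> //.
have li : l != i by rewrite -val_eqE /=; lia.
have lj' : l != j by rewrite -val_eqE /=; lia.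
rewrite pcomp_tpermD //; have := H l il lj.
have := perm_val_neq u li; have := perm_val_neq u lj'.
rewrite /arc; lia.
Qed.

End Arcs.

(** * The Monk operators and their relations *)

Section Hops.
Variable n : nat.
Implicit Types (u v w : 'S_n) (i j k l a b c : 'I_n).
Local Notation MS := ('M[Zq n]_#|{: 'S_n}|).

Definition ent (M : MS) u w : Zq n := M (enum_rank u) (enum_rank w).

Lemma ent_ext (M M' : MS) : (forall u w, ent M u w = ent M' u w) -> M = M'.
Proof.
by move=> H; apply/matrixP => x y; rewrite -(enum_valK x) -(enum_valK y); apply: H.
Qed.

Lemma entM (M M' : MS) u w : ent (M * M') u w = \sum_v ent M u v * ent M' v w.
Proof.
rewrite /ent mxE (reindex enum_rank) //=.
by exists enum_val => x _; rewrite ?enum_valK ?enum_rankK.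
Qed.

Lemma entD (M M' : MS) u w : ent (M + M') u w = ent M u w + ent M' u w.
Proof. by rewrite /ent mxE. Qed.

Lemma entN (M : MS) u w : ent (- M) u w = - ent M u w.
Proof. by rewrite /ent mxE. Qed.

Lemma ent0 u w : ent 0 u w = 0.
Proof. by rewrite /ent mxE. Qed.

Lemma ent1 u w : ent 1 u w = (u == w)%:R.
Proof. by rewrite /ent mxE (inj_eq enum_rank_inj). Qed.

Lemma ent_sum (J : Type) (r : seq J) (P : pred J) (F : J -> MS) u w :
  ent (\sum_(x <- r | P x) F x) u w = \sum_(x <- r | P x) ent (F x) u w.
Proof. by rewrite /ent summxE. Qed.

Lemma entZ (p : Zq n) (M : MS) u w : ent (p%:M * M) u w = p * ent M u w.
Proof. by rewrite /ent -[_ * M]/(_ *m M) mul_scalar_mx mxE. Qed.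

Definition hop_wt u i j : 'X_{1..n.-1} := if (u i < u j)%N then 0%MM else qexp i j.

(** A summand of the quantum Monk formula as a matrix; the rows are indexed by the
    source, so that products are read in the order of time. *)
Definition hop i j : MS := \matrix_(x, y)
  (if (enum_val y == enum_val x ∘p tperm i j) && free_arc (enum_val x) i j
   then 'X_[hop_wt (enum_val x) i j] else 0).

Lemma ent_hop i j u w : ent (hop i j) u w =
  if (w == u ∘p tperm i j) && free_arc u i j then 'X_[hop_wt u i j] else 0.
Proof. by rewrite /ent mxE !enum_rankK. Qed.

Lemma ent_hopM i j (M : MS) u w : ent (hop i j * M) u w =
  if free_arc u i j then 'X_[hop_wt u i j] * ent M (u ∘p tperm i j) w else 0.
Proof.
rewrite entM (bigD1 (u ∘p tperm i j)) //= ent_hop eqxx /= big1 ?addr0.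
  by case: ifP; rewrite ?mul0r.
by move=> v /negbTE e; rewrite ent_hop e mul0r.
Qed.

Lemma ent_hop2 i j k l u w : ent (hop i j * hop k l) u w =
  if (w == u ∘p tperm i j ∘p tperm k l) && (free_arc u i j && free_arc (u ∘p tperm i j) k l)
  then 'X_[hop_wt u i j + hop_wt (u ∘p tperm i j) k l] else 0.
Proof.
rewrite ent_hopM ent_hop mpolyXD.
by case: (free_arc u i j); rewrite ?andbF //=; case: ifP; rewrite ?mulr0.
Qed.

Lemma pcomp_tpermC u i j k l : uniq [:: i; j; k; l] ->
  u ∘p tperm i j ∘p tperm k l = u ∘p tperm k l ∘p tperm i j.
Proof.
rewrite /= !inE !negb_or => /and4P[/and3P[ij ik il] /andP[jk jl] kl _].
rewrite /pcomp !mulgA; congr (_ * _)%g.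
by rewrite [LHS]conjgC tpermJ !tpermD.
Qed.

Lemma free_arcC u i j k l : (i < j)%N -> (k < l)%N -> uniq [:: i; j; k; l] ->
  free_arc u i j && free_arc (u ∘p tperm i j) k l ->
  free_arc u k l && free_arc (u ∘p tperm k l) i j.
Proof.
move=> ij kl; rewrite /= !inE !negb_or => /and4P[/and3P[nij ik il] /andP[jk jl] nkl _].
move=> /andP[/free_arcP H1 /free_arcP H2].
have := (perm_val_neq u ik, perm_val_neq u il, perm_val_neq u jk, perm_val_neq u jl,
  perm_val_neq u nij, perm_val_neq u nkl).
move=> [[[[[nik nil] njk] njl] nuij] nukl].
have := (H1 k, H1 l, H2 i, H2 j); rewrite pcomp_tpermL pcomp_tpermR.
rewrite !(@pcomp_tpermD _ u i j) 1?eq_sym // => -[[[K1 K2] K3] K4].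
apply/andP; split; apply/free_arcP => m m1 m2.
  case: (eqVneq m i) m1 m2 => [->|mi] m1 m2; first by move: nij ik il jk jl nkl m1 m2 K1 K2 K3 K4;
    rewrite -!val_eqE /= /arc; lia.
  case: (eqVneq m j) m1 m2 => [->|mj] m1 m2; first by move: nij ik il jk jl nkl m1 m2 K1 K2 K3 K4;
    rewrite -!val_eqE /= /arc; lia.
  by have := H2 m m1 m2; rewrite !pcomp_tpermD // eq_sym.
have [ki kj li lj] : [/\ i != k, j != k, i != l & j != l] by [].
rewrite (@pcomp_tpermD _ u k l i) // (@pcomp_tpermD _ u k l j) //.
case: (eqVneq m k) m1 m2 => [->|mk] m1 m2; first by rewrite pcomp_tpermL;
  move: nij ik il jk jl nkl m1 m2 K1 K2 K3 K4; rewrite -!val_eqE /= /arc; lia.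
case: (eqVneq m l) m1 m2 => [->|ml] m1 m2; first by rewrite pcomp_tpermR;
  move: nij ik il jk jl nkl m1 m2 K1 K2 K3 K4; rewrite -!val_eqE /= /arc; lia.
by rewrite pcomp_tpermD //; apply: H1.
Qed.

Lemma hopC i j k l : (i < j)%N -> (k < l)%N -> uniq [:: i; j; k; l] ->
  hop i j * hop k l = hop k l * hop i j.
Proof.
move=> ij kl U; have U' : uniq [:: k; l; i; j].
  by rewrite -[[:: k; l; i; j]]/([:: k; l] ++ [:: i; j]) uniq_catC.
apply: ent_ext => u w; rewrite !ent_hop2 (pcomp_tpermC u U) addmC.
have -> : free_arc u i j && free_arc (u ∘p tperm i j) k l =
  free_arc u k l && free_arc (u ∘p tperm k l) i j.
  by apply/idP/idP; apply: free_arcC.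
have := U; rewrite /= !inE !negb_or => /and4P[/and3P[nij ik il] /andP[jk jl] nkl _].
by rewrite /hop_wt !pcomp_tpermD // eq_sym.
Qed.

Section Triples.
Variables (u : 'S_n) (a b c : 'I_n) (ab : (a < b)%N) (bc : (b < c)%N).

Let nab : a != b. Proof. by rewrite -val_eqE /=; lia. Qed.
Let nbc : b != c. Proof. by rewrite -val_eqE /=; lia. Qed.
Let nac : a != c. Proof. by rewrite -val_eqE /=; lia. Qed.
Let nba : b != a. Proof. by rewrite eq_sym. Qed.
Let ncb : c != b. Proof. by rewrite eq_sym. Qed.
Let nca : c != a. Proof. by rewrite eq_sym. Qed.

Let val3 := (pcomp_tpermL, pcomp_tpermR, (pcomp_tpermD u nca ncb),
  (pcomp_tpermD u nab nac), (pcomp_tpermD u nba nbc)).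

Let uab := perm_val_neq u nab.
Let ubc := perm_val_neq u nbc.
Let uac := perm_val_neq u nac.

Ltac wts := rewrite /hop_wt !val3 /arc; move: uab ubc uac => h1 h2 h3 h;
  apply/mnmP => m; rewrite !mnmDE; do ?[case: ifP => ?]; rewrite ?mnmE; lia.

Lemma hop_wt_rel1 : ~~ arc (u a) (u c) (u b) ->
  (hop_wt u a b + hop_wt (u ∘p tperm a b) b c =
   hop_wt u b c + hop_wt (u ∘p tperm b c) a c)%MM.
Proof. wts. Qed.

Lemma hop_wt_rel2 : arc (u a) (u c) (u b) ->
  (hop_wt u a b + hop_wt (u ∘p tperm a b) b c =
   hop_wt u a c + hop_wt (u ∘p tperm a c) a b)%MM.
Proof. wts. Qed.

Lemma hop_wt_rel3 : arc (u a) (u c) (u b) ->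
  (hop_wt u b c + hop_wt (u ∘p tperm b c) a b =
   hop_wt u a c + hop_wt (u ∘p tperm a c) b c)%MM.
Proof. wts. Qed.

Lemma hop_wt_rel4 : ~~ arc (u a) (u c) (u b) ->
  (hop_wt u b c + hop_wt (u ∘p tperm b c) a b =
   hop_wt u a b + hop_wt (u ∘p tperm a b) a c)%MM.
Proof. wts. Qed.

(* Both sides are decided position by position: the positions a, b, c carry known
   values, and any other position carries a value different from theirs. *)
Ltac arcs :=
  let h := fresh "h" in let H1 := fresh "H" in let H2 := fresh "H" in
  let m := fresh "m" in let ma := fresh "ma" in let mb := fresh "mb" in
  let mc := fresh "mc" in
  move=> h; apply/idP/idP => /andP[/free_arcP H1 /free_arcP H2]; apply/andP; split;
  apply/free_arcP => m; have := H1 m; have := H2 m; have := H1 b; have := H2 b;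
  rewrite !val3; move: uab ubc uac ab bc h; rewrite /arc;
  (case: (eqVneq m a) => [->|ma]; [rewrite !val3; lia|]);
  (case: (eqVneq m b) => [->|mb]; [rewrite !val3; lia|]);
  (case: (eqVneq m c) => [->|mc]; [rewrite !val3; lia|]);
  rewrite !pcomp_tpermD //;
  have := perm_val_neq u ma; have := perm_val_neq u mb; have := perm_val_neq u mc;
  move: ma mb mc; rewrite -!val_eqE /=; lia.

Lemma free_arc_rel1 : ~~ arc (u a) (u c) (u b) ->
  free_arc u a b && free_arc (u ∘p tperm a b) b c =
  free_arc u b c && free_arc (u ∘p tperm b c) a c.
Proof. arcs. Qed.

Lemma free_arc_rel2 : arc (u a) (u c) (u b) ->
  free_arc u a b && free_arc (u ∘p tperm a b) b c =
  free_arc u a c && free_arc (u ∘p tperm a c) a b.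
Proof. arcs. Qed.

Lemma free_arc_rel3 : arc (u a) (u c) (u b) ->
  free_arc u b c && free_arc (u ∘p tperm b c) a b =
  free_arc u a c && free_arc (u ∘p tperm a c) b c.
Proof. arcs. Qed.

Lemma free_arc_rel4 : ~~ arc (u a) (u c) (u b) ->
  free_arc u b c && free_arc (u ∘p tperm b c) a b =
  free_arc u a b && free_arc (u ∘p tperm a b) a c.
Proof. arcs. Qed.

Lemma free_arc_block1 : arc (u a) (u c) (u b) ->
  free_arc (u ∘p tperm b c) a c = false.
Proof.
by move=> h; apply/negP => /free_arcP/(_ b ab bc); rewrite !val3 h.
Qed.

Lemma free_arc_block2 : ~~ arc (u a) (u c) (u b) -> free_arc u a c = false.
Proof.
move=> h; apply/negP => /free_arcP/(_ b ab bc); move: uab ubc uac h; rewrite /arc; lia.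
Qed.

Lemma free_arc_block3 : arc (u a) (u c) (u b) -> free_arc (u ∘p tperm a b) a c = false.
Proof.
move=> h; apply/negP => /free_arcP/(_ b ab bc); rewrite !val3; move: uab ubc uac h; rewrite /arc; lia.
Qed.

Lemma pcomp_tperm3 :
  [/\ u ∘p tperm b c ∘p tperm a c = u ∘p tperm a b ∘p tperm b c,
      u ∘p tperm a c ∘p tperm a b = u ∘p tperm a b ∘p tperm b c,
      u ∘p tperm a c ∘p tperm b c = u ∘p tperm b c ∘p tperm a b &
      u ∘p tperm a b ∘p tperm a c = u ∘p tperm b c ∘p tperm a b].
Proof.
have e x y : (x * y = y * x ^ y :> 'S_n)%g by exact: conjgC.
rewrite /pcomp !mulgA; split; congr (_ * _)%g.
- by rewrite [LHS]e tpermJ tpermR tpermD.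
- by rewrite [RHS]e tpermJ tpermR tpermD.
- by rewrite [RHS]e tpermJ tpermL tpermD.
- by rewrite [LHS]e tpermJ tpermL tpermD.
Qed.

End Triples.

(** Of the two products on the right, exactly one can be nonzero from a given u: which
    one depends on whether u c lies in the cyclic interval from u a to u b. *)
Lemma hop_rel1 a b c : (a < b)%N -> (b < c)%N ->
  hop a b * hop b c = hop b c * hop a c + hop a c * hop a b.
Proof.
move=> ab bc; apply: ent_ext => u w; rewrite entD !ent_hop2.
have [-> -> _ _] := pcomp_tperm3 u ab bc.
case: (w == _) => /=; last by rewrite addr0.
case: (boolP (arc (u a) (u c) (u b))) => h.
  rewrite (free_arc_block1 ab bc h) andbF add0r.
  by rewrite (free_arc_rel2 ab bc h) (hop_wt_rel2 ab bc h).
rewrite (free_arc_block2 ab bc h) /= addr0.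
by rewrite (free_arc_rel1 ab bc h) (hop_wt_rel1 ab bc h).
Qed.

Lemma hop_rel2 a b c : (a < b)%N -> (b < c)%N ->
  hop b c * hop a b = hop a c * hop b c + hop a b * hop a c.
Proof.
move=> ab bc; apply: ent_ext => u w; rewrite entD !ent_hop2.
have [_ _ -> ->] := pcomp_tperm3 u ab bc.
case: (w == _) => /=; last by rewrite addr0.
case: (boolP (arc (u a) (u c) (u b))) => h.
  rewrite (free_arc_block3 ab bc h) andbF addr0.
  by rewrite (free_arc_rel3 ab bc h) (hop_wt_rel3 ab bc h).
rewrite (free_arc_block2 ab bc h) /= add0r.
by rewrite (free_arc_rel4 ab bc h) (hop_wt_rel4 ab bc h).
Qed.

(** Only adjacent positions can be exchanged twice in a row. *)
Definition hop_sq i j : Zq n :=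
  if (j == i.+1 :> nat) || (i == j.+1 :> nat) then 'X_[qexp i j + qexp j i] else 0.

Lemma hop_square i j : (i < j)%N -> hop i j * hop i j = (hop_sq i j)%:M.
Proof.
move=> ij; apply: ent_ext => u w; rewrite ent_hop2.
have -> : ent (hop_sq i j)%:M u w = hop_sq i j * (u == w)%:R.
  by rewrite -[_%:M]mulr1 entZ ent1.
have -> : u ∘p tperm i j ∘p tperm i j = u by apply/permP => x; rewrite !pcompE tpermK.
have nij : i != j by rewrite -val_eqE /=; lia.
have qji : qexp j i = 0%MM by apply/mnmP => m; rewrite !mnmE; lia.
rewrite eq_sym; case: (u == w); rewrite ?mulr1 ?mulr0 //=.
rewrite /hop_sq qji addm0 [(i == _ :> nat)](_ : _ = false) ?orbF; last by apply/negbTE; lia.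
have := perm_val_neq u nij => uij.
have -> : free_arc u i j && free_arc (u ∘p tperm i j) i j = (j == i.+1 :> nat).
  apply/idP/idP => [/andP[/free_arcP H1 /free_arcP H2]|/eqP e]; last first.
    by apply/andP; split; apply/free_arcP => l; lia.
  apply: contraT => e; have il : (i.+1 < n)%N by have := ltn_ord j; lia.
  (* whichever of u i, u j is larger, the value at l blocks one of the two exchanges *)
  pose l := Ordinal il; have [l1 l2] : (i < l)%N /\ (l < j)%N by rewrite /=; lia.
  have li : l != i by rewrite -val_eqE /=; lia.
  have lj : l != j by rewrite -val_eqE /=; lia.
  have := H1 l l1 l2; have := H2 l l1 l2.
  rewrite pcomp_tpermL pcomp_tpermR pcomp_tpermD //.
  have := perm_val_neq u li; have := perm_val_neq u lj; rewrite /arc; lia.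
case: ifP => // _; congr 'X_[_]; rewrite /hop_wt pcomp_tpermL pcomp_tpermR.
by case: ltnP uij => h1; case: ltnP => h2 uij; rewrite ?addm0 ?add0m //; lia.
Qed.

End Hops.

(** * Signed and unsigned moves *)

Lemma uniq4E (J : eqType) (a b c e : J) : uniq [:: a; b; c; e] =
  [&& a != b, a != c, a != e, b != c, b != e & c != e].
Proof. by rewrite /= !inE !negb_or andbT -!andbA. Qed.

Lemma uniq4_swapl (J : eqType) (a b c e : J) : uniq [:: a; b; c; e] -> uniq [:: b; a; c; e].
Proof. by rewrite !uniq4E (eq_sym b a) => /and5P[-> -> -> -> ->]. Qed.

Lemma uniq4_swapr (J : eqType) (a b c e : J) : uniq [:: a; b; c; e] -> uniq [:: a; b; e; c].
Proof. by rewrite !uniq4E (eq_sym e c) => /and5P[-> -> -> -> /andP[-> ->]]. Qed.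

Section SignedExtension.
Variables (n : nat) (A : pzRingType) (h : 'I_n -> 'I_n -> A).
Implicit Types i j k l a b c : 'I_n.

(** Extensions to all the pairs of a function h meant for i < j. *)
Definition antisym i j : A := if (i < j)%N then h i j else - h j i.
Definition sym i j : A := if (i < j)%N then h i j else h j i.

Lemma antisymN i j : i != j -> antisym j i = - antisym i j.
Proof. by rewrite /antisym -val_eqE /= neq_ltn; case: ltngtP => // _ _; rewrite opprK. Qed.

Lemma antisymE i j : antisym i j = (-1) ^+ (j <= i)%N * sym i j.
Proof. by rewrite /antisym /sym ltnNge; case: leqP; rewrite /= ?mul1r ?mulN1r. Qed.

Hypothesis hC : forall i j k l, (i < j)%N -> (k < l)%N -> uniq [:: i; j; k; l] ->
  h i j * h k l = h k l * h i j.
Hypothesis h_rel1 : forall a b c, (a < b)%N -> (b < c)%N ->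
  h a b * h b c = h b c * h a c + h a c * h a b.
Hypothesis h_rel2 : forall a b c, (a < b)%N -> (b < c)%N ->
  h b c * h a b = h a c * h b c + h a b * h a c.

Lemma sym_comm4 a b c e : uniq [:: a; b; c; e] -> sym a b * sym c e = sym c e * sym a b.
Proof.
move=> U; have := U; rewrite /= !inE !negb_or => /and4P[/and3P[ab _ _] _ ce _].
move: ab ce; rewrite /sym -!val_eqE /= !neq_ltn => ab ce.
case: ltngtP ab => // ab _; case: ltngtP ce => // ce _; apply: hC => //;
  first [exact: U | exact: uniq4_swapr U | exact: uniq4_swapl U | exact: uniq4_swapr (uniq4_swapl U)].
Qed.

Lemma antisym_comm4 a b c e : uniq [:: a; b; c; e] ->
  antisym a b * antisym c e = antisym c e * antisym a b.
Proof.
move=> U; rewrite !antisymE; set x := (-1) ^+ _; set y := (-1) ^+ _.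
have cx z : z * x = x * z by apply: commr_sign.
have cy z : z * y = y * z by apply: commr_sign.
by rewrite !mulrA -![_ * sym _ _ * _]mulrA cx cy !mulrA cx -!mulrA sym_comm4.
Qed.

Lemma antisym_rel3 i j k : uniq [:: i; j; k] ->
  antisym i j * antisym j k = antisym j k * antisym i k + antisym i k * antisym i j.
Proof.
rewrite /= !inE !negb_or => /and3P[/andP[ij ik] jk _]; move: ij ik jk.
rewrite /antisym -!val_eqE /= !neq_ltn.
case: (ltngtP i j) => // ij _; case: (ltngtP i k) => // ik _; case: (ltngtP j k) => // jk _;
  rewrite ?mulrN ?mulNr ?opprK; try lia.
- exact: h_rel1.
- by rewrite (h_rel2 ik jk) opprD addrNK.
- by rewrite (h_rel1 ik ij) opprD addrCA subrr addr0.
- by rewrite (h_rel2 ij ik) opprD addrA subrr add0r.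
- by rewrite (h_rel1 jk ik) opprD addrAC addNr add0r.
- by rewrite (h_rel2 jk ij) addrC.
Qed.

End SignedExtension.

Section SignedHops.
Variable n : nat.
Implicit Types (u v w : 'S_n) (i j k l a b c m : 'I_n).
Local Notation MS := ('M[Zq n]_#|{: 'S_n}|).

Definition tau i j : MS := antisym (@hop n) i j.
Definition uhop i j : MS := sym (@hop n) i j.

Lemma tau_anti i j : i != j -> tau j i = - tau i j.
Proof. exact: antisymN. Qed.

Lemma tau_uhop i j : tau i j = (-1) ^+ (j <= i)%N * uhop i j.
Proof. exact: antisymE. Qed.

Lemma uhop_comm4 a b c e : uniq [:: a; b; c; e] -> uhop a b * uhop c e = uhop c e * uhop a b.
Proof. apply: sym_comm4; exact: hopC. Qed.

Lemma tau_comm4 a b c e : uniq [:: a; b; c; e] -> tau a b * tau c e = tau c e * tau a b.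
Proof. apply: antisym_comm4; exact: hopC. Qed.

Lemma tau_rel3 i j k : uniq [:: i; j; k] ->
  tau i j * tau j k = tau j k * tau i k + tau i k * tau i j.
Proof. apply: antisym_rel3; [exact: hop_rel1 | exact: hop_rel2]. Qed.

Lemma hop_sqC i j : hop_sq i j = hop_sq j i.
Proof. by rewrite /hop_sq orbC addmC. Qed.

Lemma tau_sq i j : i != j -> tau i j * tau i j = (hop_sq i j)%:M.
Proof.
rewrite /tau /antisym -val_eqE /= neq_ltn; case: ltngtP => // ij _; first exact: hop_square.
by rewrite mulrNN hop_square // hop_sqC.
Qed.

Lemma scalar_mx_central (p : Zq n) (M : MS) : p%:M * M = M * p%:M.
Proof. by rewrite -[LHS]/(_ *m M) -[RHS]/(M *m _) scalar_mxC. Qed.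

(** The operator of the quantization of the squarefree monomial of X. *)
Definition sqfree_mx (X : {set 'I_n}) : MS := Phi tau (enum (~: X)) X.

Lemma apart_enumC (X Y : {set 'I_n}) : [disjoint X & Y] -> apart (enum X) Y.
Proof. by move=> d; split=> [|b]; rewrite ?enum_uniq // mem_enum => /(disjointFr d)->. Qed.

Lemma sqfree_mx_Phi B X : uniq B -> B =i ~: X -> sqfree_mx X = Phi tau B X.
Proof.
move=> uB eB; apply: (Phi_perm tau_comm4).
  by apply: uniq_perm; rewrite ?enum_uniq // => x; rewrite mem_enum eB.
by apply: apart_enumC; rewrite -setI_eq0 setIC setICr.
Qed.

End SignedHops.

(** * Multiplication operators and quantized squarefree monomials *)

Section Representation.
Variables (n : nat) (R : comAlgType (Zq n)) (S : 'S_n -> R).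
Implicit Types (u v w : 'S_n) (i j k l a b c m : 'I_n) (x y : R).
Local Notation MS := ('M[Zq n]_#|{: 'S_n}|).

(** The rows of M are the products in the Schubert basis, so that products of operators
    are products of matrices. *)
Definition mult_by x (M : MS) := forall u, S u * x = \sum_w ent M u w *: S w.

Lemma mult_by0 : mult_by 0 0.
Proof. by move=> u; rewrite mulr0 big1 // => w _; rewrite ent0 scale0r. Qed.

Lemma mult_byD x y M N : mult_by x M -> mult_by y N -> mult_by (x + y) (M + N).
Proof.
move=> hx hy u; rewrite mulrDr hx hy -big_split; apply: eq_bigr => w _.
by rewrite entD scalerDl.
Qed.

Lemma mult_byN x M : mult_by x M -> mult_by (- x) (- M).
Proof.
by move=> hx u; rewrite mulrN hx -sumrN; apply: eq_bigr => w _; rewrite entN scaleNr.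
Qed.

Lemma mult_by_sum (J : Type) (r : seq J) (P : pred J) (F : J -> R) (G : J -> MS) :
  (forall z, P z -> mult_by (F z) (G z)) ->
  mult_by (\sum_(z <- r | P z) F z) (\sum_(z <- r | P z) G z).
Proof.
move=> H; elim: r => [|z r IH]; first by rewrite !big_nil; apply: mult_by0.
by rewrite !big_cons; case: ifP => // Pz; apply: mult_byD => //; apply: H.
Qed.

Lemma mult_byM x y M N : mult_by x M -> mult_by y N -> mult_by (x * y) (M * N).
Proof.
move=> hx hy u; rewrite mulrA hx mulr_suml.
under eq_bigr => v _ do rewrite -scalerAl hy scaler_sumr.
rewrite exchange_big; apply: eq_bigr => w _.
by rewrite entM scaler_suml; apply: eq_bigr => v _; rewrite scalerA.
Qed.

Lemma mult_byZ (p : Zq n) x M : mult_by x M -> mult_by (p *: x) (p%:M * M).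
Proof.
move=> hx u; rewrite -scalerAr hx scaler_sumr; apply: eq_bigr => w _.
by rewrite entZ scalerA.
Qed.

Hypothesis qH : qH_flag S.

Lemma mult_by1 : mult_by 1 1.
Proof.
move=> u; rewrite mulr1 (bigD1 u) //= ent1 eqxx scale1r big1 ?addr0 // => w /negbTE wu.
by rewrite ent1 eq_sym wu scale0r.
Qed.

Lemma mult_by_val x M : mult_by x M -> x = \sum_w ent M 1%g w *: S w.
Proof. by move=> <-; rewrite (qH_unit qH) mul1r. Qed.

(** The Schubert classes are a basis; an identity between classes can be checked on
    operators and conversely. *)
Lemma mult_by_unique x M N : mult_by x M -> mult_by x N -> M = N.
Proof.
move=> hM hN; apply: ent_ext => u w.
have [c [_ H]] := qH_basis qH (S u * x).
have cM : c = [ffun w => ent M u w].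
  by apply: H; rewrite hM; apply: eq_bigr => z _; rewrite ffunE.
have cN : c = [ffun w => ent N u w].
  by apply: H; rewrite hN; apply: eq_bigr => z _; rewrite ffunE.
by have := congr1 (fun f : {ffun _ -> _} => f w) (etrans (esym cM) cN); rewrite !ffunE.
Qed.

(** The double sum makes the divisor vanish at the two ends t = 0 and t = n, as the
    telescoping definition of the Chern roots requires. *)
Definition divisor (t : nat) : R :=
  \sum_(p < n) \sum_(r < n | (r == p.+1 :> nat) && (r == t :> nat)) S (tperm p r).

Definition divisor_mx (t : nat) : MS :=
  \sum_(i < n | (i < t)%N) \sum_(j < n | (t <= j)%N) hop i j.

Lemma Monk_hop u i j : (i < j)%N ->
  \sum_w ent (hop i j) u w *: S w =
    (if bruhat_step u i j then S (u ∘p tperm i j) else 0)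
  + (if quantum_step u i j then 'X_[qexp i j] *: S (u ∘p tperm i j) else 0).
Proof.
move=> ij; rewrite (bigD1 (u ∘p tperm i j)) //= ent_hop eqxx big1 ?addr0; last first.
  by move=> w /negbTE wu; rewrite ent_hop wu scale0r.
rewrite bruhat_stepE // quantum_stepE // /hop_wt.
have nij : i != j by rewrite -val_eqE /=; lia.
have := perm_val_neq u nij.
case: (free_arc u i j); rewrite ?andbF ?scale0r ?addr0 //= !andbT.
by case: ltngtP => // _ _; rewrite ?mpolyX0 ?scale1r ?addr0 ?add0r.
Qed.

Lemma mult_by_divisor t : mult_by (divisor t) (divisor_mx t).
Proof.
have H (p r : 'I_n) : r = p.+1 :> nat -> mult_by (S (tperm p r)) (divisor_mx r).
  move=> e u; rewrite (qH_monk qH u e) /divisor_mx.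
  have E (i : 'I_n) : (i < r)%N = (i <= p)%N by rewrite e.
  rewrite (eq_bigl _ _ E) -big_split /=.
  under [RHS]eq_bigr => w _ do rewrite ent_sum scaler_suml.
  rewrite exchange_big; apply: eq_bigr => i ip.
  under [RHS]eq_bigr => w _ do rewrite ent_sum scaler_suml.
  rewrite exchange_big !big_mkcondr -big_split /=; apply: eq_bigr => j rj.
  by rewrite Monk_hop //; lia.
have [/andP[t0 tn]|ht] := boolP (0 < t < n)%N.
  have pn : (t.-1 < n)%N by lia.
  pose p := Ordinal pn; pose r := Ordinal tn.
  have e : r = p.+1 :> nat by rewrite /=; lia.
  have -> : divisor t = S (tperm p r).
    rewrite /divisor (bigD1 p) //= [X in _ + X]big1 ?addr0.
      rewrite (big_pred1 r) // => z; rewrite /= -[z == r]val_eqE /=; lia.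
    move=> z; rewrite -val_eqE /= => zp; rewrite big_pred0 // => y; lia.
  exact: H.
have -> : divisor t = 0.
  by rewrite /divisor big1 // => p _; rewrite big_pred0 // => r; have := ltn_ord r; lia.
have -> : divisor_mx t = 0.
  rewrite /divisor_mx big1 // => i it; rewrite big_pred0 // => j; have := ltn_ord j; lia.
exact: mult_by0.
Qed.

Definition chern_root m : R := divisor m.+1 - divisor m.

(** The divisors of two successive cuts differ by the moves at the position m between
    them, with a sign telling the side. *)
Definition dunkl m : MS := \sum_(l < n | l != m) tau m l.

Lemma mult_by_chern_root m : mult_by (chern_root m) (dunkl m).
Proof.
have -> : dunkl m = divisor_mx m.+1 - divisor_mx m.
  rewrite /dunkl (bigID (fun l : 'I_n => m < l)%N) /=.
  have e1 : divisor_mx m.+1 = \sum_(i < n | (i < m)%N) \sum_(j < n | (m < j)%N) hop i j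
      + \sum_(j < n | (m < j)%N) hop m j.
    rewrite /divisor_mx (bigD1 m) //= addrC; congr (_ + _); apply: eq_bigl => i.
    by rewrite -val_eqE /=; lia.
  have e2 : divisor_mx m = \sum_(i < n | (i < m)%N) \sum_(j < n | (m < j)%N) hop i j
      + \sum_(i < n | (i < m)%N) hop i m.
    rewrite /divisor_mx -big_split; apply: eq_bigr => i im.
    rewrite (bigD1 m) //= addrC; congr (_ + _); apply: eq_bigl => j.
    by rewrite -val_eqE /=; lia.
  rewrite e1 e2 opprD addrACA subrr add0r -sumrN; congr (_ + _).
    apply: eq_big => [l|l /andP[_ ml]]; first by rewrite -val_eqE /=; lia.
    by rewrite /tau /antisym ml.
  apply: eq_big => [l|l /andP[lm ml]]; first by rewrite -val_eqE /=; lia.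
  by rewrite /tau /antisym (negbTE ml).
by apply: mult_byD; [|apply: mult_byN]; apply: mult_by_divisor.
Qed.

Lemma sqfree_mx_rec m (X : {set 'I_n}) : m \notin X ->
  sqfree_mx (m |: X) = dunkl m * sqfree_mx X
    + \sum_(l in X) (hop_sq l m)%:M * sqfree_mx (X :\ l).
Proof.
move=> mX; pose B := enum (~: (m |: X)).
have mB : m \notin B by rewrite mem_enum !inE eqxx.
have BE z : (z \in B) = (z != m) && (z \notin X) by rewrite mem_enum !inE negb_or.
have uB : uniq B by apply: enum_uniq.
have wB : apart B X by split=> // b; rewrite BE => /andP[].
have := @Phi_recursion _ _ _ (@tau_comm4 n) (@tau_rel3 n) (@tau_anti n)
  (fun i j => (hop_sq i j)%:M) (fun i j z => scalar_mx_central _ z) (@tau_sq n) m B X mB mX wB.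
rewrite -/(sqfree_mx (m |: X)) => ->.
have -> : \sum_(b <- B) tau m b + \sum_(a in X) tau m a = dunkl m.
  rewrite /dunkl /B big_enum [RHS](bigID (mem X)) /= [RHS]addrC; congr (_ + _).
    by apply: eq_bigl => l; rewrite !inE negb_or.
  by apply: eq_bigl => l /=; case: eqP => [->|]; rewrite ?(negbTE mX).
congr (_ * _ + _).
  rewrite (@sqfree_mx_Phi _ (m :: B)) ?cons_uniq ?mB // => z; rewrite !inE BE.
  by case: eqP => [->|].
apply: eq_bigr => l lX; rewrite (@sqfree_mx_Phi _ (l :: m :: B)) //.
  have lm : l != m by apply: contraNneq mX => <-.
  by rewrite !cons_uniq uB mB inE BE lX (negbTE lm) andbF.
move=> z; rewrite !inE BE.
by case: eqP => [->|] //=; case: eqP => [->|].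
Qed.

(** The class is read off the row of the unit class. *)
Definition sqfree (X : {set 'I_n}) : R := \sum_w ent (sqfree_mx X) 1%g w *: S w.

Lemma sqfree_mx0 : sqfree_mx (set0 : {set 'I_n}) = 1.
Proof. exact: Phi_set0. Qed.

(** The recursion for the operators builds, from the classes of smaller monomials, a
    class with the required operator. *)
Lemma mult_by_sqfree X : mult_by (sqfree X) (sqfree_mx X).
Proof.
suff [x hx] : exists x, mult_by x (sqfree_mx X) by rewrite /sqfree -(mult_by_val hx).
have [r] := ubnP #|X|; elim: r X => // r IH X; rewrite ltnS => leX.
have [->|/set0Pn[m mX]] := eqVneq X set0.
  by exists 1; rewrite sqfree_mx0; apply: mult_by1.
have cX : (#|X :\ m| < r)%N by move: leX; rewrite (cardsD1 m X) mX.
have mXm : m \notin X :\ m by rewrite !inE eqxx.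
have [y hy] := IH _ cX.
have H l : exists z, l \in X :\ m -> mult_by z (sqfree_mx (X :\ m :\ l)).
  have [lX|] := boolP (l \in X :\ m); last by exists 0.
  have [|z hz] := IH (X :\ m :\ l); last by exists z.
  by apply: leq_ltn_trans cX; rewrite [X in (_ <= X)%N](cardsD1 l) lX leq_addl.
have [z hz] := choice H.
exists (chern_root m * y + \sum_(l in X :\ m) hop_sq l m *: z l).
rewrite -[in sqfree_mx X](setD1K mX) sqfree_mx_rec //.
apply: mult_byD; first by apply: mult_byM => //; apply: mult_by_chern_root.
by apply: mult_by_sum => l lX; apply: mult_byZ; apply: hz.
Qed.

Lemma sqfreeE X x : mult_by x (sqfree_mx X) -> x = sqfree X.
Proof. by move=> hx; rewrite /sqfree -(mult_by_val hx). Qed.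

Lemma sqfree0 : sqfree set0 = 1.
Proof. by apply/esym/sqfreeE; rewrite sqfree_mx0; apply: mult_by1. Qed.

Lemma sqfree_rec m (X : {set 'I_n}) : m \notin X ->
  sqfree (m |: X) = chern_root m * sqfree X + \sum_(l in X) hop_sq l m *: sqfree (X :\ l).
Proof.
move=> mX; apply/esym/sqfreeE; rewrite sqfree_mx_rec //; apply: mult_byD.
  by apply: mult_byM; [apply: mult_by_chern_root | apply: mult_by_sqfree].
by apply: mult_by_sum => l lX; apply: mult_byZ; apply: mult_by_sqfree.
Qed.

Lemma hop_sq0 i j : (i.+1 < j)%N -> hop_sq i j = 0.
Proof. by rewrite /hop_sq => ij; case: ifP => //; lia. Qed.

Section Cut.
Variables (k : nat).

Lemma sqfree_far (X Y : {set 'I_n}) : (forall i, i \in X -> (i < k)%N) ->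
  (forall j, j \in Y -> (k < j)%N) -> sqfree (X :|: Y) = sqfree X * sqfree Y.
Proof.
move=> hX; have [r] := ubnP #|Y|; elim: r Y => // r IH Y; rewrite ltnS => leY hY.
have [->|/set0Pn[m mY]] := eqVneq Y set0; first by rewrite setU0 sqfree0 mulr1.
have cY : (#|Y :\ m| < r)%N by move: leY; rewrite (cardsD1 m Y) mY.
have mYm : m \notin Y :\ m by rewrite !inE eqxx.
have mX : m \notin X by apply/negP => /hX; have := hY m mY; lia.
have hYm j : j \in Y :\ m -> (k < j)%N by move=> /setD1P[_ /hY].
rewrite -(setD1K mY) setUCA sqfree_rec; last by rewrite inE negb_or mX.
rewrite sqfree_rec // IH // mulrDr mulrCA; congr (_ + _).
have dXY : [disjoint X & Y :\ m].
  rewrite -setI_eq0 -subset0; apply/subsetP => x; rewrite inE => /andP[/hX + /hYm]; lia.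
rewrite (eq_bigl [predU X & Y :\ m]) => [|z]; last by rewrite !inE.
rewrite bigU //= big1 ?add0r.
  rewrite mulr_sumr; apply: eq_bigr => l lY; rewrite -scalerAr.
  have <- : sqfree ((X :|: Y :\ m) :\ l) = sqfree X * sqfree (Y :\ m :\ l).
    rewrite -IH; first last.
    - by move=> j /setD1P[_ /hYm].
    - by apply: leq_ltn_trans cY; rewrite [X in (_ <= X)%N](cardsD1 l) lY leq_addl.
    congr (sqfree _); apply/setP => z; rewrite !inE; case: eqP => [->|] //=; rewrite ?andbF ?orbF.
    by apply/esym/negP => /hX; have := hYm l lY; lia.
  by [].
move=> l lX; rewrite hop_sq0 ?scale0r //; have := hX l lX; have := hY m mY; lia.
Qed.

(** Only the adjacent positions k - 1 and k interact across the cut, since hop_sq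
    vanishes for the other pairs. *)
Lemma sqfree_cut (X Y : {set 'I_n}) : (forall i, i \in X -> (i < k)%N) ->
  (forall j, j \in Y -> (k <= j)%N) ->
  sqfree (X :|: Y) = sqfree X * sqfree Y +
    \sum_(m in Y | m == k :> nat) \sum_(l in X) hop_sq l m *: (sqfree (X :\ l) * sqfree (Y :\ m)).
Proof.
move=> hX hY; have [/existsP[m /andP[mY /eqP em]]|no] :=
    boolP [exists m, (m \in Y) && (m == k :> nat)]; last first.
  rewrite big_pred0 ?addr0 => [|m]; last first.
    by apply/negbTE/negP => mk; case/negP: no; apply/existsP; exists m.
  apply: sqfree_far => // j jY; have := hY j jY; rewrite leq_eqVlt => /orP[/eqP e|//].
  by case/negP: no; apply/existsP; exists j; rewrite jY e eqxx.
rewrite (big_pred1 m) => [|j]; last first.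
  rewrite /= -[j == m]val_eqE /= em; case: eqP => [e|]; rewrite ?andbF ?andbT //.
  by rewrite (_ : j = m) //; apply: val_inj; rewrite /= e.
have mYm : m \notin Y :\ m by rewrite !inE eqxx.
have mX : m \notin X by apply/negP => /hX; lia.
have hYm j : j \in Y :\ m -> (k < j)%N.
  by move=> /setD1P[jm /hY]; move: jm; rewrite -val_eqE /=; lia.
rewrite -(setD1K mY) setUCA sqfree_rec; last by rewrite inE negb_or mX.
rewrite sqfree_rec // sqfree_far // mulrDr mulrCA -addrA; congr (_ + _).
have dXY : [disjoint X & Y :\ m].
  rewrite -setI_eq0 -subset0; apply/subsetP => x; rewrite inE => /andP[/hX + /hYm]; lia.
rewrite (eq_bigl [predU X & Y :\ m]) => [|z]; last by rewrite !inE.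
rewrite bigU //= addrC setU1K //; congr (_ + _).
  rewrite mulr_sumr; apply: eq_bigr => l lY; rewrite -scalerAr -sqfree_far //.
    congr (_ *: _); congr (sqfree _).
    apply/setP => z; rewrite !inE; case: eqP => [->|] //=; rewrite ?andbF ?orbF.
    by apply/esym/negP => /hX; have := hYm l lY; lia.
  by move=> j /setD1P[_ /hYm].
apply: eq_bigr => l lX; congr (_ *: _); rewrite -sqfree_far //; last by move=> i /setD1P[_ /hX].
congr sqfree; apply/setP => z; rewrite !inE; case: (z =P l) => [->|] //=.
by apply/esym/negP => lY; have := hX l lX; have := hYm l; rewrite !inE lY => /(_ isT); lia.
Qed.

End Cut.

End Representation.

(** * Orbits of permutations *)

Section Porbits.
Variable T : finType.
Implicit Types (s r : {perm T}) (x y z b : T) (Z : {set T}).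

Lemma porbit_sub s x Z : x \in Z -> (forall z, z \in Z -> s z \in Z) -> porbit s x \subset Z.
Proof.
move=> xZ sZ; apply/subsetP => _ /porbitP[i ->]; elim: i => [|i IH]; first by rewrite expg0 perm1.
by rewrite expgSr permM; apply: sZ.
Qed.

Lemma porbit_step s x z : (s z \in porbit s x) = (z \in porbit s x).
Proof. by rewrite porbit_sym -[s z](congr1 (fun p : {perm T} => p z) (expg1 s)) porbit_perm porbit_sym. Qed.

Lemma porbit_eq_on s r x Z : x \in Z -> (forall z, z \in Z -> s z \in Z) ->
  (forall z, z \in Z -> r z = s z) -> porbit r x = porbit s x.
Proof.
move=> xZ sZ rs.
have H i : (s ^+ i)%g x \in Z /\ (r ^+ i)%g x = (s ^+ i)%g x.
  elim: i => [|i [IH1 IH2]]; first by rewrite !expg0 perm1.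
  by rewrite !expgSr !permM IH2 rs //; split=> //; apply: sZ.
apply/setP => z; apply/porbitP/porbitP => -[i ->]; exists i; by have [_ ->] := H i.
Qed.

Lemma porbit_fix s x : (porbit s x == [set x]) = (s x == x).
Proof.
apply/eqP/eqP => [e|e].
  by have := porbit_step s x x; rewrite e !inE eqxx => /eqP.
apply/eqP; rewrite eqEsubset sub1set porbit_id andbT.
by apply: porbit_sub; rewrite ?inE // => z /set1P->; rewrite inE e.
Qed.

Lemma card_porbit_gt1 s x : (1 < #|porbit s x|)%N = (s x != x).
Proof.
have x1 : [set x] \subset porbit s x by rewrite sub1set porbit_id.
have := subset_leqif_card x1; rewrite cards1 => -[le1 e].
by rewrite ltn_neqAle le1 andbT e -porbit_fix eqEsubset x1 andbT.
Qed.

(** A transposition with a fixed point y of s inserts y into a cycle of s. *)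
Lemma porbit_extend s b y : b != y -> s y = y ->
  porbit (s * tperm y b) b = y |: porbit s b.
Proof.
move=> nby sy; set r := (_ * _)%g; have yb : y \notin porbit s b.
  apply: contra nby; rewrite porbit_sym => /(subsetP (porbit_sub (set11 y) _)) h.
  by rewrite -in_set1 h // => z /set1P->; rewrite sy inE.
have rE z : r z = tperm y b (s z) by rewrite permM.
apply/eqP; rewrite eqEsubset; apply/andP; split.
  apply: porbit_sub; first by rewrite !inE porbit_id orbT.
  move=> z; rewrite rE !inE => /orP[/eqP->|zb]; first by rewrite sy tpermL porbit_id orbT.
  case: tpermP => [_|_|_ _]; first by rewrite porbit_id orbT.
    by rewrite eqxx.
  by rewrite porbit_step zb orbT.
have sub : porbit s b \subset porbit r b.
  suff : porbit s b \subset porbit r b :&: porbit s b by rewrite subsetI => /andP[].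
  apply: porbit_sub; first by rewrite inE !porbit_id.
  move=> z; rewrite !inE porbit_step => /andP[zr zs]; rewrite zs andbT.
  have [->|sb] := eqVneq (s z) b; first exact: porbit_id.
  have sy' : s z != y by apply: contraNneq yb => <-; rewrite porbit_step.
  by rewrite -(tpermD (_ : y != s z) (_ : b != s z)) 1?eq_sym // -rE porbit_step.
rewrite subUset sub1set sub andbT.
have xb : s^-1%g b \in porbit r b.
  by apply: (subsetP sub); rewrite -porbit_step permKV porbit_id.
by have := porbit_step r b (s^-1%g b); rewrite rE permKV tpermR xb.
Qed.

End Porbits.

(** * Factorization of the operators over cycles *)

Section Support.
Variable n : nat.
Implicit Types (u v w : 'S_n) (i j k l a b c m : 'I_n) (X Y Z : {set 'I_n}).
Local Notation MS := ('M[Zq n]_#|{: 'S_n}|).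

(** Acts on positions, whereas w u^-1 acts on values; u conjugates one into the other. *)
Definition pos_perm u w : 'S_n := (w * u^-1)%g.

Lemma pos_permP u w x : u (pos_perm u w x) = w x.
Proof. by rewrite permM permKV. Qed.

Lemma pos_perm_fix u w x : (pos_perm u w x == x) = (w x == u x).
Proof. by rewrite -(inj_eq (@perm_inj _ u)) pos_permP. Qed.

Lemma pos_perm_tperm u w i j :
  pos_perm u w = (pos_perm (u ∘p tperm i j) w * tperm i j)%g.
Proof. by rewrite /pos_perm /pcomp invMg tpermV -!mulgA tperm2 mulg1. Qed.

Lemma pos_perm_rcoset u w i j :
  pos_perm u (w ∘p tperm i j) = (tperm i j * pos_perm u w)%g.
Proof. by rewrite /pos_perm /pcomp mulgA. Qed.

Lemma pos_permxx u : pos_perm u u = 1%g.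
Proof. by rewrite /pos_perm mulgV. Qed.

Lemma psupp1 : psupp (1%g : 'S_n) = set0.
Proof. by apply/setP => x; rewrite !inE perm1 eqxx. Qed.

Lemma exists_moved u w : w != u -> exists e, pos_perm u w e != e.
Proof.
move=> uw; apply/existsP; apply: contraNT uw => /existsPn h; apply/eqP/permP => x; apply/eqP.
by rewrite -pos_perm_fix; have := h x; rewrite negbK.
Qed.

Variable t : 'I_n -> 'I_n -> MS.
Hypothesis t_tperm : forall a b u w, a != b -> ent (t a b) u w != 0 -> w = u ∘p tperm a b.

Lemma entM_neq0 (M N : MS) u w : ent (M * N) u w != 0 ->
  exists2 v, ent M u v != 0 & ent N v w != 0.
Proof.
rewrite entM => h; have [/existsP[v /andP[]]|no] :=
  boolP [exists v, (ent M u v != 0) && (ent N v w != 0)]; first by exists v.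
case/eqP: h; rewrite big1 // => v _; apply/eqP; rewrite mulf_eq0.
by apply: contraNT no; rewrite negb_or => h; apply/existsP; exists v.
Qed.

Lemma ent_sum_neq0 (J : finType) (P : pred J) (F : J -> MS) u w :
  ent (\sum_(x | P x) F x) u w != 0 -> exists2 x, P x & ent (F x) u w != 0.
Proof.
rewrite ent_sum => h; have [/existsP[x /andP[]]|no] :=
  boolP [exists x, P x && (ent (F x) u w != 0)]; first by exists x.
case/eqP: h; rewrite big1 // => x Px; apply/eqP; apply: contraNT no => h.
by apply/existsP; exists x; rewrite Px.
Qed.

(** The star with center b sweeps exactly one cycle, that of b. *)
Lemma star_support b Y u w : b \notin Y -> ent (star t b Y) u w != 0 ->
  (forall x, x \notin b |: Y -> w x = u x) /\ porbit (pos_perm u w) b = b |: Y.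
Proof.
have [r] := ubnP #|Y|; elim: r Y u => // r IH Y u; rewrite ltnS => leY bY.
have [->|Y0] := eqVneq Y set0.
  rewrite star0 ent1; case: (u =P w) => [<-|]; last by rewrite eqxx.
  by move=> _; split=> //; rewrite setU0; apply/eqP; rewrite porbit_fix pos_permxx perm1.
rewrite star_recl // => /ent_sum_neq0[y yY] /entM_neq0[v].
have yb : y != b by apply: contraNneq bY => <-.
move=> /(t_tperm yb) -> h; have cY : (#|Y :\ y| < r)%N by move: leY; rewrite (cardsD1 y) yY.
have bYy : b \notin Y :\ y by rewrite inE negb_and bY orbT.
have [H1 H2] := IH _ _ cY bYy h.
split=> [x|].
  rewrite !inE negb_or => /andP[xb xY].
  have xy : x != y by apply: contraNneq xY => ->.
  by rewrite H1 ?pcomp_tpermD // !inE negb_or xb negb_and xY orbT.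
rewrite (pos_perm_tperm _ _ y b) porbit_extend ?H2 //; first by rewrite setUCA setD1K.
  by rewrite eq_sym.
apply/eqP; rewrite pos_perm_fix H1 // !inE negb_or yb /=.
by rewrite negb_and eqxx.
Qed.

Lemma Phi_support B X u w : apart B X -> ent (Phi t B X) u w != 0 ->
  forall x, x \notin B -> x \notin X -> w x = u x.
Proof.
elim: B X u => [|b B IH] X u.
  rewrite /=; case: (X =P set0) => [->|_]; last by rewrite ent0 eqxx.
  by rewrite ent1; case: (u =P w) => [->|]; rewrite ?eqxx.
case/apart_cons => bX bB wB; rewrite Phi_cons => /ent_sum_neq0[Y YX] /entM_neq0[v h1 h2] x.
rewrite !inE negb_or => /andP[xb xB] xX.
have bY : b \notin Y by apply: contra bX; apply: (subsetP YX).
have xY : x \notin Y by apply: contra xX; apply: (subsetP YX).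
have [H1 _] := star_support bY h1.
rewrite (IH _ _ _ h2) ?H1 ?inE ?negb_or ?negb_and ?xb ?xX ?orbT //.
by apply: apartS wB; rewrite subsetDl.
Qed.

(** Agrees with w on the orbit of b, and with u elsewhere. *)
Definition swap_orbit u w b : 'S_n :=
  u ∘p restr_perm (porbit (pos_perm u w) b) (pos_perm u w).

Lemma porbit_astabs (s : 'S_n) b : s \in 'N(porbit s b | 'P)%g.
Proof.
by apply/astabsP => x; rewrite /= apermE porbit_step.
Qed.

Lemma swap_orbit_in u w b x : x \in porbit (pos_perm u w) b -> swap_orbit u w b x = w x.
Proof.
move=> xb; rewrite /swap_orbit pcompE restr_permE ?porbit_astabs //; exact: pos_permP.
Qed.

Lemma swap_orbit_out u w b x : x \notin porbit (pos_perm u w) b -> swap_orbit u w b x = u x.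
Proof.
by move=> xb; rewrite /swap_orbit pcompE (out_perm (restr_perm_on _ _) xb).
Qed.

Lemma swap_orbitP u w b v : (forall x, x \in porbit (pos_perm u w) b -> v x = w x) ->
  (forall x, x \notin porbit (pos_perm u w) b -> v x = u x) -> v = swap_orbit u w b.
Proof.
move=> H1 H2; apply/permP => x; have [xb|xb] := boolP (x \in porbit (pos_perm u w) b).
  by rewrite H1 // swap_orbit_in.
by rewrite H2 // swap_orbit_out.
Qed.

(** Given u and w, the first center must sweep its whole orbit: the distribution of the
    leaves is forced, and so is the intermediate permutation. *)
Lemma Phi_cons_ent b B X u w : apart (b :: B) X ->
  ent (Phi t (b :: B) X) u w =
  if porbit (pos_perm u w) b :\ b \subset X
  then ent (star t b (porbit (pos_perm u w) b :\ b)) u (swap_orbit u w b) *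
       ent (Phi t B (X :\: porbit (pos_perm u w) b)) (swap_orbit u w b) w
  else 0.
Proof.
move=> wbB; have [bX bB wB] := apart_cons wbB; have [_ dB] := wB.
set C := porbit _ _.
have key Y v : Y \subset X -> ent (star t b Y) u v != 0 ->
    ent (Phi t B (X :\: Y)) v w != 0 -> Y = C :\ b /\ v = swap_orbit u w b.
  move=> YX h1 h2.
  have bY : b \notin Y by apply: contra bX; apply: (subsetP YX).
  have [H1 H2] := star_support bY h1.
  have wBY : apart B (X :\: Y) by apply: apartS wB; rewrite subsetDl.
  have H3 x : x \in b |: Y -> w x = v x.
    move=> xY; apply: (Phi_support wBY h2).
      move: xY; rewrite !inE => /orP[/eqP->//|xY]; apply/negP => /dB.
      by rewrite (subsetP YX).
    by move: xY; rewrite !inE => /orP[/eqP->|->//]; rewrite (negbTE bX) andbF.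
  have CE : C = b |: Y.
    rewrite -H2; apply: (porbit_eq_on (Z := b |: Y)); first by rewrite setU11.
      by move=> z; rewrite -H2 porbit_step.
    by move=> z zY; apply: (@perm_inj _ u); rewrite !pos_permP H3.
  split; first by rewrite CE setU1K.
  apply: swap_orbitP => x; rewrite -/C CE => xY; first by rewrite H3.
  by rewrite H1.
rewrite Phi_cons ent_sum.
have bC : b |: (C :\ b) = C by rewrite setD1K // porbit_id.
have XC : X :\: (C :\ b) = X :\: C.
  by apply/setP => x; rewrite !inE; case: eqP => [->|] //=; rewrite (negbTE bX) andbF.
case: ifP => CX.
  rewrite (bigD1 (C :\ b)) //= big1 ?addr0 => [|Y /andP[YX YC]].
    rewrite -XC entM (bigD1 (swap_orbit u w b)) //= big1 ?addr0 // => v vC.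
    apply/eqP; rewrite mulf_eq0; apply: contraNT vC; rewrite negb_or => /andP[h1 h2].
    by have [_ ->] := key _ _ CX h1 h2.
  apply/eqP; apply: contraNT YC => /entM_neq0[v h1 h2].
  by have [->] := key _ _ YX h1 h2.
rewrite big1 // => Y YX; apply/eqP; apply: contraFT CX => /entM_neq0[v h1 h2].
by have [<-] := key _ _ YX h1 h2.
Qed.

Lemma swap_orbit_perm_out u w b x : x \notin porbit (pos_perm u w) b ->
  pos_perm (swap_orbit u w b) w x = pos_perm u w x.
Proof.
move=> xC; apply: (@perm_inj _ (swap_orbit u w b)); rewrite pos_permP.
by rewrite swap_orbit_out ?pos_permP // porbit_step.
Qed.

Lemma swap_orbit_perm_in u w b x : x \in porbit (pos_perm u w) b ->
  pos_perm (swap_orbit u w b) w x = x.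
Proof. by move=> xC; apply/eqP; rewrite pos_perm_fix swap_orbit_in. Qed.

Lemma swap_orbit_porbit_out u w b x : x \notin porbit (pos_perm u w) b ->
  porbit (pos_perm (swap_orbit u w b) w) x = porbit (pos_perm u w) x.
Proof.
move=> xC; apply: (porbit_eq_on (Z := ~: porbit (pos_perm u w) b)); rewrite ?inE //.
  by move=> z; rewrite !inE porbit_step.
by move=> z; rewrite !inE; apply: swap_orbit_perm_out.
Qed.

(** A leaf moves along with its center. *)
Lemma Phi_leaf B X u w a : apart B X -> ent (Phi t B X) u w != 0 -> a \in X ->
  exists2 b, b \in B & a \in porbit (pos_perm u w) b.
Proof.
elim: B X u => [|b B IH] X u wB.
  by rewrite /=; case: (X =P set0) => [->|_]; rewrite ?inE // ent0 eqxx.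
rewrite Phi_cons_ent //; case: ifP => _; last by rewrite eqxx.
rewrite mulf_eq0 negb_or => /andP[_ h] aX.
have [aC|aC] := boolP (a \in porbit (pos_perm u w) b); first by exists b; rewrite ?inE ?eqxx.
have [_ _ wB'] := apart_cons wB.
have [||b' b'B ab'] := IH _ _ _ h; [|by rewrite inE aC|].
  by apply: apartS wB'; rewrite subsetDl.
exists b'; first by rewrite inE b'B orbT.
have [b'C|b'C] := boolP (b' \in porbit (pos_perm u w) b).
  move: ab'; have /eqP-> : porbit (pos_perm (swap_orbit u w b) w) b' == [set b'].
    by rewrite porbit_fix swap_orbit_perm_in.
  by move/set1P => e; rewrite e b'C in aC.
by move: ab'; rewrite swap_orbit_porbit_out.
Qed.

Hypothesis t_comm4 : forall a b c e, uniq [:: a; b; c; e] ->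
  t a b * t c e = t c e * t a b.

(** The centers are all the elements left in the universe N once X is removed. *)
Definition Phi_in (N X : {set 'I_n}) : MS := Phi t (enum (N :\: X)) X.

Lemma apart_Phi_in (N X : {set 'I_n}) : apart (enum (N :\: X)) X.
Proof. by split=> [|b]; rewrite ?enum_uniq // mem_enum inE => /andP[]. Qed.

Lemma porbit_same (s : 'S_n) b e : b \in porbit s e -> porbit s b = porbit s e.
Proof. by move=> h; apply/eqP; rewrite eq_porbit_mem. Qed.

Lemma Phi_in_orbit (N X : {set 'I_n}) u w b : b \in N ->
  let C := porbit (pos_perm u w) b in C \subset N -> X \subset N -> X :&: C = C :\ b ->
  ent (Phi_in N X) u w = ent (star t b (C :\ b)) u (swap_orbit u w b) *
    ent (Phi_in (N :\: C) (X :\: C)) (swap_orbit u w b) w.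
Proof.
move=> bN C CN XN XC.
have bX : b \notin X.
  by have := setD11 b C; rewrite -XC inE porbit_id andbT => ->.
have pB : perm_eq (enum (N :\: X)) (b :: enum (N :\: C :\: (X :\: C))).
  apply: uniq_perm; rewrite /= ?enum_uniq ?andbT ?mem_enum ?inE ?porbit_id ?andbF //.
  move=> x; rewrite inE !mem_enum !inE.
  have := congr1 (fun Z : {set 'I_n} => x \in Z) XC; rewrite !inE -/C.
  have [->|xb] /= := eqVneq x b; first by rewrite bX bN.
  by case: (x \in C); case: (x \in X).
rewrite /Phi_in (Phi_perm t_comm4 pB (apart_Phi_in _ _)) Phi_cons_ent; last first.
  have [uB dB] := apart_Phi_in N X; split; first by rewrite -(perm_uniq pB).
  by move=> c; rewrite -(perm_mem pB); apply: dB.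
by rewrite -/C -{1}XC subsetIl.
Qed.

(** In each cycle all the elements but one, the center, belong to X. Hence a sum over X
    splits into a sum over the center b in the cycle of e and a sum over the rest of X.
    The weight G lets the same expansion serve for sums and for generating polynomials. *)
Lemma orbit_expansion (K : nmodType) (G : {set 'I_n} -> Zq n -> K) (N : {set 'I_n}) u w e :
  (forall X, G X 0 = 0) ->
  let C := porbit (pos_perm u w) e in let v := swap_orbit u w e in C \subset N ->
  \sum_(X : {set 'I_n} | X \subset N) G X (ent (Phi_in N X) u w) =
  \sum_(b in C) \sum_(X : {set 'I_n} | X \subset N :\: C)
    G ((C :\ b) :|: X) (ent (star t b (C :\ b)) u v * ent (Phi_in (N :\: C) X) v w).
Proof.
move=> G0 C v CN.
have CE b : b \in C -> porbit (pos_perm u w) b = C by move/porbit_same.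
have vE b : b \in C -> swap_orbit u w b = v.
  by move=> bC; rewrite /v /swap_orbit CE.
transitivity (\sum_(b in C) \sum_(X : {set 'I_n} | (X \subset N) && (X :&: C == C :\ b))
   G X (ent (Phi_in N X) u w)).
  rewrite (exchange_big_dep (fun X : {set 'I_n} => X \subset N)) /=; last by move=> b X _ /andP[].
  apply: eq_bigr => X XN.
  have [/existsP[b /andP[bC /eqP XC]]|no] := boolP [exists b, (b \in C) && (X :&: C == C :\ b)].
    rewrite (big_pred1 b) // => b' /=; rewrite XN /= XC.
    apply/andP/eqP => [[b'C /eqP e']|->]; last by rewrite bC eqxx.
    by have := setD11 b' C; rewrite -e' !inE b'C andbT => /negbFE/eqP.
  rewrite big_pred0 => [|b]; last first.
    by apply: contraNF no => /and3P[bC _ h]; apply/existsP; exists b; rewrite bC.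
  have [->|h] := eqVneq (ent (Phi_in N X) u w) 0; first exact: G0.
  have [b bB eb] : exists2 b, b \in N :\: X & b \in C.
    have [eX|eX] := boolP (e \in X).
      have [b] := Phi_leaf (apart_Phi_in N X) h eX; rewrite mem_enum => bB eb.
      by exists b => //; rewrite porbit_sym.
    exists e; last exact: porbit_id.
    by rewrite inE eX (subsetP CN) ?porbit_id.
  case/negP: no; apply/existsP; exists b; rewrite eb /=.
  have bB' : b \in enum (N :\: X) by rewrite mem_enum.
  have pB : perm_eq (enum (N :\: X)) (b :: rem b (enum (N :\: X))) by apply: perm_to_rem.
  have wB : apart (b :: rem b (enum (N :\: X))) X.
    have [uB dB] := apart_Phi_in N X; split; first by rewrite -(perm_uniq pB).
    by move=> c; rewrite -(perm_mem pB); apply: dB.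
  move: h; rewrite /Phi_in (Phi_perm t_comm4 pB (apart_Phi_in _ _)) Phi_cons_ent // CE //.
  case: ifP => [CX _|]; last by rewrite eqxx.
  rewrite eqEsubset subsetI CX subD1set /= andbT; apply/subsetP => x; rewrite !inE.
  case/andP=> xX ->; rewrite andbT; apply: contraTneq xX => ->.
  by move: bB; rewrite inE => /andP[].
apply: eq_bigr => b bC.
rewrite (reindex_onto (fun X => (C :\ b) :|: X) (fun X => X :\: C)) /=; last first.
  move=> X /andP[_ /eqP <-]; apply/setP => x; rewrite !inE.
  by case: (x \in C); rewrite ?andbT ?andbF ?orbF.
apply: eq_big => [X|X /andP[/andP[XN /eqP XC] /eqP XD]]; last first.
  have bN : b \in N by apply: (subsetP CN).
  have := @Phi_in_orbit N (C :\ b :|: X) u w b bN.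
  by rewrite /= CE // vE // XD => ->.
apply/andP/idP => [[/andP[XN /eqP XC] /eqP XD]|XN].
  by rewrite -XD; apply: setSD.
have XC x : x \in X -> x \notin C by move=> /(subsetP XN); rewrite inE => /andP[].
split.
  apply/andP; split.
    rewrite subUset (subset_trans (subD1set _ _) CN) /=.
    by apply: subset_trans XN (subsetDl _ _).
  apply/eqP/setP => x; rewrite !inE; case xX : (x \in X); last by case: (x \in C);
    rewrite ?andbT ?andbF ?orbF.
  by rewrite (negbTE (XC _ xX)) !andbF.
apply/eqP/setP => x; rewrite !inE; case xX : (x \in X).
  by rewrite XC // orbT.
by case: (x \in C); rewrite ?andbF.
Qed.

Lemma Phi_in_disjoint (N X : {set 'I_n}) u : X != set0 -> ent (Phi_in N X) u u = 0.
Proof.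
case/set0Pn=> a aX; apply/eqP; apply/negP => /negP h.
have [b] := Phi_leaf (apart_Phi_in N X) h aX.
rewrite mem_enum inE pos_permxx => /andP[bX _].
have /eqP-> : porbit (1%g : 'S_n) b == [set b] by rewrite porbit_fix perm1.
by move/set1P => e; rewrite -e aX in bX.
Qed.

Lemma Phi_in_support (N X : {set 'I_n}) u w : X \subset N ->
  ent (Phi_in N X) u w != 0 -> forall x, x \notin N -> w x = u x.
Proof.
move=> XN h x xN; apply: (Phi_support (apart_Phi_in N X) h).
  by rewrite mem_enum inE negb_and xN orbT.
by apply: contra xN; apply: (subsetP XN).
Qed.

End Support.

Lemma tau_tperm (n : nat) (a b : 'I_n) (u w : 'S_n) :
  a != b -> ent (tau a b) u w != 0 -> w = u ∘p tperm a b.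
Proof.
move=> ab; rewrite /tau /antisym; case: ifP => _; rewrite ?entN ?oppr_eq0 ent_hop.
  by case: (w =P _) => //=; rewrite eqxx.
by rewrite tpermC; case: (w =P _) => //=; rewrite eqxx.
Qed.

(** Every nontrivial cycle is summed over all its possible centers, and sums of stars
    over their centers vanish. *)
Lemma sum_Phi_in0 (n : nat) (N : {set 'I_n}) (c : nat) : (0 < c)%N ->
  \sum_(X : {set 'I_n} | (X \subset N) && (#|X| == c)) Phi_in (@tau n) N X = 0.
Proof.
move=> c0; apply: ent_ext => u w; rewrite ent0 ent_sum.
have tt := @tau_tperm n.
have [->|uw] := eqVneq w u.
  rewrite big1 // => X /andP[_ /eqP cX]; apply: Phi_in_disjoint => //.
  by rewrite -card_gt0 cX.
have [e ew] := exists_moved uw.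
have [CN|/subsetPn[x xC xN]] := boolP (porbit (pos_perm u w) e \subset N); last first.
  rewrite big1 // => X /andP[XN _]; apply/eqP; apply/negP => /negP h.
  have /eqP := Phi_in_support tt XN h xN; rewrite -pos_perm_fix -porbit_fix (porbit_same xC).
  have := card_porbit_gt1 (pos_perm u w) e; rewrite ew => h1 /eqP h2.
  by rewrite h2 cards1 in h1.
rewrite big_mkcondr /=.
have G0 (X : {set 'I_n}) : (if #|X| == c then 0 else 0) = 0 :> Zq n by case: ifP.
rewrite (orbit_expansion tt (@tau_comm4 n) (G := fun X z => if #|X| == c then z else 0) G0 CN).
set C := porbit _ _; set v := swap_orbit _ _ _.
rewrite exchange_big big1 //= => X XN.
have cE b : b \in C -> #|C :\ b :|: X| = (#|C|.-1 + #|X|)%N.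
  move=> bC; rewrite cardsU (cardsD1 b C) bC (_ : _ :&: _ = set0) ?cards0 ?subn0 //.
  apply/setP => x; rewrite !inE; case xX: (x \in X); rewrite ?andbF //.
  by have := subsetP XN x xX; rewrite inE => /andP[/negbTE-> _]; rewrite andbF.
under eq_bigr => b bC do rewrite cE //.
case: (_ == c); last by rewrite big1.
rewrite -mulr_suml -ent_sum (sum_stars0 (@tau_comm4 n) (@tau_rel3 n) (@tau_anti n)).
  by rewrite ent0 mul0r.
by rewrite card_porbit_gt1.
Qed.

(** * Nonnegative coefficients *)

Section NonnegCoefs.
Variable n : nat.
Implicit Types (p q : Zq n) (al be ga : 'X_{1..n.-1}).

Definition nonneg_coefs p := forall al, 0 <= p@_al.

Lemma nonneg_coefs0 : nonneg_coefs 0.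
Proof. by move=> al; rewrite mcoeff0. Qed.

Lemma nonneg_coefsX be : nonneg_coefs 'X_[be].
Proof. by move=> al; rewrite mcoeffX ler0n. Qed.

Lemma nonneg_coefs1 : nonneg_coefs 1.
Proof. by rewrite -mpolyX0; apply: nonneg_coefsX. Qed.

Lemma nonneg_coefsD p q : nonneg_coefs p -> nonneg_coefs q -> nonneg_coefs (p + q).
Proof. by move=> hp hq al; rewrite mcoeffD addr_ge0. Qed.

Lemma nonneg_coefsM p q : nonneg_coefs p -> nonneg_coefs q -> nonneg_coefs (p * q).
Proof. by move=> hp hq al; rewrite mcoeffM sumr_ge0 // => k _; rewrite mulr_ge0. Qed.

Lemma nonneg_coefs_sum (J : Type) (r : seq J) (P : pred J) (F : J -> Zq n) :
  (forall x, P x -> nonneg_coefs (F x)) -> nonneg_coefs (\sum_(x <- r | P x) F x).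
Proof.
move=> h; apply: big_ind => //; [exact: nonneg_coefs0 | exact: nonneg_coefsD].
Qed.

Lemma mcoeffM_neq0 p q al : (p * q)@_al != 0 ->
  exists be ga, [/\ al = (be + ga)%MM, p@_be != 0 & q@_ga != 0].
Proof.
rewrite -mcoeff_msupp => /msuppM_le/allpairsP[[be ga] /=].
by rewrite !mcoeff_msupp => -[h1 h2 ->]; exists be, ga.
Qed.

Lemma mcoeff_sum_neq0 (J : finType) (P : pred J) (F : J -> Zq n) al :
  (\sum_(x | P x) F x)@_al != 0 -> exists2 x, P x & (F x)@_al != 0.
Proof.
rewrite raddf_sum /= => h; have [/existsP[x /andP[]]|no] :=
  boolP [exists x, P x && ((F x)@_al != 0)]; first by exists x.
case/eqP: h; rewrite big1 // => x Px; apply/eqP; apply: contraNT no => h.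
by apply/existsP; exists x; rewrite Px.
Qed.

Lemma mcoeffM_gt0 p q be ga : nonneg_coefs p -> nonneg_coefs q ->
  0 < p@_be -> 0 < q@_ga -> 0 < (p * q)@_(be + ga).
Proof.
move=> hp hq pb qg.
have -> : p * q = (p - 'X_[be]) * q + 'X_[be] * q by rewrite mulrBl subrK.
have hp' : nonneg_coefs (p - 'X_[be]).
  move=> al; rewrite mcoeffB mcoeffX; case: (eqVneq be al) => [<-|_]; last by rewrite subr0.
  by rewrite subr_ge0.
by rewrite mcoeffD [X in _ + X](_ : _ = q@_ga) ?ltr_wpDl ?nonneg_coefsM // mulrC mcoeffMX.
Qed.

End NonnegCoefs.

Section NonnegMatrices.
Variable n : nat.
Implicit Types (u v w : 'S_n) (i j k l a b c m : 'I_n) (X Y Z : {set 'I_n}) (al be ga : 'X_{1..n.-1}).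
Local Notation MS := ('M[Zq n]_#|{: 'S_n}|).
Implicit Types (M N : MS).

Definition nonneg_mx M := forall u w, nonneg_coefs (ent M u w).
Definition le_mx M N := nonneg_mx (N - M).

Lemma nonneg_mx0 : nonneg_mx 0.
Proof. by move=> u w; rewrite ent0; apply: nonneg_coefs0. Qed.

Lemma nonneg_mx1 : nonneg_mx 1.
Proof.
by move=> u w; rewrite ent1; case: eqP => _; [apply: nonneg_coefs1 | apply: nonneg_coefs0].
Qed.

Lemma nonneg_mxD M N : nonneg_mx M -> nonneg_mx N -> nonneg_mx (M + N).
Proof. by move=> hM hN u w; rewrite entD; apply: nonneg_coefsD. Qed.

Lemma nonneg_mxM M N : nonneg_mx M -> nonneg_mx N -> nonneg_mx (M * N).
Proof.
by move=> hM hN u w; rewrite entM; apply: nonneg_coefs_sum => v _; apply: nonneg_coefsM.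
Qed.

Lemma nonneg_mx_sum (J : Type) (r : seq J) (P : pred J) (F : J -> MS) :
  (forall x, P x -> nonneg_mx (F x)) -> nonneg_mx (\sum_(x <- r | P x) F x).
Proof.
move=> h; apply: big_ind => //; [exact: nonneg_mx0 | exact: nonneg_mxD].
Qed.

Lemma nonneg_hop i j : nonneg_mx (hop i j).
Proof.
by move=> u w; rewrite ent_hop; case: ifP => _; [apply: nonneg_coefsX | apply: nonneg_coefs0].
Qed.

Lemma nonneg_uhop i j : nonneg_mx (uhop i j).
Proof. by rewrite /uhop /sym; case: ifP => _; apply: nonneg_hop. Qed.

Lemma nonneg_star b Y : nonneg_mx (star (@uhop n) b Y).
Proof.
have [r] := ubnP #|Y|; elim: r Y => // r IH Y; rewrite ltnS => leY.
have [->|Y0] := eqVneq Y set0; first by rewrite star0; apply: nonneg_mx1.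
rewrite star_recl //; apply: nonneg_mx_sum => y yY; apply: nonneg_mxM.
  exact: nonneg_uhop.
by apply: IH; move: leY; rewrite (cardsD1 y) yY.
Qed.

Lemma nonneg_Phi B X : nonneg_mx (Phi (@uhop n) B X).
Proof.
elim: B X => [|b B IH] X /=.
  by case: (X == set0); [apply: nonneg_mx1 | apply: nonneg_mx0].
by apply: nonneg_mx_sum => Y _; apply: nonneg_mxM; [apply: nonneg_star | apply: IH].
Qed.

Lemma entM_gt0 M N u v w be ga : nonneg_mx M -> nonneg_mx N ->
  0 < (ent M u v)@_be -> 0 < (ent N v w)@_ga -> 0 < (ent (M * N) u w)@_(be + ga).
Proof.
move=> hM hN h1 h2; rewrite entM (bigD1 v) //= mcoeffD ltr_wpDr //; last exact: mcoeffM_gt0.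
rewrite nonneg_coefs_sum // => v' _; exact: nonneg_coefsM.
Qed.

Lemma entM_coef_neq0 M N u w al : (ent (M * N) u w)@_al != 0 ->
  exists v be ga, [/\ al = (be + ga)%MM, (ent M u v)@_be != 0 & (ent N v w)@_ga != 0].
Proof.
rewrite entM => /mcoeff_sum_neq0[v _] /mcoeffM_neq0[be [ga h]].
by exists v, be, ga.
Qed.

Lemma le_mx_gt0 M N u w al : le_mx M N -> 0 < (ent M u w)@_al -> 0 < (ent N u w)@_al.
Proof.
move=> h; have := h u w al; rewrite entD entN mcoeffB subr_ge0 => h1 h2.
exact: lt_le_trans h1.
Qed.

Lemma le_mx_sum (J : finType) (P : pred J) (F : J -> MS) x : P x ->
  (forall y, P y -> nonneg_mx (F y)) -> le_mx (F x) (\sum_(y | P y) F y).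
Proof.
move=> Px h; rewrite /le_mx (bigD1 x) //= addrAC subrr add0r.
by apply: nonneg_mx_sum => y /andP[Py _]; apply: h.
Qed.

Lemma le_mx_trans M N L : le_mx M N -> le_mx N L -> le_mx M L.
Proof. by move=> h1 h2; rewrite /le_mx -(subrK N L) -addrA; apply: nonneg_mxD. Qed.

Lemma le_mxM2r L M N : nonneg_mx L -> le_mx M N -> le_mx (M * L) (N * L).
Proof. by move=> hL h; rewrite /le_mx -mulrBl; apply: nonneg_mxM. Qed.

Lemma le_mx_add M N L : nonneg_mx L -> le_mx M N -> le_mx M (N + L).
Proof. by move=> hL h; rewrite /le_mx addrAC; apply: nonneg_mxD. Qed.

Lemma le_mx_sum2 (J : Type) (r : seq J) (P : pred J) (F G : J -> MS) :
  (forall x, P x -> le_mx (F x) (G x)) ->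
  le_mx (\sum_(x <- r | P x) F x) (\sum_(x <- r | P x) G x).
Proof. by move=> h; rewrite /le_mx -sumrB; apply: nonneg_mx_sum. Qed.

(** Last is one of the places that the new leaf may take in an ordering. *)
Lemma star_absorb_r b y Y : y \notin Y ->
  le_mx (star (@uhop n) b Y * uhop y b) (star (@uhop n) b (y |: Y)).
Proof.
move=> yY; rewrite [X in le_mx _ X]star_recr; last by apply/set0Pn; exists y; rewrite setU11.
rewrite -{1}(setU1K yY); apply: (@le_mx_sum _ (mem (y |: Y)) (fun z => _ * uhop z b) y).
  exact: setU11.
by move=> z _; apply: nonneg_mxM; [apply: nonneg_star | apply: nonneg_uhop].
Qed.

Lemma star_absorb_l b y Y : y \notin Y ->
  le_mx (uhop y b * star (@uhop n) b Y) (star (@uhop n) b (y |: Y)).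
Proof.
move=> yY; rewrite [X in le_mx _ X]star_recl; last by apply/set0Pn; exists y; rewrite setU11.
rewrite -{1}(setU1K yY); apply: (@le_mx_sum _ (mem (y |: Y)) (fun z => uhop z b * _) y).
  exact: setU11.
by move=> z _; apply: nonneg_mxM; [apply: nonneg_uhop | apply: nonneg_star].
Qed.

Lemma apartU1 (B : seq 'I_n) X x : apart B X -> x \notin B -> apart B (x |: X).
Proof.
by case=> uB dB xB; split=> // b bB; rewrite !inE negb_or dB // andbT; apply: (memPn xB).
Qed.

(** The star of b is brought next to the move by commutation, and absorbs it; the
    remaining terms of the larger product are nonnegative. *)
Lemma Phi_absorb_r B X b x : apart B X -> b \in B -> x \notin B -> x \notin X ->
  le_mx (Phi (@uhop n) B X * uhop x b) (Phi (@uhop n) B (x |: X)).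
Proof.
move=> wB bB xB xX; have [uB dB] := wB.
have xb : x != b by apply: contraNneq xB => ->.
rewrite (Phi_pull (@uhop_comm4 n) bB wB).
have wx := apartU1 wB xB.
rewrite (Phi_perm (@uhop_comm4 n) (perm_to_rem bB) wx) Phi_consU //.
apply: le_mx_add.
  by apply: nonneg_mx_sum => Y _; apply: nonneg_mxM; [apply: nonneg_star | apply: nonneg_Phi].
rewrite mulr_suml; apply: le_mx_sum2 => Y YX.
have bY : b \notin rem b B by rewrite mem_rem_uniq // inE eqxx.
have xr : x \notin rem b B by apply: contra xB => /mem_rem.
rewrite -mulrA -(Phi_comm1 (@uhop_comm4 n)) ?inE ?negb_and ?xX ?dB ?orbT //.
  rewrite mulrA; apply: le_mxM2r; first exact: nonneg_Phi.
  by apply: star_absorb_r; apply: contra xX; apply: (subsetP YX).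
by split=> [|c /mem_rem cB]; rewrite ?rem_uniq // inE negb_and dB ?orbT.
Qed.

Lemma Phi_absorb_l B X b x : apart B X -> b \in B -> x \notin B -> x \notin X ->
  le_mx (uhop x b * Phi (@uhop n) B X) (Phi (@uhop n) B (x |: X)).
Proof.
move=> wB bB xB xX; have [uB dB] := wB.
rewrite (Phi_pull (@uhop_comm4 n) bB wB).
have wx := apartU1 wB xB.
rewrite (Phi_perm (@uhop_comm4 n) (perm_to_rem bB) wx) Phi_consU //.
apply: le_mx_add.
  by apply: nonneg_mx_sum => Y _; apply: nonneg_mxM; [apply: nonneg_star | apply: nonneg_Phi].
rewrite mulr_sumr; apply: le_mx_sum2 => Y YX.
rewrite mulrA; apply: le_mxM2r; first exact: nonneg_Phi.
by apply: star_absorb_l; apply: contra xX; apply: (subsetP YX).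
Qed.

End NonnegMatrices.

(** * Words of moves *)

Section Words.
Variable n : nat.
Implicit Types (u v w : 'S_n) (i j k l a b c m : 'I_n) (X Y Z : {set 'I_n}) (al be ga : 'X_{1..n.-1}).
Implicit Types (s : seq ('I_n * 'I_n)).
Local Notation MS := ('M[Zq n]_#|{: 'S_n}|).

(** Words of exchanges of positions; a letter is taken in either orientation. *)
Definition step_ok u i j := if (i < j)%N then free_arc u i j else free_arc u j i.
Definition step_wt u i j := if (i < j)%N then hop_wt u i j else hop_wt u j i.

Definition act u s : 'S_n := foldl (fun v e => v ∘p tperm e.1 e.2) u s.

Fixpoint word_ok u s : bool :=
  if s is e :: s' then step_ok u e.1 e.2 && word_ok (u ∘p tperm e.1 e.2) s' else true.

Fixpoint word_wt u s : 'X_{1..n.-1} :=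
  if s is e :: s' then (step_wt u e.1 e.2 + word_wt (u ∘p tperm e.1 e.2) s')%MM else 0%MM.

Lemma ent_uhop i j u w : i != j ->
  ent (uhop i j) u w =
  if (w == u ∘p tperm i j) && step_ok u i j then 'X_[step_wt u i j] else 0.
Proof.
rewrite /uhop /sym /step_ok /step_wt -val_eqE /= neq_ltn.
by case: ltngtP => // _ _; rewrite ent_hop // tpermC.
Qed.

Lemma uhop_gt0 i j u : i != j -> step_ok u i j ->
  0 < (ent (uhop i j) u (u ∘p tperm i j))@_(step_wt u i j).
Proof. by move=> ij h; rewrite ent_uhop // h eqxx mcoeffX eqxx ltr01. Qed.

Lemma act_cat u s1 s2 : act u (s1 ++ s2) = act (act u s1) s2.
Proof. by rewrite /act foldl_cat. Qed.

Lemma word_ok_cat u s1 s2 : word_ok u (s1 ++ s2) = word_ok u s1 && word_ok (act u s1) s2.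
Proof. by elim: s1 u => //= e s1 IH u; rewrite IH andbA. Qed.

Lemma word_wt_cat u s1 s2 :
  word_wt u (s1 ++ s2) = (word_wt u s1 + word_wt (act u s1) s2)%MM.
Proof. by elim: s1 u => [|e s1 IH] u /=; rewrite ?add0m // IH addmA. Qed.

Definition verts s : seq 'I_n := map fst s ++ map snd s.

Lemma verts_cons e s x : (x \in verts (e :: s)) = [|| x == e.1, x == e.2 | x \in verts s].
Proof.
rewrite /verts /= !inE !mem_cat inE; case: (x == e.1) => //=.
by rewrite orbCA.
Qed.

Lemma verts_cat s1 s2 x : (x \in verts (s1 ++ s2)) = (x \in verts s1) || (x \in verts s2).
Proof. by elim: s1 => //= e s1 IH; rewrite !verts_cons IH !orbA. Qed.

Lemma act_fix u s x : x \notin verts s -> act u s x = u x.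
Proof.
elim: s u => //= e s IH u; rewrite verts_cons !negb_or => /and3P[x1 x2 xs].
by rewrite IH // pcomp_tpermD.
Qed.

(** The words that an operator with leaves X produces: P relates the leaf and the center
    of each letter. *)
Definition is_word_of (P : 'I_n -> 'I_n -> Prop) (X : {set 'I_n}) u w al s :=
  [/\ act u s = w, word_ok u s, word_wt u s = al, size s = #|X| &
     (forall e, e \in s -> P e.1 e.2) /\ (forall x, x \in X -> x \in verts s)].

Section Signed.
Variable t : 'I_n -> 'I_n -> MS.
Hypothesis t_step : forall a b u w al, a != b -> (ent (t a b) u w)@_al != 0 ->
  [/\ w = u ∘p tperm a b, step_ok u a b & al = step_wt u a b].

Lemma star_word b Y u w al : b \notin Y -> (ent (star t b Y) u w)@_al != 0 ->
  exists s, is_word_of (fun x y => x \in Y /\ y = b) Y u w al s.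
Proof.
have [r] := ubnP #|Y|; elim: r Y u al => // r IH Y u al; rewrite ltnS => leY bY.
have [->|Y0] := eqVneq Y set0.
  rewrite star0 ent1; case: (u =P w) => [<-|]; last by rewrite mcoeff0 eqxx.
  rewrite mcoeff1; case: (al =P 0%MM) => [->|]; last by rewrite eqxx.
  by move=> _; exists [::]; split=> //=; rewrite ?cards0 //; split=> // x; rewrite inE.
rewrite star_recl // ent_sum => /mcoeff_sum_neq0[y yY] /entM_coef_neq0[v [be [ga [-> h1 h2]]]].
have yb : y != b by apply: contraNneq bY => <-.
have [ev ok eb] := t_step yb h1.
have bYy : b \notin Y :\ y by rewrite inE negb_and bY orbT.
have [|s [h3 h4 h5 h6 [h7 h8]]] := IH (Y :\ y) v ga _ bYy h2.
  by move: leY; rewrite (cardsD1 y) yY.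
exists ((y, b) :: s); split=> /=; rewrite -?ev ?ok ?h4 ?eb ?h5 //.
  by rewrite h6 [RHS](cardsD1 y) yY.
split=> [e|x xY].
  by rewrite inE => /orP[/eqP->//|/h7[/setD1P[_ ?] ?]].
by rewrite verts_cons /=; have [//|xy] := eqVneq x y; rewrite h8 ?orbT // !inE xy.
Qed.

Lemma Phi_word B X u w al : apart B X -> (ent (Phi t B X) u w)@_al != 0 ->
  exists s, is_word_of (fun x y => x \in X /\ y \in B) X u w al s.
Proof.
elim: B X u al => [|b B IH] X u al wB.
  rewrite /=; case: (X =P set0) => [->|_]; last by rewrite ent0 mcoeff0 eqxx.
  rewrite ent1; case: (u =P w) => [<-|]; last by rewrite mcoeff0 eqxx.
  rewrite mcoeff1; case: (al =P 0%MM) => [->|]; last by rewrite eqxx.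
  by move=> _; exists [::]; split=> //=; rewrite ?cards0 //; split=> // x; rewrite inE.
have [bX bB wB'] := apart_cons wB.
rewrite Phi_cons ent_sum => /mcoeff_sum_neq0[Y YX] /entM_coef_neq0[v [be [ga [-> h1 h2]]]].
have bY : b \notin Y by apply: contra bX; apply: (subsetP YX).
have [s1 [a1 a2 a3 a4 [a5 a6]]] := star_word bY h1.
have [|s2 [b1 b2 b3 b4 [b5 b6]]] := IH _ _ _ _ h2; first by apply: apartS wB'; rewrite subsetDl.
exists (s1 ++ s2); split; rewrite ?act_cat ?word_ok_cat ?word_wt_cat ?a1 ?a2 ?a3 //=.
- by rewrite b3.
- by rewrite size_cat a4 b4 cardsD (setIidPr YX) subnKC // subset_leq_card.
split=> [e|x xX].
  rewrite mem_cat inE => /orP[/a5[/(subsetP YX) h ->]|/b5[/setDP[h _] h']]; first by rewrite eqxx.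
  by rewrite h' orbT.
by rewrite verts_cat; have [/a6->//|xY] := boolP (x \in Y); rewrite b6 ?orbT // inE xY.
Qed.

End Signed.

Lemma uhop_step a b u w al : a != b -> (ent (uhop a b) u w)@_al != 0 ->
  [/\ w = u ∘p tperm a b, step_ok u a b & al = step_wt u a b].
Proof.
move=> ab; rewrite ent_uhop //; case: (w =P _) => [->|_] /=; last by rewrite mcoeff0 eqxx.
case: ifP => // _; last by rewrite mcoeff0 eqxx.
by rewrite mcoeffX; case: (_ =P al) => [->|]; rewrite ?eqxx.
Qed.

Lemma tau_step a b u w al : a != b -> (ent (tau a b) u w)@_al != 0 ->
  [/\ w = u ∘p tperm a b, step_ok u a b & al = step_wt u a b].
Proof.
move=> ab h; apply: uhop_step => //; move: h; rewrite /tau /uhop /antisym /sym.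
by case: ifP => // _; rewrite entN mcoeffN oppr_eq0.
Qed.

End Words.

(** * Quantum Pieri formulas without cancellation *)

Section SignChange.
Variables (I : finType) (A : pzRingType) (t t' : I -> I -> A) (e : bool).

Lemma star_sign b (Y : {set I}) : (forall y, y \in Y -> t y b = (-1) ^+ e * t' y b) ->
  star t b Y = (-1) ^+ (e * #|Y|) * star t' b Y.
Proof.
have [r] := ubnP #|Y|; elim: r Y => // r IH Y; rewrite ltnS => leY h.
have [->|Y0] := eqVneq Y set0; first by rewrite !star0 cards0 muln0 mulr1.
rewrite !star_recl // mulr_sumr; apply: eq_bigr => y yY.
have cY : (#|Y :\ y| < r)%N by move: leY; rewrite (cardsD1 y) yY.
rewrite h // IH // => [|z /setD1P[_]]; last exact: h.
rewrite mulrA -[_ * t' y b * _]mulrA commr_sign !mulrA -exprD; congr (_ ^+ _ * _ * _).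
by rewrite (cardsD1 y Y) yY mulnDr muln1.
Qed.

Lemma Phi_sign B (X : {set I}) :
  (forall y b, y \in X -> b \in B -> t y b = (-1) ^+ e * t' y b) ->
  Phi t B X = (-1) ^+ (e * #|X|) * Phi t' B X.
Proof.
elim: B X => [|b B IH] X h.
  rewrite /=; have [->|_] := eqVneq X set0; first by rewrite cards0 muln0 mulr1.
  by rewrite mulr0.
rewrite !Phi_cons mulr_sumr; apply: eq_bigr => Y YX.
rewrite (@star_sign b Y) => [|y yY]; last by rewrite h ?inE ?eqxx // (subsetP YX).
rewrite IH => [|y c /setDP[yX _] cB]; last by rewrite h // inE cB orbT.
rewrite mulrA -[_ * star t' b Y * _]mulrA commr_sign !mulrA -exprD; congr (_ ^+ _ * _ * _).
by rewrite -mulnDr cardsD (setIidPr YX) subnKC // subset_leq_card.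
Qed.

End SignChange.

Section Pieri.
Variable n : nat.
Implicit Types (u v w : 'S_n) (i j l m : 'I_n) (X Y Z N : {set 'I_n}).
Local Notation MS := ('M[Zq n]_#|{: 'S_n}|).

(** The operator of X has all the other positions as centers. Sorting its leaves by
    whether the center lies in N or not, the leaves with a center in N cancel in the sum
    over X, so only the centers outside N remain. *)
Lemma sum_sqfree_mx N (c : nat) :
  \sum_(X : {set 'I_n} | (X \subset N) && (#|X| == c)) sqfree_mx X =
  \sum_(X : {set 'I_n} | (X \subset N) && (#|X| == c)) Phi (@tau n) (enum (~: N)) X.
Proof.
pose F (Y W : {set 'I_n}) : MS := if (#|Y| + #|W|)%N == c then
  Phi (@tau n) (enum (~: N)) Y * Phi_in (@tau n) (N :\: Y) W else 0.
rewrite big_mkcondr /= (eq_bigr (fun X : {set 'I_n} => \sum_(Y : {set 'I_n} | Y \subset X) F Y (X :\: Y))).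
  rewrite (nested_subset (fun Y W _ => F Y W)) [RHS]big_mkcondr /=; apply: eq_bigr => Y YN.
  have [cY|cY] := eqVneq #|Y| c.
    rewrite (bigD1 set0) ?sub0set //= big1 ?addr0 => [|W /andP[_ W0]].
      by rewrite /F cards0 addn0 cY eqxx /Phi_in Phi_set0 mulr1.
    by move: W0; rewrite -card_gt0 /F cY => W0; case: eqP => //; lia.
  have [cYl|cYl] := ltnP #|Y| c; last first.
    by rewrite big1 // => W _; rewrite /F; case: eqP => // e; move: cY => /eqP; lia.
  rewrite /F -big_mkcondr /=.
  rewrite (eq_bigl (fun W : {set 'I_n} => (W \subset N :\: Y) && (#|W| == c - #|Y|)%N)) => [|W].
    by rewrite -mulr_sumr sum_Phi_in0 ?mulr0 // subn_gt0.
  by congr (_ && _); apply/eqP/eqP => [<-|->]; rewrite ?addKn ?subnKC // ltnW.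
move=> X XN; have [cX|cX] := eqVneq #|X| c; last first.
  rewrite big1 // => Y YX; rewrite /F cardsD (setIidPr YX) subnKC ?subset_leq_card //.
  by rewrite (negbTE cX).
have -> : sqfree_mx X = Phi (@tau n) (enum (~: N) ++ enum (N :\: X)) X.
  apply: sqfree_mx_Phi => [|x].
    rewrite cat_uniq !enum_uniq andbT /=; apply/hasPn => x; rewrite !mem_enum !inE.
    by case/andP=> _ ->.
  rewrite mem_cat !mem_enum !inE; case xN : (x \in N) => //=; first by rewrite andbT.
  by apply/esym; apply: contraFN xN; apply: (subsetP XN).
rewrite Phi_cat; apply: eq_bigr => Y YX.
rewrite /F cardsD (setIidPr YX) subnKC ?subset_leq_card // cX eqxx /Phi_in.
congr (_ * Phi _ _ _); apply: eq_enum => x; rewrite !inE.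
by case xY: (x \in Y) => /=; rewrite ?andbF ?andbT // (subsetP YX x xY).
Qed.

Variable k : nat.

Definition low : {set 'I_n} := [set i : 'I_n | (i < k)%N].
Definition high : {set 'I_n} := [set i : 'I_n | (k <= i)%N].

Lemma lowC : ~: low = high.
Proof. by apply/setP => x; rewrite !inE -leqNgt. Qed.
Lemma highC : ~: high = low.
Proof. by apply/setP => x; rewrite !inE -ltnNge. Qed.

Definition e_mx (a : nat) : MS :=
  \sum_(X : {set 'I_n} | (X \subset low) && (#|X| == a)) Phi (@uhop n) (enum high) X.
Definition h_mx (b : nat) : MS :=
  \sum_(X : {set 'I_n} | (X \subset high) && (#|X| == b)) Phi (@uhop n) (enum low) X.

Lemma nonneg_e_mx a : nonneg_mx (e_mx a).
Proof. by apply: nonneg_mx_sum => X _; apply: nonneg_Phi. Qed.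
Lemma nonneg_h_mx a : nonneg_mx (h_mx a).
Proof. by apply: nonneg_mx_sum => X _; apply: nonneg_Phi. Qed.

(** All the moves go across the cut, in the same direction, hence with the same sign. *)
Lemma e_mxE a : e_mx a = \sum_(X : {set 'I_n} | (X \subset low) && (#|X| == a)) sqfree_mx X.
Proof.
rewrite sum_sqfree_mx lowC; apply: eq_bigr => X /andP[XL _].
rewrite (@Phi_sign _ _ (@tau n) (@uhop n) false) ?mul1r // => y b yX.
rewrite mem_enum inE => kb; have := subsetP XL y yX; rewrite inE => yk.
by rewrite tau_uhop leqNgt (leq_trans yk).
Qed.

Lemma h_mxE b : h_mx b =
  (-1) ^+ b * \sum_(X : {set 'I_n} | (X \subset high) && (#|X| == b)) sqfree_mx X.
Proof.
rewrite sum_sqfree_mx highC mulr_sumr; apply: eq_bigr => X /andP[XH /eqP cX].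
rewrite (@Phi_sign _ _ (@tau n) (@uhop n) true) => [|y c yX].
  by rewrite mul1n cX mulrA -exprD addnn -muln2 exprM sqrr_sign mul1r.
rewrite mem_enum inE => ck; have := subsetP XH y yX; rewrite inE => ky.
by rewrite tau_uhop (leq_trans (ltnW ck) ky).
Qed.

(** The quantization of e_a(x_1..x_k) h_b(x_1..x_k) up to shorter terms: a variables are
    taken before the cut and b after it, where the signed sum of the squarefree
    monomials plays the role of h_b. *)
Definition eh_mx (a b : nat) : MS := (-1) ^+ b *
  \sum_(X : {set 'I_n} | (X \subset low) && (#|X| == a))
  \sum_(Y : {set 'I_n} | (Y \subset high) && (#|Y| == b)) sqfree_mx (X :|: Y).

Definition eh_corr (a b : nat) : MS := (-1) ^+ b *
  \sum_(X : {set 'I_n} | (X \subset low) && (#|X| == a))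
  \sum_(Y : {set 'I_n} | (Y \subset high) && (#|Y| == b))
  \sum_(m in Y | m == k :> nat) \sum_(l in X)
    (hop_sq l m)%:M * (sqfree_mx (X :\ l) * sqfree_mx (Y :\ m)).

Section Classes.
Variables (R : comAlgType (Zq n)) (S : 'S_n -> R) (qH : qH_flag S).

Definition e_class a : R := \sum_(X : {set 'I_n} | (X \subset low) && (#|X| == a)) sqfree S X.
Definition h_class b : R :=
  (-1) ^+ b * \sum_(X : {set 'I_n} | (X \subset high) && (#|X| == b)) sqfree S X.
Definition eh_class a b : R := (-1) ^+ b *
  \sum_(X : {set 'I_n} | (X \subset low) && (#|X| == a))
  \sum_(Y : {set 'I_n} | (Y \subset high) && (#|Y| == b)) sqfree S (X :|: Y).

Lemma mult_by_sign (c : nat) x (M : MS) : mult_by S x M -> mult_by S ((-1) ^+ c * x) ((-1) ^+ c * M).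
Proof.
move=> h; rewrite -![(-1) ^+ c]signr_odd; case: (odd c); rewrite ?mul1r // !mulN1r.
exact: mult_byN.
Qed.

Lemma mult_by_e a : mult_by S (e_class a) (e_mx a).
Proof. by rewrite e_mxE; apply: mult_by_sum => X _; apply: mult_by_sqfree. Qed.

Lemma mult_by_h b : mult_by S (h_class b) (h_mx b).
Proof. by rewrite h_mxE; apply/mult_by_sign/mult_by_sum => X _; apply: mult_by_sqfree. Qed.

Lemma mult_by_eh a b : mult_by S (eh_class a b) (eh_mx a b).
Proof.
apply/mult_by_sign/mult_by_sum => X _; apply: mult_by_sum => Y _; exact: mult_by_sqfree.
Qed.

(** Operators of classes of a commutative ring commute. *)
Lemma e_h_comm a b : e_mx a * h_mx b = h_mx b * e_mx a.
Proof.
apply: (mult_by_unique qH (mult_byM (mult_by_e a) (mult_by_h b))).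
by rewrite mulrC; apply: mult_byM; [apply: mult_by_h | apply: mult_by_e].
Qed.

(** The cut formula for squarefree monomials, summed and read on the operators. *)
Lemma eh_mxE a b : eh_mx a b = e_mx a * h_mx b + eh_corr a b.
Proof.
apply: (mult_by_unique qH (mult_by_eh a b)).
pose corr : R := (-1) ^+ b *
  \sum_(X : {set 'I_n} | (X \subset low) && (#|X| == a))
  \sum_(Y : {set 'I_n} | (Y \subset high) && (#|Y| == b))
  \sum_(m in Y | m == k :> nat) \sum_(l in X)
    hop_sq l m *: (sqfree S (X :\ l) * sqfree S (Y :\ m)).
have -> : eh_class a b = e_class a * h_class b + corr.
  rewrite /eh_class /e_class /h_class mulrCA -mulrDr; congr (_ * _).
  rewrite big_distrlr -big_split; apply: eq_bigr => X /andP[XL _].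
  rewrite -big_split; apply: eq_bigr => Y /andP[YH _]; apply: sqfree_cut => //.
    by move=> i /(subsetP XL); rewrite inE.
  by move=> j /(subsetP YH); rewrite inE.
apply: mult_byD; first by apply: mult_byM; [apply: mult_by_e | apply: mult_by_h].
apply/mult_by_sign/mult_by_sum => X _; apply: mult_by_sum => Y _.
apply: mult_by_sum => m _; apply: mult_by_sum => l _; apply: mult_byZ.
by apply: mult_byM; apply: mult_by_sqfree.
Qed.

End Classes.

End Pieri.

(** * Counting cycles *)

Section Stats.
Variable n : nat.
Implicit Types (u v w s : 'S_n) (i j k l a b c m e : 'I_n) (X Y Z N C D : {set 'I_n}).

Lemma card_porbits s : (#|porbits s| + #|psupp s| = ncyc s + n)%N.
Proof.
have cn : (#|psupp s| + #|~: psupp s| = n)%N by rewrite cardsC card_ord.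
suff h : #|porbits s| = (ncyc s + #|~: psupp s|)%N by move: cn h; lia.
rewrite -(cardsID [set D : {set 'I_n} | (1 < #|D|)%N] (porbits s)); congr (_ + _)%N.
  by rewrite /ncyc setIdE.
rewrite -[RHS](card_imset _ (@set1_inj _)); apply: eq_card => D; rewrite !inE.
apply/andP/imsetP => [[nD /imsetP[x _ eD]]|[x xs ->]].
  exists x; rewrite ?inE ?eD; move: nD; rewrite eD card_porbit_gt1 negbK => sx; first by rewrite ?negbK.
  by apply/eqP; rewrite porbit_fix.
move: xs; rewrite !inE negbK -porbit_fix => /eqP e; rewrite cards1 ltnn; split=> //.
by apply/imsetP; exists x.
Qed.

Lemma ncyc_le s : (2 * ncyc s <= #|psupp s|)%N.
Proof.
pose P := [set D in porbits s | (1 < #|D|)%N].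
have tP : trivIset P.
  apply/trivIsetP => A B; rewrite !inE => /andP[/imsetP[x _ ->] _] /andP[/imsetP[y _ ->] _] AB.
  rewrite -setI_eq0; apply: contraNT AB => /set0Pn[z]; rewrite inE => /andP[zx zy].
  by rewrite -(porbit_same zx) -(porbit_same zy).
have cP : cover P \subset psupp s.
  apply/bigcupsP => D; rewrite !inE => /andP[/imsetP[x _ ->] cx].
  apply/subsetP => y yx; rewrite inE -card_porbit_gt1 (porbit_same yx) //.
apply: leq_trans (subset_leq_card cP); rewrite -(eqP tP) mulnC /ncyc -/P -sum_nat_const.
by apply: leq_sum => D; rewrite inE => /andP[].
Qed.

Lemma act_rcons u (s : seq ('I_n * 'I_n)) (e : 'I_n * 'I_n) : act u (rcons s e) = act u s ∘p tperm e.1 e.2.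
Proof. by rewrite -cats1 act_cat. Qed.

(** A transposition changes the number of cycles by one, so a product of r
    transpositions has at least n - r cycles. *)
Lemma word_length u (s : seq ('I_n * 'I_n)) : (n <= #|porbits (pos_perm u (act u s))| + size s)%N.
Proof.
elim/last_ind: s => [|s d IH].
  rewrite addn0 /= pos_permxx -{1}(card_ord n) -cardsT -[X in (X <= _)%N](card_imset _ (@set1_inj _)).
  apply: subset_leq_card; apply/subsetP => _ /imsetP[x _ ->]; apply/imsetP; exists x => //.
  by apply/esym/eqP; rewrite porbit_fix perm1.
rewrite size_rcons act_rcons pos_perm_rcoset.
have := porbits_mul_tperm (pos_perm u (act u s)) d.1 d.2.
have : d.1 \notin porbit (pos_perm u (act u s)) d.2 -> d.1 != d.2.
  by apply: contraNneq => ->; apply: porbit_id.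
move: IH => + /=; move: #|porbits (tperm _ _ * _)| #|porbits _| => A B.
by case: (_ \notin _) => /=; case: (_ != _) => /=; lia.
Qed.

Lemma ncyc1 : ncyc (1%g : 'S_n) = 0%N.
Proof. by have := ncyc_le (1%g : 'S_n); rewrite psupp1 cards0; lia. Qed.

Lemma swap_orbit_psupp u w e :
  psupp (pos_perm (swap_orbit u w e) w) = psupp (pos_perm u w) :\: porbit (pos_perm u w) e.
Proof.
apply/setP => x; rewrite !inE; have [xC|xC] /= := boolP (x \in _).
  by rewrite swap_orbit_perm_in // eqxx.
by rewrite swap_orbit_perm_out.
Qed.

Lemma porbit_psupp s e : s e != e -> porbit s e \subset psupp s.
Proof.
by move=> se; apply/subsetP => x xe; rewrite inE -card_porbit_gt1 (porbit_same xe) card_porbit_gt1.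
Qed.

Lemma swap_orbit_ncyc u w e : pos_perm u w e != e ->
  ncyc (pos_perm u w) = (ncyc (pos_perm (swap_orbit u w e) w)).+1.
Proof.
move=> he; set s := pos_perm u w; set r := pos_perm _ w; set C := porbit s e.
have -> : ncyc s = #|C |: [set D in porbits r | (1 < #|D|)%N]|.
  apply: eq_card => D; rewrite !inE; apply/andP/orP => [[/imsetP[x _ ->] cx]|].
    have [xC|xC] := boolP (x \in C); first by left; rewrite (porbit_same xC).
    right; rewrite cx andbT; apply/imsetP; exists x => //.
    by rewrite swap_orbit_porbit_out.
  case=> [/eqP->|/andP[/imsetP[x _ ->] cx]].
    by rewrite card_porbit_gt1; split=> //; apply/imsetP; exists e.
  have xC : x \notin C.
    by apply: contraTN cx => xC; rewrite card_porbit_gt1 negbK swap_orbit_perm_in.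
  by move: cx; rewrite /r swap_orbit_porbit_out //; split=> //; apply/imsetP; exists x.
rewrite cardsU1 (_ : C \notin _) //; rewrite inE negb_and; apply/orP; left.
apply/negP => /imsetP[x _ eC]; have xC : x \in C by rewrite eC porbit_id.
have := card_porbit_gt1 s e; rewrite -/C he eC card_porbit_gt1.
by rewrite swap_orbit_perm_in // eqxx.
Qed.

Lemma swap_orbit_porbit u w e : porbit (pos_perm u (swap_orbit u w e)) e = porbit (pos_perm u w) e.
Proof.
apply: (porbit_eq_on (Z := porbit (pos_perm u w) e)); first exact: porbit_id.
  by move=> z; rewrite porbit_step.
by move=> z zC; apply: (@perm_inj _ u); rewrite !pos_permP swap_orbit_in.
Qed.

Lemma swap_orbit_single u w e : pos_perm u w e != e ->
  psupp (pos_perm u (swap_orbit u w e)) = porbit (pos_perm u w) e.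
Proof.
move=> he; apply/setP => x; rewrite inE pos_perm_fix.
have [xC|xC] := boolP (x \in _); last by rewrite swap_orbit_out // eqxx.
rewrite swap_orbit_in // -pos_perm_fix.
by rewrite -card_porbit_gt1 (porbit_same xC) card_porbit_gt1.
Qed.

Lemma swap_orbit_id u v e : psupp (pos_perm u v) = porbit (pos_perm u v) e ->
  swap_orbit u v e = v.
Proof.
move=> h; apply/esym/swap_orbitP => // x; rewrite -h inE negbK pos_perm_fix.
by move/eqP.
Qed.

End Stats.

(** * Winding numbers *)

Section Winding.
Variable n : nat.
Implicit Types (u v w : 'S_n) (i j l a b m : 'I_n) (X Y : {set 'I_n}) (al be : 'X_{1..n.-1}).

Definition mnm_val al (t : nat) : nat := if insub t is Some x then al x else 0%N.

(** The number of times the value at position l winds around: a step from i to j that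
    wraps has exponent q_i ... q_(j-1), and moves i up past the top value and j down
    past the bottom. *)
Definition wind al (l : nat) : int :=
  (mnm_val al l)%:Z - (if l is l'.+1 then mnm_val al l' else 0%N)%:Z.

Lemma mnm_val0 t : mnm_val 0%MM t = 0%N.
Proof. by rewrite /mnm_val; case: insubP => // x _ _; rewrite mnm0E. Qed.

Lemma mnm_valD al be t : mnm_val (al + be)%MM t = (mnm_val al t + mnm_val be t)%N.
Proof. by rewrite /mnm_val; case: insubP => // x _ _; rewrite mnmDE. Qed.

Lemma mnm_val_qexp i j t : mnm_val (qexp i j) t = (i <= t < j)%N.
Proof.
rewrite /mnm_val; case: insubP => [x _ <-|]; first by rewrite mnmE.
by rewrite -leqNgt; have := ltn_ord j; lia.
Qed.

Lemma wind0 (l : nat) : wind 0%MM l = 0.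
Proof. by rewrite /wind mnm_val0; case: l => // l; rewrite mnm_val0. Qed.

Lemma windD al be (l : nat) : wind (al + be)%MM l = wind al l + wind be l.
Proof.
rewrite /wind mnm_valD; case: l => [|l'] /=; rewrite ?mnm_valD ?subr0 ?PoszD //.
by rewrite opprD addrACA.
Qed.

Lemma wind_qexp i j l : (i < j)%N -> wind (qexp i j) l = (l == i)%:R - (l == j)%:R :> int.
Proof.
move=> ij; rewrite /wind mnm_val_qexp -!val_eqE /= !natz; case: (l : nat) => [|l'] /=;
  rewrite ?mnm_val_qexp; lia.
Qed.

(** The winding numbers are differences of successive exponents, and telescope. *)
Lemma sum_wind al : \sum_(l < n) wind al l = 0.
Proof.
have h r : \sum_(l < r) wind al l = (if r == 0%N then 0%N else mnm_val al r.-1)%:Z.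
  elim: r => [|[|r] IH]; first by rewrite big_ord0.
    by rewrite big_ord_recr big_ord0 /= add0r /wind subr0.
  by rewrite big_ord_recr /= IH /wind /= addrCA subrr addr0.
rewrite h; case: eqP => // _; rewrite /mnm_val; case: insubP => // x /=.
by rewrite ltnn.
Qed.

Lemma wind_hop_wt u i j l : (i < j)%N ->
  wind (hop_wt u i j) l = if (u i < u j)%N then 0 else (l == i)%:R - (l == j)%:R.
Proof. by move=> ij; rewrite /hop_wt; case: ifP => _; rewrite ?wind0 ?wind_qexp. Qed.

Lemma wind_step_wt u y b l : y != b -> l != y -> l != b -> wind (step_wt u y b) l = 0.
Proof.
rewrite /step_wt -val_eqE /= neq_ltn => yb ly lb.
case: ltngtP yb => // h _; rewrite wind_hop_wt // (negbTE ly) (negbTE lb) subr0; by case: ifP.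
Qed.

Lemma wind_step_wt_leaf u y b : y != b ->
  wind (step_wt u y b) y = if (y < b)%N then (u b < u y)%:R else - (u y < u b)%:R.
Proof.
move=> nyb; have nu := perm_val_neq u nyb; have nby : b != y by rewrite eq_sym.
rewrite /step_wt; move: (nyb); rewrite -val_eqE /= neq_ltn.
case: ltngtP => // h _; rewrite wind_hop_wt // eqxx ?(negbTE nyb) ?(negbTE nby) ?subr0 ?sub0r.
  by case: ltngtP nu.
by case: ltngtP nu.
Qed.

(** A star from u to w admits one ordering at most, since the first leaf receives the
    value of the center at once and keeps it. Each leaf moves once, hence by less than
    one turn, upwards if it is before the center and downwards if it is after. *)
Lemma star_monomial b Y u w : b \notin Y ->
  ent (star (@tau n) b Y) u w = 0 \/
  exists al, [/\ ent (star (@tau n) b Y) u w = (-1) ^+ #|[set y in Y | (b < y)%N]| * 'X_[al],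
    (forall l, l \in Y -> wind al l = if (l < b)%N then (w l < u l)%:R else - (u l < w l)%:R)
    & (forall l, l \notin b |: Y -> wind al l = 0)].
Proof.
have [r] := ubnP #|Y|; elim: r Y u => // r IH Y u; rewrite ltnS => leY bY.
have [->|Y0] := eqVneq Y set0.
  rewrite star0 ent1; case: (u =P w) => _; [right|by left].
  exists 0%MM; split=> [|l|l _]; rewrite ?inE ?wind0 //.
  rewrite (_ : [set y in _ | _] = set0) ?cards0 ?mpolyX0 ?mulr1 //.
  by apply/setP => y; rewrite !inE.
have [->|h] := eqVneq (ent (star (@tau n) b Y) u w) 0; [by left|right].
have [y yY h1] : exists2 y, y \in Y & ent (tau y b * star (@tau n) b (Y :\ y)) u w != 0.
  by move: h; rewrite star_recl // => /ent_sum_neq0.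
have yb z : z \in Y -> z != b by move=> zY; apply: contraNneq bY => <-.
have bYz z : b \notin Y :\ z by rewrite inE negb_and bY orbT.
have wz z : z \in Y -> ent (tau z b * star (@tau n) b (Y :\ z)) u w != 0 -> w z = u b.
  move=> zY /entM_neq0[v /(tau_tperm (yb z zY)) -> h2].
  have [H _] := star_support (@tau_tperm n) (bYz z) h2.
  by rewrite H ?pcomp_tpermL // !inE negb_or yb // eqxx.
have uniq_y z : z \in Y -> z != y -> ent (tau z b * star (@tau n) b (Y :\ z)) u w = 0.
  move=> zY zy; apply/eqP; apply: contraNT zy => /(wz z zY) e.
  by apply/eqP; apply: (@perm_inj _ w); rewrite e (wz y yY h1).
have -> : ent (star (@tau n) b Y) u w = ent (tau y b * star (@tau n) b (Y :\ y)) u w.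
  rewrite star_recl // ent_sum (bigD1 y) //= big1 ?addr0 // => z /andP[zY zy]; exact: uniq_y.
have [v hv hvw] := entM_neq0 h1.
have ev := tau_tperm (yb y yY) hv.
have -> : ent (tau y b * star (@tau n) b (Y :\ y)) u w =
    ent (tau y b) u v * ent (star (@tau n) b (Y :\ y)) v w.
  rewrite entM (bigD1 v) //= big1 ?addr0 // => v' vv'.
  have [->|/(tau_tperm (yb y yY)) e] := eqVneq (ent (tau y b) u v') 0; first by rewrite mul0r.
  by rewrite e -ev eqxx in vv'.
have [|e0|[al [e1 e2 e3]]] := IH (Y :\ y) v _ (bYz y); first by move: leY; rewrite (cardsD1 y) yY.
  by rewrite e0 eqxx in hvw.
have et : ent (tau y b) u v = (-1) ^+ (b < y)%N * 'X_[step_wt u y b].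
  have := hv; rewrite /tau /antisym /step_wt ev; move: (yb y yY).
  rewrite -val_eqE /= neq_ltn; case: ltngtP => // hyb _.
    by rewrite ent_hop eqxx /=; case: ifP; rewrite ?eqxx // expr0 mul1r.
  by rewrite entN oppr_eq0 tpermC ent_hop eqxx /=; case: ifP; rewrite ?eqxx // expr1 mulN1r.
exists (step_wt u y b + al)%MM; split.
- rewrite et e1 mulrACA -mpolyXD -exprD; congr (_ ^+ _ * _).
  rewrite [RHS](cardsD1 y) !inE yY /=; congr (_ + _)%N; apply: eq_card => z; rewrite !inE.
  by rewrite andbA.
- move=> l lY; rewrite windD; have [->|ly] := eqVneq l y.
    rewrite wind_step_wt_leaf ?yb // e3 ?addr0 ?(wz y yY h1) //.
    by rewrite !inE negb_or yb // eqxx.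
  by rewrite wind_step_wt ?yb // add0r e2 ?inE ?ly // ev pcomp_tpermD // yb.
move=> l; rewrite !inE negb_or => /andP[lb lY].
have ly : l != y by apply: contraNneq lY => ->.
by rewrite windD (wind_step_wt _ (yb y yY) ly lb) e3 ?addr0 // !inE negb_or lb negb_and lY orbT.
Qed.

End Winding.

(** * Generating polynomials of entries *)

Section Generating.
Variable n : nat.
Implicit Types (u v w s : 'S_n) (i j l b c m e : 'I_n) (X Y Z N C : {set 'I_n}) (k : nat).
Local Notation MS := ('M[Zq n]_#|{: 'S_n}|).
Local Notation star := (star (@tau n)).
Local Notation Phi_in := (Phi_in (@tau n)).

Lemma ent_sign (c : nat) (M : MS) u w : ent ((-1) ^+ c * M) u w = (-1) ^+ c * ent M u w.
Proof.
rewrite -![(-1) ^+ c]signr_odd; case: (odd c); rewrite ?expr0 ?mul1r // !expr1 !mulN1r.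
exact: entN.
Qed.

Lemma card_low_high k X : (#|X :&: low n k| + #|X :&: high n k|)%N = #|X|.
Proof. by rewrite -(lowC n k) -setDE cardsID. Qed.

(** Generating polynomial of the entries (u, w) of the squarefree monomials: its
    variable marks the elements before the cut, and the sign is that of the operators h. *)
Definition gen k N u w : {poly Zq n} :=
  \sum_(X : {set 'I_n} | X \subset N)
    'X^#|X :&: low n k| * ((-1) ^+ #|X :&: high n k| * ent (Phi_in N X) u w)%:P.

Definition orbit_gen k C u v : {poly Zq n} :=
  \sum_(b in C) 'X^#|(C :\ b) :&: low n k|
     * ((-1) ^+ #|(C :\ b) :&: high n k| * ent (star b (C :\ b)) u v)%:P.

(** The centers in different cycles are chosen independently. *)
Lemma gen_orbit k N u w e :
  let C := porbit (pos_perm u w) e in C \subset N ->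
  gen k N u w = orbit_gen k C u (swap_orbit u w e) * gen k (N :\: C) (swap_orbit u w e) w.
Proof.
move=> C CN; rewrite /gen.
pose G X (z : Zq n) : {poly Zq n} := 'X^#|X :&: low n k| * ((-1) ^+ #|X :&: high n k| * z)%:P.
have G0 X : G X 0 = 0 by rewrite /G mulr0 polyC0 mulr0.
have E := @orbit_expansion n (@tau n) (@tau_tperm n) (@tau_comm4 n) {poly Zq n} G N u w e G0 CN.
apply: etrans E _; rewrite /orbit_gen mulr_suml.
apply: eq_bigr => b bC; rewrite mulr_sumr; apply: eq_bigr => X XN.
have dX Z : #|(C :\ b :|: X) :&: Z| = (#|(C :\ b) :&: Z| + #|X :&: Z|)%N.
  rewrite setIUl cardsU [in X in (_ - X)%N](_ : _ :&: Z :&: _ = set0) ?cards0 ?subn0 //.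
  apply/setP => x; rewrite !inE; case xX: (x \in X); rewrite ?andbF //.
  by have := subsetP XN x xX; rewrite inE => /andP[/negbTE-> _]; rewrite !andbF.
by rewrite /G !dX !exprD [RHS]mulrACA -polyCM [in RHS]mulrACA.
Qed.

Lemma gen_id k N u : gen k N u u = 1.
Proof.
rewrite /gen (bigD1 set0) ?sub0set //= big1 ?addr0 => [|X /andP[_ X0]].
  by rewrite !set0I !cards0 /Phi_in Phi_set0 ent1 eqxx !mulr1.
by rewrite (Phi_in_disjoint (@tau_tperm n)) ?mulr0 ?polyC0 ?mulr0.
Qed.

(** A partial sum of the signed stars of one cycle, over the centers before the cut; the
    sum over all the centers is 0. *)
Definition cycle_val k C u v : Zq n :=
  (-1) ^+ #|C :&: high n k| * \sum_(b in C | (b < k)%N) ent (star b (C :\ b)) u v.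

Lemma sum_ent_stars C u v : (1 < #|C|)%N -> \sum_(b in C) ent (star b (C :\ b)) u v = 0.
Proof.
by move=> c1; rewrite -ent_sum (sum_stars0 (@tau_comm4 n) (@tau_rel3 n) (@tau_anti n)) // ent0.
Qed.

Lemma card_setD1I C b Z : b \in C -> #|(C :\ b) :&: Z| = (#|C :&: Z| - (b \in Z))%N.
Proof.
move=> bC; rewrite (cardsD1 b (C :&: Z)) inE bC /= addKn; apply: eq_card => x.
by rewrite !inE andbA.
Qed.

(** The centers before the cut lower the exponent of X by one, the others leave it and
    change the sign; the two partial sums of stars are opposite. *)
Lemma orbit_genE k C u v : (1 < #|C|)%N ->
  orbit_gen k C u v = (cycle_val k C u v)%:P * ('X^(#|C :&: low n k|.-1) + 'X^#|C :&: low n k|).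
Proof.
move=> c1; rewrite /orbit_gen (bigID (fun b : 'I_n => b < k)%N) /=.
have lo b : b \in C -> (b < k)%N -> (0 < #|C :&: low n k|)%N.
  by move=> bC bk; apply/card_gt0P; exists b; rewrite !inE bC.
have hi b : b \in C -> ~~ (b < k)%N -> (0 < #|C :&: high n k|)%N.
  by move=> bC bk; apply/card_gt0P; exists b; rewrite !inE bC leqNgt.
rewrite mulrDr; congr (_ + _).
  rewrite /cycle_val polyCM -mulrA [X in _ * X]mulrC mulrA raddf_sum /= mulr_sumr.
  apply: eq_bigr => b /andP[bC bk].
  have eL : #|(C :\ b) :&: low n k| = #|C :&: low n k|.-1.
    by rewrite card_setD1I // inE bk subn1.
  have eH : #|(C :\ b) :&: high n k| = #|C :&: high n k|.
    by rewrite card_setD1I // inE leqNgt bk subn0.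
  rewrite eL eH polyCM.
  by rewrite mulrA; congr (_ * _); apply: mulrC.
have -> : cycle_val k C u v = (-1) ^+ #|C :&: high n k|.+1 *
    \sum_(b in C | ~~ (b < k)%N) ent (star b (C :\ b)) u v.
  have := sum_ent_stars u v c1; rewrite (bigID (fun b : 'I_n => b < k)%N) /= => /eqP.
  by rewrite addr_eq0 => /eqP h; rewrite /cycle_val h exprS mulN1r mulrN mulNr.
rewrite polyCM -mulrA [X in _ * X]mulrC mulrA raddf_sum /= mulr_sumr.
apply: eq_bigr => b /andP[bC bk].
have -> : #|(C :\ b) :&: low n k| = #|C :&: low n k|.
  by rewrite card_setD1I // inE (negbTE bk) subn0.
have -> : #|(C :\ b) :&: high n k| = #|C :&: high n k|.-1.
  by rewrite card_setD1I // inE leqNgt bk subn1.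
rewrite polyCM.
have -> : (-1) ^+ #|C :&: high n k|.+1 = (-1) ^+ #|C :&: high n k|.-1 :> Zq n.
  by rewrite -[in LHS](prednK (hi b bC bk)) -addn2 exprD sqrrN expr1n mulr1.
by rewrite mulrA; congr (_ * _); apply: mulrC.
Qed.

(** One element of each cycle is missing from X. *)
Lemma Phi_in_card N X u w : X \subset N -> ent (Phi_in N X) u w != 0 ->
  (#|X| + ncyc (pos_perm u w))%N = #|psupp (pos_perm u w)|.
Proof.
have [r] := ubnP #|N|; elim: r N X u => // r IH N X u; rewrite ltnS => leN XN h.
have [ew|uw] := eqVneq w u.
  move: h; rewrite ew => h.
  have -> : X = set0 by apply/eqP; apply: contraNT h => X0; rewrite (Phi_in_disjoint (@tau_tperm n)).
  by have := ncyc_le (pos_perm u u); rewrite pos_permxx psupp1 cards0; lia.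
have [e he] := exists_moved uw.
have CN : porbit (pos_perm u w) e \subset N.
  apply/subsetP => x xC; apply: contraT => xN.
  have /eqP := Phi_in_support (@tau_tperm n) XN h xN; rewrite -pos_perm_fix -porbit_fix (porbit_same xC).
  have := card_porbit_gt1 (pos_perm u w) e; rewrite he => h1 /eqP h2.
  by rewrite h2 cards1 in h1.
pose G Y (z : Zq n) := if Y == X then z else 0.
have G0 Y : G Y 0 = 0 by rewrite /G; case: ifP.
have := orbit_expansion (@tau_tperm n) (@tau_comm4 n) G0 CN.
rewrite (bigD1 X) //= big1 ?addr0 => [|Y /andP[_ /negbTE YX]]; last by rewrite /G YX.
set C := porbit _ _ in CN *; set v := swap_orbit _ _ _.
rewrite {1}/G eqxx => eX; move: h; rewrite eX => h.
have [b [Y [bC YN GY]]] : exists b Y, [/\ b \in C, Y \subset N :\: C &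
     G (C :\ b :|: Y) (ent (star b (C :\ b)) u v * ent (Phi_in (N :\: C) Y) v w) != 0].
  case: (pselect (exists b Y, [/\ b \in C, Y \subset N :\: C &
     G (C :\ b :|: Y) (ent (star b (C :\ b)) u v * ent (Phi_in (N :\: C) Y) v w) != 0])) => // no.
  case/eqP: h; rewrite big1 // => b bC; rewrite big1 // => Y YN; apply/eqP.
  by apply: contra_notT no => h; exists b, Y.
move: GY; rewrite /G; case: (_ =P X) => [e'|_]; last by rewrite eqxx.
rewrite mulf_eq0 negb_or => /andP[_ hY].
have cN : (#|N :\: C| < r)%N.
  apply: leq_trans leN; apply: proper_card; rewrite properE subsetDl /=.
  apply/subsetPn; exists e; first by rewrite (subsetP CN) ?porbit_id.
  by rewrite inE porbit_id.
have := IH _ _ _ cN YN hY; rewrite swap_orbit_psupp (swap_orbit_ncyc he) -/C -/v.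
have -> : #|X| = (#|C|.-1 + #|Y|)%N.
  rewrite -e' cardsU (cardsD1 b C) bC (_ : _ :&: _ = set0) ?cards0 ?subn0 //.
  apply/setP => x; rewrite !inE; case xY: (x \in Y); rewrite ?andbF //.
  by have := subsetP YN x xY; rewrite inE => /andP[/negbTE-> _]; rewrite andbF.
have sC := porbit_psupp he.
have cC : (0 < #|C|)%N by apply/card_gt0P; exists b.
have := subset_leq_card sC; rewrite cardsD (setIidPr sC) -/C.
have arith (p q y z : nat) : (0 < p)%N -> (p <= q)%N -> (y + z = q - p)%N -> (p.-1 + y + z.+1 = q)%N.
  clear; lia.
exact: arith.
Qed.

End Generating.

Section Entries.
Variable n : nat.
Implicit Types (u v w s : 'S_n) (i j l m e : 'I_n) (X Y Z N C : {set 'I_n}) (k a b : nat)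
  (al : 'X_{1..n.-1}).
Local Notation MS := ('M[Zq n]_#|{: 'S_n}|).

Lemma sqfree_mx_in X : Phi_in (@tau n) setT X = sqfree_mx X.
Proof. by rewrite /Phi_in setTD. Qed.

Lemma sqfree_mx_card X u w : ent (sqfree_mx X) u w != 0 ->
  (#|X| + ncyc (pos_perm u w))%N = #|psupp (pos_perm u w)|.
Proof. by rewrite -sqfree_mx_in; apply: Phi_in_card; apply: subsetT. Qed.

Lemma gen_coef k N u w a : (gen k N u w)`_a =
  \sum_(X : {set 'I_n} | (X \subset N) && (#|X :&: low n k| == a))
     (-1) ^+ #|X :&: high n k| * ent (Phi_in (@tau n) N X) u w.
Proof.
rewrite /gen coef_sum [RHS]big_mkcondr /=; apply: eq_bigr => X _.
by rewrite coefMC coefXn eq_sym; case: eqP => _; rewrite ?mul1r ?mul0r.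
Qed.

Lemma eh_mx_sum k a b : eh_mx n k a b = (-1) ^+ b *
  \sum_(Z : {set 'I_n} | (#|Z :&: low n k| == a) && (#|Z :&: high n k| == b)) sqfree_mx Z.
Proof.
rewrite /eh_mx; congr (_ * _); rewrite pair_big_dep /=.
rewrite (reindex_onto (fun Z : {set 'I_n} => (Z :&: low n k, Z :&: high n k)) (fun p => p.1 :|: p.2)) /=.
  apply: eq_big => [Z|Z _]; rewrite -setIUr -lowC setUCr setIT ?eqxx ?andbT //.
  by rewrite !subsetIr.
case=> X Y /= /andP[/andP[XL _] /andP[YH _]]; congr (_, _).
  apply/setP => x; rewrite !inE; have := subsetP XL x; have := subsetP YH x; rewrite !inE.
  rewrite [(k <= _)%N]leqNgt; case: (x \in X); case: (x \in Y); case: (_ < _)%N => //=;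
    do ?[by move/(_ isT) | move=> _].
apply/setP => x; rewrite !inE; have := subsetP XL x; have := subsetP YH x; rewrite !inE.
rewrite [(k <= _)%N]leqNgt; case: (x \in X); case: (x \in Y); case: (_ < _)%N => //=;
  do ?[by move/(_ isT) | move=> _].
Qed.

(** The sizes of X on the two sides of the cut add up to the distance, so that the
    exponent of X determines both. *)
Lemma eh_ent k a b u w : ent (eh_mx n k a b) u w =
  if (a + b + ncyc (pos_perm u w) == #|psupp (pos_perm u w)|)%N then (gen k setT u w)`_a else 0.
Proof.
rewrite eh_mx_sum ent_sign ent_sum gen_coef.
have card Z : #|Z| = (#|Z :&: low n k| + #|Z :&: high n k|)%N by rewrite card_low_high.
have [h|h] := eqVneq; last first.
  rewrite big1 ?mulr0 // => Z /andP[/eqP ea /eqP eb].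
  by apply/eqP; apply: contraNT h => /sqfree_mx_card; rewrite card ea eb => ->.
rewrite mulr_sumr [LHS]big_mkcondr [RHS](eq_bigl (fun Z : {set 'I_n} => #|Z :&: low n k| == a)); last first.
  by move=> Z; rewrite subsetT.
apply: eq_bigr => Z /eqP ea; rewrite sqfree_mx_in; case: eqP => [->//|nb].
have [->|/sqfree_mx_card] := eqVneq (ent (sqfree_mx Z) u w) 0; first by rewrite mulr0.
by rewrite card ea -h => /eqP; rewrite eqn_add2r eqn_add2l => /eqP.
Qed.

Lemma sqfree_mx_word X u w : ent (sqfree_mx X) u w != 0 ->
  exists2 s, act u s = w & size s = #|X|.
Proof.
rewrite -mleadc_eq0 => h.
have wf : apart (enum (~: X)) X by apply: apart_enumC; rewrite disjoint_sym disjoints_subset setCK.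
by have [s [e _ _ es _]] := Phi_word (@tau_step n) wf h; exists s.
Qed.

(** The terms that correct the product of an elementary and a complete class are reached
    by words two letters shorter, too short for permutations at distance a + b. *)
Lemma eh_corr_ent k a b u w :
  (a + b + ncyc (pos_perm u w))%N = #|psupp (pos_perm u w)| -> ent (eh_corr n k a b) u w = 0.
Proof.
move=> h; rewrite /eh_corr ent_sign ent_sum big1 ?mulr0 // => X /andP[_ /eqP ea].
rewrite ent_sum big1 // => Y /andP[_ /eqP eb]; rewrite ent_sum big1 // => m /andP[mY _].
rewrite ent_sum big1 // => l lX; rewrite entZ.
apply/eqP; rewrite mulf_eq0; apply/orP; right; apply: contraT => /entM_neq0[v].
move=> /sqfree_mx_word[s1 e1 z1] /sqfree_mx_word[s2 e2 z2].
have := word_length u (s1 ++ s2); rewrite act_cat e1 e2 size_cat z1 z2.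
have := card_porbits (pos_perm u w); move: h; rewrite -ea -eb (cardsD1 l X) lX (cardsD1 m Y) mY /=.
move: (#|porbits _|) (#|psupp _|) (ncyc _) #|X :\ l| #|Y :\ m|; clear; lia.
Qed.

Lemma porbits_conj s u : porbits (s ^ u)%g = [set u @: (C : {set 'I_n}) | C in porbits s].
Proof.
have h x : porbit (s ^ u)%g (u x) = u @: porbit s x.
  apply/setP => y; apply/porbitP/imsetP => [[i ->]|[z /porbitP[i ->] ->]].
    by exists ((s ^+ i)%g x); rewrite ?mem_porbit // -conjXg permJ.
  by exists i; rewrite -conjXg permJ.
apply/setP => D; apply/imsetP/imsetP => [[x _ ->]|[_ /imsetP[x _ ->] ->]].
  by exists (porbit s (u^-1%g x)); [apply: imset_f | rewrite -h permKV].
by exists (u x).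
Qed.

Lemma ncyc_conj s u : ncyc (s ^ u)%g = ncyc s.
Proof.
rewrite /ncyc porbits_conj -[RHS](card_imset _ (imset_inj (@perm_inj _ u))).
apply: eq_card => D; rewrite inE; apply/andP/imsetP => [[/imsetP[C hC ->]]|[C]].
  by rewrite (card_imset _ (@perm_inj _ u)) => h; exists C; rewrite ?inE ?hC.
by rewrite inE => /andP[hC h] ->; rewrite (card_imset _ (@perm_inj _ u)); split=> //; apply: imset_f.
Qed.

Lemma psupp_conj s u : #|psupp (s ^ u)%g| = #|psupp s|.
Proof.
rewrite -[RHS](card_imset _ (@perm_inj _ u)); apply: eq_card => x.
rewrite -[x](permKV u) (mem_imset _ _ (@perm_inj _ u)) !inE permJ; congr (~~ _).
by apply/eqP/eqP => [/perm_inj|->].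
Qed.

Lemma pos_perm_conj u w : w ∘p u^-1%g = (pos_perm u w ^ u)%g.
Proof. by rewrite /pcomp /pos_perm conjgE !mulgA mulgKV. Qed.

(** The exponents of the monomials of stars: before the cut the values only grow, after
    it they only decrease, and no value makes a full turn. *)
Definition turns k u w al := forall l, wind al l =
  if (l < k)%N then (w l < u l)%:R else - (u l < w l)%:R.

Lemma turns_id k u : turns k u u 0%MM.
Proof. by move=> l; rewrite wind0 ltnn oppr0; case: ifP. Qed.

(** The total winding is 0, so the positions before the cut that go past the top are as
    many as those after the cut that go past the bottom. Trading the former for the
    latter turns the count of all moved positions before the cut into the count of the
    values that grow. *)
Lemma turns_ht k u w al : turns k u w al ->
  ht (w ∘p u^-1%g) = #|psupp (pos_perm u w) :&: low n k|.
Proof.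
move=> h; have := sum_wind al.
rewrite (eq_bigr (fun l => (if (l < k)%N then (w l < u l)%N : int else 0)
    - (if (l < k)%N then 0 else (u l < w l)%N : int))); last first.
  by move=> l _; rewrite h; case: ifP; rewrite ?subr0 ?sub0r natz.
rewrite sumrB => /subr0_eq e1.
have e2 : (\sum_(l : 'I_n | l < k) (w l < u l) = \sum_(l : 'I_n | ~~ (l < k)) (u l < w l))%N.
  have c (F : 'I_n -> nat) : (\sum_l F l)%N%:Z = \sum_l (F l : int) :> int.
    by rewrite -natz raddf_sum; apply: eq_bigr => l _; rewrite /= natz.
  rewrite big_mkcond [RHS]big_mkcond; apply/eqP; rewrite -eqz_nat; apply/eqP.
  rewrite (c (fun l => if (l < k)%N then _ else _)) [RHS](c (fun l => if ~~ (l < k)%N then _ else _)).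
  apply: etrans (etrans e1 _); last by apply: eq_bigr => l _; case: ifP.
  by apply: eq_bigr => l _; case: ifP.
have -> : ht (w ∘p u^-1%g) = (\sum_(l : 'I_n) (u l < w l))%N.
  rewrite /ht -sum1_card big_mkcond /= (reindex_inj (@perm_inj _ u)) /=.
  by apply: eq_bigr => l _; rewrite inE pcompE permK; case: ifP.
rewrite (bigID (fun l : 'I_n => (l < k)%N)) /= -e2 -big_split /= -sum1_card big_mkcond.
rewrite [RHS]big_mkcond; apply: eq_bigr => l _; rewrite !inE pos_perm_fix.
case: ifP; rewrite ?andbF ?andbT // => _; rewrite -val_eqE /=.
by case: ltngtP.
Qed.

Lemma nonneg_coefs_split (p q : Zq n) al : nonneg_coefs p -> nonneg_coefs q ->
  p + q = 'X_[al] -> p = 0 \/ p = 'X_[al].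
Proof.
move=> hp hq e; have eb be : p@_be + q@_be = (al == be)%:R by rewrite -mcoeffD e mcoeffX.
have z be : be != al -> p@_be = 0.
  move=> h; have := eb be; rewrite eq_sym (negbTE h); have := hp be; have := hq be.
  move: (p@_be) (q@_be) => x y /=; lia.
have pE : p = p@_al *: 'X_[al].
  apply/mpolyP => be; rewrite mcoeffZ mcoeffX; have [->|h] := eqVneq be al; first by rewrite mulr1.
  by rewrite (z _ h) mulr0.
have : p@_al = 0 \/ p@_al = 1.
  have := eb al; rewrite eqxx; have := hp al; have := hq al.
  move: (p@_al) (q@_al) => x y /=; lia.
by case=> h; rewrite pE h ?scale0r ?scale1r; [left|right].
Qed.

End Entries.

(** * The monomial of a cycle *)

Section Structure.
Variables (n : nat) (R : comAlgType (Zq n)) (S : 'S_n -> R) (qH : qH_flag S).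
Implicit Types (u v w s : 'S_n) (i j l m e : 'I_n) (X Y Z N C : {set 'I_n}) (k a b : nat)
  (al be : 'X_{1..n.-1}).
Local Notation MS := ('M[Zq n]_#|{: 'S_n}|).
Local Notation star := (star (@tau n)).

Lemma e_h_ent k a b u w : (a + b + ncyc (pos_perm u w))%N = #|psupp (pos_perm u w)| ->
  ent (e_mx n k a * h_mx n k b) u w = (gen k setT u w)`_a.
Proof.
move=> h; have := eh_ent k a b u w; rewrite h eqxx => <-.
by rewrite (eh_mxE k qH) entD eh_corr_ent // addr0.
Qed.

Definition single C u v := exists2 e, pos_perm u v e != e & C = porbit (pos_perm u v) e /\ C = psupp (pos_perm u v).

Lemma single_ncyc C u v : single C u v -> ncyc (pos_perm u v) = 1%N.
Proof.
case=> e he [e1 e2]; rewrite (swap_orbit_ncyc he) swap_orbit_id; last by rewrite -e2 e1.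
by rewrite pos_permxx ncyc1.
Qed.

Lemma single_card C u v : single C u v -> (1 < #|C|)%N.
Proof. by case=> e he [-> _]; rewrite card_porbit_gt1. Qed.

Lemma single_gen k C u v : single C u v -> gen k setT u v = orbit_gen k C u v.
Proof.
case=> e he [e1 e2]; rewrite (@gen_orbit n k setT u v e) ?subsetT // swap_orbit_id; last by rewrite -e2 e1.
by rewrite gen_id mulr1 -e1.
Qed.

Lemma cycle_val_low0 k C u v : C :&: low n k = set0 -> cycle_val k C u v = 0.
Proof.
move=> h; rewrite /cycle_val big_pred0 ?mulr0 // => b; have := in_set0 b.
by rewrite -h !inE.
Qed.

Lemma cycle_val_high0 k C u v : (1 < #|C|)%N -> C :&: high n k = set0 -> cycle_val k C u v = 0.
Proof.
move=> c1 h; rewrite /cycle_val (eq_bigl (mem C)) ?sum_ent_stars ?mulr0 // => b.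
case bC: (b \in C) => //=; rewrite ?bC //; have := in_set0 b.
by rewrite -h !inE bC /= ltnNge => ->.
Qed.

(** The value of a cycle is the top coefficient of its generating polynomial, which is
    an entry of a product of nonnegative operators. *)
Lemma nonneg_cycle_val k C u v : single C u v -> nonneg_coefs (cycle_val k C u v).
Proof.
move=> sC; have c1 := single_card sC; have nc := single_ncyc sC.
have [h|hL] := eqVneq (C :&: low n k) set0; first by rewrite cycle_val_low0 //; apply: nonneg_coefs0.
have [h|hH] := eqVneq (C :&: high n k) set0; first by rewrite cycle_val_high0 //; apply: nonneg_coefs0.
have := @e_h_ent k #|C :&: low n k| #|C :&: high n k|.-1 u v; rewrite nc.
have [_ _ [_ eC]] := sC; rewrite -eC -[#|C|](card_low_high k) addn1 -addnS prednK ?card_gt0 // => /(_ erefl).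
rewrite (single_gen k sC) orbit_genE // coefCM coefD !coefXn eqxx.
rewrite -[X in (X == _)](prednK (n := #|C :&: low n k|)) ?card_gt0 // eqn_leq ltnn add0r mulr1 => <-.
by apply: nonneg_mxM; [apply: nonneg_e_mx | apply: nonneg_h_mx].
Qed.

Lemma card_highS C m : m \in C -> #|C :&: high n m| = #|C :&: high n m.+1|.+1.
Proof.
move=> mC; rewrite (cardsD1 m) !inE mC leqnn /=; congr _.+1; apply: eq_card => x.
rewrite !inE andbCA; congr (_ && _); by rewrite [RHS]ltn_neqAle -val_eqE eq_sym.
Qed.

(** Moving the cut past m changes the sign and adds the center m; the other centers
    cancel. *)
Lemma cycle_val_cut C u v m : m \in C ->
  cycle_val m C u v + cycle_val m.+1 C u v = (-1) ^+ #|C :&: high n m.+1| * ent (star m (C :\ m)) u v.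
Proof.
move=> mC; rewrite {1}/cycle_val (card_highS mC) exprS mulN1r mulNr /cycle_val -mulrN -mulrDr.
congr (_ * _); rewrite [X in _ + X](bigD1 m) /=; last by rewrite mC leqnn.
rewrite addrCA -[RHS]addr0; congr (_ + _); apply/eqP; rewrite addrC subr_eq0; apply/eqP.
by apply: eq_bigl => b; rewrite -andbA; congr (_ && _); rewrite ltnS -val_eqE ltn_neqAle andbC.
Qed.

(** Two nonnegative elements with sum a monomial are 0 or that monomial. *)
Lemma cycle_val_near C u v m : single C u v -> m \in C ->
  (cycle_val m C u v = 0 /\ cycle_val m.+1 C u v = 0) \/
  exists al, [/\ cycle_val m C u v = 0 \/ cycle_val m C u v = 'X_[al],
    cycle_val m.+1 C u v = 0 \/ cycle_val m.+1 C u v = 'X_[al],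
    (forall l, l \in C -> l != m -> wind al l = if (l < m)%N then (v l < u l)%:R else - (u l < v l)%:R)
   & (forall l, l \notin C -> wind al l = 0)].
Proof.
move=> sC mC; have n1 := nonneg_cycle_val m sC; have n2 := nonneg_cycle_val m.+1 sC.
have := cycle_val_cut u v mC.
have mm : m \notin C :\ m by rewrite !inE eqxx.
have [->|[al [-> h1 h2]]] := star_monomial u v mm.
  rewrite mulr0 => e; left; suff h : cycle_val m C u v = 0 by move: e; rewrite h add0r.
  apply/mpolyP => be; rewrite mcoeff0; have := congr1 (mcoeff be) e; rewrite mcoeffD mcoeff0.
  have := n1 be; have := n2 be; move: (_@_be) (_@_be) => x y /=; lia.
rewrite (_ : [set y in C :\ m | (m < y)%N] = C :&: high n m.+1); last first.
  by apply/setP => x; rewrite !inE -val_eqE; case: (x \in C); rewrite ?andbF //=; case: ltngtP.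
rewrite mulrA -exprD addnn -muln2 exprM sqrr_sign mul1r => e; right; exists al; split.
- exact: nonneg_coefs_split n1 n2 e.
- by apply: nonneg_coefs_split n2 n1 _; rewrite addrC.
- by move=> l lC lm; apply: h1; rewrite !inE lm.
by move=> l lC; apply: h2; rewrite setD1K.
Qed.

Lemma cycle_val_eq k k' C u v : (forall b : 'I_n, b \in C -> (b < k)%N = (b < k')%N) ->
  cycle_val k C u v = cycle_val k' C u v.
Proof.
move=> h; rewrite /cycle_val; congr ((-1) ^+ _ * _).
  by apply: eq_card => x; rewrite !inE; case xC: (x \in C) => //=; rewrite leqNgt h // -leqNgt.
by apply: eq_bigl => b; case bC: (b \in C) => //=; rewrite h.
Qed.

Lemma mpolyX_neq0 al : 'X_[al] != 0 :> Zq n.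
Proof. by apply/eqP => /(congr1 (mcoeff al)); rewrite mcoeffX eqxx mcoeff0. Qed.

Lemma mpolyX_eq al be : 'X_[al] = 'X_[be] :> Zq n -> al = be.
Proof.
by move=> /(congr1 (mcoeff al)); rewrite !mcoeffX eqxx; case: eqVneq.
Qed.

(** With m and m' the elements of C next to the cut on its two sides, the value at k is
    also the value at the cuts just after m and just before m'. Comparing the first with
    the cut before m, and the second with the cut after m', bounds the value by the star
    with center m and by that with center m'. The first star gives the winding at every
    element but m, and the second gives it at m. *)
Lemma cycle_val_monomial k C u v : single C u v -> cycle_val k C u v = 0 \/
  exists2 al, cycle_val k C u v = 'X_[al] & turns k u v al.
Proof.
move=> sC; have c1 := single_card sC.
have [h|/set0Pn[x0 hx0]] := eqVneq (C :&: low n k) set0; first by left; rewrite cycle_val_low0.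
have [h|/set0Pn[y0 hy0]] := eqVneq (C :&: high n k) set0; first by left; rewrite cycle_val_high0.
have [m hm mmax] := @arg_maxnP _ x0 (mem (C :&: low n k)) (fun x => x : nat) hx0.
have [m' hm' mmin] := @arg_minnP _ y0 (mem (C :&: high n k)) (fun x => x : nat) hy0.
move: hm hm'; rewrite !inE => /andP[mC mk] /andP[m'C km'].
have e1 : cycle_val k C u v = cycle_val m.+1 C u v.
  apply: cycle_val_eq => b bC; rewrite ltnS; apply/idP/idP => [bk|bm]; last exact: leq_ltn_trans bm mk.
  by apply: mmax; rewrite !inE bC.
have e2 : cycle_val k C u v = cycle_val m' C u v.
  apply: cycle_val_eq => b bC; apply/idP/idP => [bk|bm]; first exact: leq_trans bk km'.
  by rewrite ltnNge; apply: contraL bm => kb; rewrite -leqNgt; apply: mmin; rewrite !inE bC.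
have [[_ h]|[al [_ hal w1 w1']]] := cycle_val_near sC mC; first by left; rewrite e1.
have [[h _]|[be [hbe _ w2 w2']]] := cycle_val_near sC m'C; first by left; rewrite e2.
move: hal hbe; rewrite -e1 -e2; case=> [|e]; [by left | case=> [|e']; first by left].
right; exists al => // l.
have eab : be = al by apply: mpolyX_eq; rewrite -e -e'.
have [lC|lC] := boolP (l \in C); last first.
  have ul : v l = u l.
    by apply/eqP; rewrite -pos_perm_fix -[_ == _]negbK; have [_ _ [_ eC]] := sC; move: lC; rewrite eC inE.
  by rewrite w1' // ul ltnn oppr0; case: ifP.
have [lm|lm] := eqVneq l m; last first.
  rewrite w1 //; congr (if _ then _ else _); apply/idP/idP => [h|h]; first exact: ltn_trans h mk.
  by rewrite ltn_neqAle -val_eqE in lm *; rewrite lm; apply: mmax; rewrite !inE lC.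
have lm' : l != m' by rewrite lm -val_eqE neq_ltn (leq_trans mk km').
by rewrite -eab w2 // lm mk (leq_trans mk km').
Qed.

Lemma factor_step (A : comPzRingType) (c x y z t p : A) :
  c * (y + t * y) * (x * (z * p)) = c * x * (y * z * ((1 + t) * p)).
Proof. by ring. Qed.

(** By induction on the number of cycles: a cycle with a nonzero value contributes a
    monomial and the factor X^(h-1) (1+X), and it meets both sides of the cut. *)
Lemma gen_structure k N u w : psupp (pos_perm u w) \subset N ->
  let h := #|psupp (pos_perm u w) :&: low n k| in
  let g := #|psupp (pos_perm u w) :&: high n k| in let s := ncyc (pos_perm u w) in
  exists2 x : Zq n, gen k N u w = x%:P * ('X^(h - s) * (1 + 'X) ^+ s) &
    x = 0 \/ [/\ exists2 al, x = 'X_[al] & turns k u w al, (s <= h)%N & (s <= g)%N].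
Proof.
have [r] := ubnP #|psupp (pos_perm u w)|; elim: r N u => // r IH N u; rewrite ltnS => leN pN.
have [->|uw] := eqVneq w u.
  rewrite gen_id pos_permxx ncyc1 psupp1 !set0I cards0 /=; exists 1; first by rewrite !mulr1.
  by right; split=> //; exists 0%MM; [rewrite mpolyX0 | apply: turns_id].
have [e he] := exists_moved uw.
have Cp := porbit_psupp he; have CN := subset_trans Cp pN.
rewrite (gen_orbit k CN) (swap_orbit_ncyc he).
have ep := swap_orbit_psupp u w e; have eo := swap_orbit_porbit u w e; have es := swap_orbit_single he.
set C := porbit (pos_perm u w) e in Cp CN ep eo es *; set v := swap_orbit u w e in ep eo es *.
have sC : single C u v.
  by exists e; [rewrite pos_perm_fix swap_orbit_in ?porbit_id // -pos_perm_fix | rewrite eo es].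
have c1 := single_card sC.
have cN : (#|psupp (pos_perm v w)| < r)%N.
  apply: leq_trans leN; apply: proper_card; rewrite ep properE subsetDl /=.
  apply/subsetPn; exists e; first by rewrite inE.
  by rewrite inE porbit_id.
have [|x0 -> hx0] := IH (N :\: C) v cN; first by rewrite ep setSD.
rewrite orbit_genE //.
set p := psupp _ in Cp ep *; set p' := psupp _ in ep hx0 *.
have cI Z : #|p :&: Z| = (#|C :&: Z| + #|p' :&: Z|)%N.
  rewrite -(cardsID C (p :&: Z)) ep; congr (_ + _)%N; apply: eq_card => x; rewrite !(in_setI, in_setD).
    by case xC: (x \in C); rewrite ?andbF // andbT /= (subsetP Cp x xC).
  by case: (x \in C); rewrite ?andbF.
have [h|[al eal tal]] := cycle_val_monomial k sC.
  by exists 0; [rewrite h polyC0 !mul0r | left].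
have [h|[[be ebe tbe] sh sg]] := hx0.
  by exists 0; [rewrite h polyC0 !mul0r mulr0 | left].
have cn0 : cycle_val k C u v != 0 by rewrite eal mpolyX_neq0.
have cL : (0 < #|C :&: low n k|)%N.
  by rewrite card_gt0; apply: contraNneq cn0 => h; rewrite cycle_val_low0.
have cH : (0 < #|C :&: high n k|)%N.
  by rewrite card_gt0; apply: contraNneq cn0 => h; rewrite cycle_val_high0.
exists (cycle_val k C u v * x0).
  have -> : (#|p :&: low n k| - (ncyc (pos_perm v w)).+1 =
             #|C :&: low n k|.-1 + (#|p' :&: low n k| - ncyc (pos_perm v w)))%N.
    by rewrite cI; move: cL sh; move: #|_| #|_| (ncyc _); clear; lia.
  by rewrite [in RHS]polyCM -[in 'X^#|C :&: low n k|](prednK cL) !exprS exprD; apply: factor_step.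
right; split; rewrite ?cI; last 2 first.
- by rewrite -add1n leq_add.
- by rewrite -add1n leq_add.
exists (al + be)%MM; first by rewrite mpolyXD eal ebe.
move=> l; rewrite windD tal tbe; have [lC|lC] := boolP (l \in C).
  by rewrite (swap_orbit_in lC) ltnn oppr0; case: ifP; rewrite addr0.
by rewrite (swap_orbit_out lC) ltnn oppr0; case: ifP; rewrite add0r.
Qed.

End Structure.

(** * Forest words *)

Section Forests.
Variable n : nat.
Implicit Types (u v w : 'S_n) (x y z i j l a b q : 'I_n) (p : 'S_n).
Implicit Types (s t : seq ('I_n * 'I_n)) (d : 'I_n * 'I_n).

Definition prod_word s : 'S_n := act 1%g s.

Lemma pos_perm_act u s : pos_perm u (act u s) = prod_word s.
Proof.
elim/last_ind: s => [|s d IH]; first by rewrite /prod_word /= pos_permxx.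
by rewrite /prod_word !act_rcons pos_perm_rcoset IH.
Qed.

Lemma prod_word_rcons s d : prod_word (rcons s d) = (tperm d.1 d.2 * prod_word s)%g.
Proof. by rewrite /prod_word act_rcons. Qed.

Lemma prod_word_cons s d : prod_word (d :: s) = (prod_word s * tperm d.1 d.2)%g.
Proof.
rewrite -(pos_perm_act 1%g) -(pos_perm_act (1%g ∘p tperm d.1 d.2)) /=.
by rewrite -pos_perm_tperm.
Qed.

(** A product of r transpositions with n - r cycles: each transposition merges two
    cycles, hence the edges of the word form a forest on the positions. *)
Definition forest s : bool := (#|porbits (prod_word s)| + size s == n)%N.

Lemma card_porbits_tpermr p x y : #|porbits (p * tperm x y)%g| = #|porbits (tperm x y * p)%g|.
Proof.
have -> : (p * tperm x y = (tperm x y * p) ^ tperm x y)%g.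
  by rewrite conjgE tpermV !mulgA tperm2 mul1g.
by rewrite porbits_conj card_imset //; apply/imset_inj/perm_inj.
Qed.

Lemma tperm_porbits p x y : (#|porbits (tperm x y * p)%g| + (x \notin porbit p y).*2 =
  #|porbits p| + (x != y))%N.
Proof. exact: porbits_mul_tperm. Qed.

Lemma forest_rcons s d : forest (rcons s d) -> forest s /\ d.1 \notin porbit (prod_word s) d.2.
Proof.
rewrite /forest size_rcons prod_word_rcons => /eqP h.
have := tperm_porbits (prod_word s) d.1 d.2.
have := word_length 1%g s; rewrite pos_perm_act.
have : d.1 \notin porbit (prod_word s) d.2 -> d.1 != d.2.
  by apply: contraNneq => ->; apply: porbit_id.
move: h; move: #|porbits (prod_word s)| #|porbits (_ * _)%g| (size s) => A B m.
case: (d.1 \notin _); case: (d.1 != d.2) => h e1 e2 /=;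
  by [have := e1 isT | move=> e3; split=> //; first [by apply/eqP; lia | exfalso; lia]].
Qed.

Lemma forest_cons s d : forest (d :: s) -> forest s.
Proof.
move=> h; apply: (proj1 (@forest_rcons s d _)); move: h.
by rewrite /forest size_rcons /= prod_word_rcons prod_word_cons card_porbits_tpermr.
Qed.

(** A transposition of two elements in distinct cycles merges these cycles and leaves
    the others. *)
Lemma porbit_merge p x y z : x \notin porbit p y ->
  porbit p z \subset porbit (tperm x y * p)%g z /\ x \in porbit (tperm x y * p)%g y.
Proof.
move=> xy; have nxy : x != y by apply: contraNneq xy => ->; apply: porbit_id.
have xyt : x \in porbit (tperm x y * p)%g y.
  apply: contraT => h; have := tperm_porbits p x y; have := tperm_porbits (tperm x y * p)%g x y.
  rewrite mulgA tperm2 mul1g xy h nxy /=; move: #|porbits (_ * _)%g| #|porbits _| => A B; lia.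
split=> //; apply: porbit_sub => [|c cz]; first exact: porbit_id.
have same e1 e2 : e1 \in porbit (tperm x y * p)%g e2 -> e1 \in porbit (tperm x y * p)%g z ->
    e2 \in porbit (tperm x y * p)%g z.
  by move=> h1 h2; rewrite -(porbit_same h2) porbit_sym.
have [cx|cx] := eqVneq c x.
  rewrite cx -(_ : (tperm x y * p)%g y = p x); last by rewrite permM tpermR.
  by rewrite porbit_step; apply: same xyt _; move: cz; rewrite cx.
have [cy|cy] := eqVneq c y.
  rewrite cy -(_ : (tperm x y * p)%g x = p y); last by rewrite permM tpermL.
  by rewrite porbit_step; apply: (same y); [rewrite porbit_sym | move: cz; rewrite cy].
by rewrite -(_ : (tperm x y * p)%g c = p c) ?porbit_step // permM tpermD // eq_sym.
Qed.

Lemma moved_card p x : (p x != x) = (1 < #|porbit p x|)%N.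
Proof. by rewrite card_porbit_gt1. Qed.

Lemma verts_rcons s d x : (x \in verts (rcons s d)) = [|| x == d.1, x == d.2 | x \in verts s].
Proof.
by rewrite -cats1 verts_cat verts_cons [verts [::]]/= in_nil orbF orbC -orbA.
Qed.

(** A forest word never splits a cycle, so a position that has moved never comes back. *)
Lemma forest_verts s x : forest s -> x \in verts s -> prod_word s x != x.
Proof.
elim/last_ind: s => // s d IH /forest_rcons[fs nd].
have nd12 : d.1 != d.2 by apply: contraNneq nd => ->; apply: porbit_id.
have mv z : prod_word (rcons s d) z != z = (1 < #|porbit (tperm d.1 d.2 * prod_word s)%g z|)%N.
  by rewrite moved_card prod_word_rcons.
have [_ d12] := porbit_merge d.1 nd.
rewrite verts_rcons => /or3P[/eqP->|/eqP->|xs]; rewrite mv.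
- rewrite -moved_card -porbit_fix; apply: contraNneq nd12 => e.
  by move: d12; rewrite porbit_sym e inE eq_sym.
- rewrite -moved_card -porbit_fix; apply: contraNneq nd12 => e.
  by move: d12; rewrite e inE.
have [sub _] := porbit_merge x nd.
by apply: leq_trans (subset_leq_card sub); rewrite -moved_card IH.
Qed.

(** An edge that can be commuted to one end of the word and cut off there. The position
    z, excluded in the second case, is the one at which the induction on words attaches
    a later edge. *)
Definition pendant s z l q := exists s1 d s2,
  [/\ s = s1 ++ d :: s2, d = (l, q) \/ d = (q, l), l \notin verts (s1 ++ s2) &
      q \notin verts s1 \/ (q \notin verts s2 /\ q != z)].

Lemma pendant_rcons s z z' l q d : pendant s z l q -> l != d.1 -> l != d.2 ->
  (q != z -> [/\ q != d.1, q != d.2 & q != z']) -> pendant (rcons s d) z' l q.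
Proof.
move=> [s1 [e [s2 [-> he hl hq]]]] l1 l2 hz; exists s1, e, (rcons s2 d); split=> //.
- by rewrite -!cats1 -catA.
- move: hl; rewrite !verts_cat verts_rcons (negbTE l1) (negbTE l2) /=; by rewrite -verts_cat.
case: hq => [h|[h /hz[q1 q2 q3]]]; [by left | right; split=> //].
by rewrite verts_rcons (negbTE q1) (negbTE q2).
Qed.

(** Induction on the last edge (a, b) of the word, with z on the side of a, say. If b
    was used before, its component has by induction a pendant edge away from b, which
    the last edge does not disturb. If not, b itself is a leaf whose edge is the last
    one at a; the only obstruction is z = a, and then the component of a has a pendant
    edge away from a, if a was used before. *)
Lemma forest_pendant s z : forest s -> z \in verts s ->
  exists l q, [/\ pendant s z l q, l \in porbit (prod_word s) z,
    q \in porbit (prod_word s) z & l != z].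
Proof.
elim/last_ind: s z => // s d IH z /forest_rcons[fs nd] zs.
have d12 : d.1 != d.2 by apply: contraNneq nd => ->; apply: porbit_id.
pose p := prod_word s; pose p' := prod_word (rcons s d).
have sub y : porbit p y \subset porbit p' y by rewrite /p' prod_word_rcons; apply: (porbit_merge y nd).1.
have join : d.1 \in porbit p' d.2 by rewrite /p' prod_word_rcons; apply: (porbit_merge d.1 nd).2.
(* the edge joins a, on the side of z, to b *)
have side a b : (d = (a, b) \/ d = (b, a)) -> z \in porbit p a -> exists l q,
    [/\ pendant (rcons s d) z l q, l \in porbit p' z, q \in porbit p' z & l != z].
  move=> hd za.
  have nab : a \notin porbit p b by case: hd nd => -> //=; rewrite porbit_sym.
  have jab : a \in porbit p' b by case: hd join => -> //=; rewrite porbit_sym.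
  have ab : a != b by apply: contraNneq nab => ->; apply: porbit_id.
  have za' : z \in porbit p' a by apply: (subsetP (sub a)).
  have ez : porbit p' z = porbit p' a := porbit_same za'.
  have ebz : porbit p' b = porbit p' z by rewrite ez (porbit_same jab).
  have dab l : l != a -> l != b -> l != d.1 /\ l != d.2 by move=> l1 l2; case: hd => ->.
  have off x y : x \in porbit p a -> y \in porbit p b -> x != y.
    move=> xa yb; apply: contraNneq nab => e; rewrite -(porbit_same yb) -e (porbit_same xa).
    exact: porbit_id.
  have [bs|bs] := boolP (b \in verts s).
    have [l [q [pl lb qb lnb]]] := IH b fs bs; exists l, q.
    have la := off _ _ (porbit_id p a) lb; have [l1 l2] : l != d.1 /\ l != d.2 by apply: dab;
      rewrite // eq_sym.
    split=> //; rewrite -?ebz ?(subsetP (sub b)) //; last by rewrite eq_sym off.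
    apply: pendant_rcons pl l1 l2 _ => qnb; have [q1 q2] : q != d.1 /\ q != d.2 by apply: dab;
      rewrite // eq_sym off ?porbit_id.
    by split=> //; rewrite eq_sym off.
  have pend : a \notin verts s \/ a != z -> exists l q,
      [/\ pendant (rcons s d) z l q, l \in porbit p' z, q \in porbit p' z & l != z].
    move=> h; exists b, a; split; rewrite ?ez -?(porbit_same jab) ?porbit_id //.
    - exists s, d, [::]; split; rewrite ?cats1 ?cats0 //; first by case: hd => ->; [right|left].
      by case: h => h; [left | right].
    - by rewrite (porbit_same jab) porbit_id.
    by rewrite eq_sym off ?porbit_id.
  have [az|az] := eqVneq a z; last by apply: pend; right.
  have [as_|as_] := boolP (a \in verts s); last by apply: pend; left.
  have [l [q [pl la qa lna]]] := IH a fs as_; exists l, q.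
  have lb : l != b by rewrite off ?porbit_id.
  have [l1 l2] := dab l lna lb.
  split=> //; rewrite ?ez ?(subsetP (sub a)) -?az //.
  apply: pendant_rcons pl l1 l2 _ => qna; have [q1 q2] : q != d.1 /\ q != d.2 by apply: dab;
    rewrite // off ?porbit_id.
  by split.
have [z1|z1] := boolP (z \in porbit p d.1); first by apply: (side _ d.2 _ z1); left;
  apply: surjective_pairing.
have [z2|z2] := boolP (z \in porbit p d.2); first by apply: (side _ d.1 _ z2); right;
  apply: surjective_pairing.
have zs' : z \in verts s.
  move: zs; rewrite verts_rcons => /or3P[/eqP e|/eqP e|h]; last exact: h.
    by rewrite e porbit_id in z1.
  by rewrite e porbit_id in z2.
have [l [q [pl lz qz lnz]]] := IH z fs zs'; exists l, q.
have off y : y \in porbit p z -> y != d.1 /\ y != d.2.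
  by move=> yz; split; [apply: contraNneq z1 => <- | apply: contraNneq z2 => <-]; rewrite porbit_sym.
split; rewrite ?(subsetP (sub z)) //; have [l1 l2] := off _ lz; have [q1 q2] := off _ qz.
by apply: pendant_rcons pl l1 l2 _.
Qed.

End Forests.

(** * Operators of words and of fans *)

Section WordMatrices.
Variable n : nat.
Implicit Types (u v w p : 'S_n) (x y z i j l q : 'I_n) (X Y L V : {set 'I_n}) (al be ga : 'X_{1..n.-1}).
Implicit Types (s t : seq ('I_n * 'I_n)) (d : 'I_n * 'I_n).
Local Notation MS := ('M[Zq n]_#|{: 'S_n}|).
Implicit Types (G M : MS).

Lemma uhopC i j : uhop i j = uhop j i :> MS.
Proof.
rewrite /uhop /sym; have [->//|] := eqVneq i j.
by rewrite -val_eqE /=; case: ltngtP.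
Qed.

Definition word_mx s : MS := \prod_(d <- s) uhop d.1 d.2.
Definition proper_word s := all (fun d : 'I_n * 'I_n => d.1 != d.2) s.

Lemma word_mx_cons d s : word_mx (d :: s) = uhop d.1 d.2 * word_mx s.
Proof. exact: big_cons. Qed.

Lemma word_mx_cat s t : word_mx (s ++ t) = word_mx s * word_mx t.
Proof. exact: big_cat. Qed.

Lemma word_mx_comm l q s : l != q -> proper_word s -> l \notin verts s -> q \notin verts s ->
  uhop l q * word_mx s = word_mx s * uhop l q.
Proof.
move=> lq; elim: s => [|d s IH]; first by rewrite /word_mx big_nil mul1r mulr1.
move=> /andP[d12 ps]; rewrite !verts_cons !negb_or => /and3P[l1 l2 ls] /and3P[q1 q2 qs].
rewrite word_mx_cons -mulrA -IH // !mulrA uhop_comm4 //= !inE !negb_or.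
by rewrite lq l1 l2 q1 q2 d12.
Qed.

Lemma nonneg_word_mx s : nonneg_mx (word_mx s).
Proof.
elim: s => [|d s IH]; first by rewrite /word_mx big_nil; apply: nonneg_mx1.
by rewrite word_mx_cons; apply: nonneg_mxM => //; apply: nonneg_uhop.
Qed.

Lemma word_mx_gt0 u s : proper_word s -> word_ok u s ->
  0 < (ent (word_mx s) u (act u s))@_(word_wt u s).
Proof.
elim: s u => [|d s IH] u /=.
  by rewrite /word_mx big_nil ent1 eqxx mcoeff1 eqxx.
move=> /andP[d12 ps] /andP[ok oks]; rewrite word_mx_cons.
apply: entM_gt0; [exact: nonneg_uhop | exact: nonneg_word_mx | exact: uhop_gt0 | exact: IH].
Qed.

Lemma word_mx_act u w s al : proper_word s -> (ent (word_mx s) u w)@_al != 0 -> w = act u s.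
Proof.
elim: s u al => [|d s IH] u al /=.
  rewrite /word_mx big_nil ent1; case: (u =P w) => [->//|]; by rewrite mcoeff0 eqxx.
move=> /andP[d12 ps]; rewrite word_mx_cons => /entM_coef_neq0[v [be [ga [_ h1 h2]]]].
by have [<- _ _] := uhop_step d12 h1; apply: IH h2.
Qed.

Lemma le_mxM2l G M M' : nonneg_mx G -> le_mx M M' -> le_mx (G * M) (G * M').
Proof. by move=> hG h; rewrite /le_mx -mulrBr; apply: nonneg_mxM. Qed.

(** Both e (with L before the cut) and h (with L after it) have this form. *)
Definition fan_mx L (c : nat) : MS :=
  \sum_(X : {set 'I_n} | (X \subset L) && (#|X| == c)) Phi (@uhop n) (enum (~: L)) X.

Lemma nonneg_fan_mx L c : nonneg_mx (fan_mx L c).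
Proof. by apply: nonneg_mx_sum => X _; apply: nonneg_Phi. Qed.

Lemma e_mx_fan k c : e_mx n k c = fan_mx (low n k) c.
Proof. by rewrite /e_mx /fan_mx lowC. Qed.

Lemma h_mx_fan k c : h_mx n k c = fan_mx (high n k) c.
Proof. by rewrite /h_mx /fan_mx highC. Qed.

Lemma apart_fan L X : X \subset L -> apart (enum (~: L)) X.
Proof. by move=> XL; apply: apart_enumC; rewrite disjoint_sym disjoints_subset setCK. Qed.

Lemma fan_absorb L c X l q : l \in L -> q \notin L -> X \subset L -> #|X| = c -> l \notin X ->
  le_mx (uhop l q * Phi (@uhop n) (enum (~: L)) X) (fan_mx L c.+1) /\
  le_mx (Phi (@uhop n) (enum (~: L)) X * uhop l q) (fan_mx L c.+1).
Proof.
move=> lL qL XL cX lX.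
have lx : le_mx (Phi (@uhop n) (enum (~: L)) (l |: X)) (fan_mx L c.+1).
  apply: (@le_mx_sum _ _ (fun X => (X \subset L) && (#|X| == c.+1)) (fun X => Phi (@uhop n)
    (enum (~: L)) X)).
    by rewrite subUset sub1set lL XL cardsU1 lX cX /=.
  by move=> Y _; apply: nonneg_Phi.
by split; apply: le_mx_trans lx; [apply: Phi_absorb_l | apply: Phi_absorb_r];
  rewrite ?mem_enum ?inE ?negbK //; apply: apart_fan.
Qed.

(** A term of the fan that does not use the leaf l absorbs the move (l, q) in front of
    it. The hypothesis says that the other terms do not contribute. *)
Lemma fan_front L c G l q u v w be al : l \in L -> q \notin L -> nonneg_mx G ->
  (forall X, X \subset L -> #|X| = c -> l \in X -> ent (Phi (@uhop n) (enum (~: L)) X * G) v w = 0) ->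
  0 < (ent (uhop l q) u v)@_be -> 0 < (ent (fan_mx L c * G) v w)@_al ->
  0 < (ent (fan_mx L c.+1 * G) u w)@_(be + al).
Proof.
move=> lL qL nG van h1 h2.
have [X /andP[XL /eqP cX] h3] : exists2 X : {set 'I_n}, (X \subset L) && (#|X| == c) &
    (ent (Phi (@uhop n) (enum (~: L)) X * G) v w)@_al != 0.
  by apply: mcoeff_sum_neq0; rewrite -ent_sum -mulr_suml gt_eqF.
have lX : l \notin X by apply: contraNN h3 => lX; rewrite van // mcoeff0.
have nP := nonneg_mxM (nonneg_Phi (enum (~: L)) X) nG.
apply: le_mx_gt0 (le_mxM2r nG (fan_absorb lL qL XL cX lX).1) _; rewrite -mulrA.
by apply: entM_gt0 h1 _ => //; [apply: nonneg_uhop | rewrite lt_def h3 nP].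
Qed.

Lemma fan_back L c G l q u v w be al : l \in L -> q \notin L -> nonneg_mx G ->
  (forall X, X \subset L -> #|X| = c -> l \in X -> ent (G * Phi (@uhop n) (enum (~: L)) X) u v = 0) ->
  0 < (ent (G * fan_mx L c) u v)@_al -> 0 < (ent (uhop l q) v w)@_be ->
  0 < (ent (G * fan_mx L c.+1) u w)@_(al + be).
Proof.
move=> lL qL nG van h2 h1.
have [X /andP[XL /eqP cX] h3] : exists2 X : {set 'I_n}, (X \subset L) && (#|X| == c) &
    (ent (G * Phi (@uhop n) (enum (~: L)) X) u v)@_al != 0.
  by apply: mcoeff_sum_neq0; rewrite -ent_sum -mulr_sumr gt_eqF.
have lX : l \notin X by apply: contraNN h3 => lX; rewrite van // mcoeff0.
have nP := nonneg_mxM nG (nonneg_Phi (enum (~: L)) X).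
apply: le_mx_gt0 (le_mxM2l nG (fan_absorb lL qL XL cX lX).2) _; rewrite mulrA.
by apply: entM_gt0 _ h1 => //; [apply: nonneg_uhop | rewrite lt_def h3 nP].
Qed.

(** What is needed of the words behind an operator to show that an entry vanishes. *)
Definition has_words M (r : nat) V := forall u w al, (ent M u w)@_al != 0 ->
  exists s, [/\ act u s = w, size s = r & {subset V <= verts s}].

Lemma has_wordsM M M' r r' V V' : has_words M r V -> has_words M' r' V' ->
  has_words (M * M') (r + r') (V :|: V').
Proof.
move=> h h' u w al /entM_coef_neq0[v [be [ga [_ /h[s [s1 s2 s3]] /h'[t [t1 t2 t3]]]]]].
exists (s ++ t); split; rewrite ?act_cat ?s1 // ?size_cat ?s2 ?t2 // => x.
by rewrite inE verts_cat => /orP[/s3->//|/t3->]; rewrite orbT.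
Qed.

Lemma has_words_Phi L X : X \subset L -> has_words (Phi (@uhop n) (enum (~: L)) X) #|X| X.
Proof.
move=> XL u w al /(Phi_word (@uhop_step n) (apart_fan XL))[s [a1 a2 a3 a4 [_ a5]]].
by exists s.
Qed.

Lemma has_words_fan L c : has_words (fan_mx L c) c set0.
Proof.
move=> u w al; rewrite ent_sum => /mcoeff_sum_neq0[X /andP[XL /eqP <-]] /(has_words_Phi XL)[s [a1 a2 _]].
by exists s; split=> // x; rewrite inE.
Qed.

Lemma forest_card s : forest s -> (size s + ncyc (prod_word s))%N = #|psupp (prod_word s)|.
Proof. rewrite /forest => /eqP; have := card_porbits (prod_word s); lia. Qed.

(** Words of minimal length are forests, hence they move all their positions. *)
Lemma has_words_support M r V u w x : has_words M r V ->
  (r + ncyc (pos_perm u w))%N = #|psupp (pos_perm u w)| ->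
  x \in V -> x \notin psupp (pos_perm u w) -> ent M u w = 0.
Proof.
move=> hM hr xV xp; apply/eqP; apply: contraNT xp; rewrite -mleadc_eq0.
move=> /hM[s [s1 s2 /(_ x xV) xs]]; move: hr; rewrite -s1 pos_perm_act inE => hr.
apply: forest_verts xs; rewrite /forest s2; have := card_porbits (prod_word s).
by move: hr; move: #|porbits _| #|psupp _| (ncyc _) => A B C; lia.
Qed.

Lemma psupp_pendant p l q : l != q -> p l = l ->
  psupp (tperm l q * p)%g = l |: (q |: psupp p) /\ psupp (p * tperm l q)%g = l |: (q |: psupp p).
Proof.
move=> lq pl; have plE x : (p x == l) = (x == l) by rewrite -{1}pl (inj_eq perm_inj).
split; apply/setP => x; rewrite !inE permM.
  have [->|xl] := eqVneq x l; first by rewrite tpermL plE eq_sym.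
  have [->|xq] := eqVneq x q; first by rewrite tpermR pl.
  by rewrite tpermD // eq_sym.
have [->|xl] := eqVneq x l; first by rewrite pl tpermL eq_sym.
have [->|xq] /= := eqVneq x q.
  have [->|pq] := eqVneq (p q) q; first by rewrite tpermR.
  by rewrite tpermD // eq_sym // plE eq_sym.
have [e|pq] := eqVneq (p x) q; first by rewrite e tpermR eq_sym xl eq_sym.
by rewrite tpermD // eq_sym // plE.
Qed.

End WordMatrices.

(** * The monomial of a pair of permutations *)

Section Values.
Variables (n : nat) (R : comAlgType (Zq n)) (S : 'S_n -> R) (qH : qH_flag S) (k : nat).
Implicit Types (u v w p : 'S_n) (x y z i j l q : 'I_n) (X Y L V : {set 'I_n}) (al be ga : 'X_{1..n.-1}).
Implicit Types (s t : seq ('I_n * 'I_n)) (d : 'I_n * 'I_n).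
Local Notation nc u w := (ncyc (pos_perm u w)).
Local Notation moved u w L := (#|psupp (pos_perm u w) :&: L|).

(** The leading coefficient of the generating polynomial of (u, w); by the structure
    theorem it is 0 or a monomial. *)
Definition pair_val u w : Zq n := (gen k setT u w)`_(moved u w (low n k)).

Lemma coef_shape (A : nzRingType) (x : A) (a b c : nat) :
  (x%:P * ('X^a * (1 + 'X) ^+ b))`_(a + c) = x *+ 'C(b, c).
Proof.
rewrite coefCM coefXnM ltnNge leq_addr /= addKn addrC exprD1n coef_sum.
rewrite (eq_bigr (fun i : 'I_b.+1 => ((i : nat) == c)%:R *+ 'C(b, i))) => [|i _]; last first.
  by rewrite coefMn coefXn eq_sym.
have [cb|bc] := leqP c b; last first.
  rewrite big1 ?mulr0 ?bin_small ?mulr0n // => i _.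
  by rewrite (_ : (i : nat) == c = false) ?mul0rn //; have := ltn_ord i; lia.
rewrite (bigD1 (inord c)) //= inordK // eqxx big1 ?addr0 ?mulr_natr // => i ic.
have -> : (i : nat) == c = false by apply: contra_neqF ic => /eqP<-; rewrite inord_val.
by rewrite mul0rn.
Qed.

Lemma pair_val_gen u w : let h := moved u w (low n k) in let g := moved u w (high n k) in
  (pair_val u w = 0 /\ gen k setT u w = 0) \/
  [/\ exists2 al, pair_val u w = 'X_[al] & turns k u w al, (nc u w <= h)%N, (nc u w <= g)%N &
     gen k setT u w = (pair_val u w)%:P * ('X^(h - nc u w) * (1 + 'X) ^+ nc u w)].
Proof.
move=> h g; have [|x e] := @gen_structure n R S qH k setT u w; first exact: subsetT.
case=> [x0|[[al ex tx] sh sg]]; first by left; rewrite /pair_val e x0 polyC0 mul0r coef0.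
right; have pv : pair_val u w = x.
  by rewrite /pair_val -[X in _`_X](subnK sh) e coef_shape binn.
split; [by exists al; rewrite ?pv | exact: sh | exact: sg | rewrite pv; exact: e].
Qed.

Definition side L := L = low n k \/ L = high n k.

Lemma side_C L : side L -> side (~: L).
Proof. by case=> ->; rewrite ?lowC ?highC; [right | left]. Qed.

Lemma fan_comm L a b : side L -> fan_mx L a * fan_mx (~: L) b = fan_mx (~: L) b * fan_mx L a.
Proof.
by case=> ->; rewrite ?lowC ?highC -e_mx_fan -h_mx_fan (e_h_comm k qH).
Qed.

(** The leading and the lowest coefficients of x X^(h-s) (1+X)^s are both x: so x is an
    entry of e_h h_(g-s), as well as of e_(h-s) h_g. The two sides of the cut are thus
    treated alike. *)
Lemma fan_val L u w : side L -> (nc u w <= moved u w (~: L))%N -> (nc u w <= moved u w L)%N ->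
  ent (fan_mx L (moved u w L) * fan_mx (~: L) (moved u w (~: L) - nc u w)) u w = pair_val u w.
Proof.
move=> sL; have := pair_val_gen u w; have := card_low_high k (psupp (pos_perm u w)).
case: sL => ->; rewrite ?lowC ?highC => cp pv sC sL.
  by rewrite -e_mx_fan -h_mx_fan (e_h_ent qH) // -addnA subnK.
have -> : fan_mx (high n k) (moved u w (high n k)) * fan_mx (low n k) (moved u w (low n k) - nc u w) =
   e_mx n k (moved u w (low n k) - nc u w) * h_mx n k (moved u w (high n k)).
  by rewrite (e_h_comm k qH) e_mx_fan h_mx_fan.
rewrite (e_h_ent qH); last by rewrite addnAC subnK.
case: pv => [[-> ->]|[_ _ _ ->]]; first by rewrite coef0.
by rewrite -[X in _`_X]addn0 coef_shape bin0.
Qed.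

Definition cross_word s := all (fun d : 'I_n * 'I_n => (d.1 < k)%N != (d.2 < k)%N) s.

Lemma cross_proper s : cross_word s -> proper_word s.
Proof. by apply: sub_all => d; apply: contraNneq => ->. Qed.

Lemma pair_val_nz u w al : (pair_val u w)@_al != 0 ->
  [/\ pair_val u w = 'X_[al], turns k u w al, (nc u w <= moved u w (low n k))%N &
     (nc u w <= moved u w (high n k))%N].
Proof.
case: (pair_val_gen u w) => [[-> _]|[[be e te] sl sh _]]; first by rewrite mcoeff0 eqxx.
rewrite e mcoeffX; have [<-|_] := eqVneq be al; [by split | by rewrite eqxx].
Qed.

Lemma side_le L u w al : side L -> (pair_val u w)@_al != 0 -> (nc u w <= moved u w L)%N.
Proof. by move=> sL /pair_val_nz[_ _ h1 h2]; case: sL => ->. Qed.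

(** The leaf is new on its side of the cut; if the other end is new too, then the edge
    starts a new cycle. *)
Lemma pendant_counts L p p' l q (r : nat) : l \in L -> q \notin L -> p' l = l ->
  p = (tperm l q * p')%g \/ p = (p' * tperm l q)%g ->
  (r + ncyc p' = #|psupp p'|)%N -> (r.+1 + ncyc p = #|psupp p|)%N ->
  [/\ #|psupp p :&: L| = #|psupp p' :&: L|.+1,
      #|psupp p :&: ~: L| = (#|psupp p' :&: ~: L| + (q \notin psupp p'))%N &
      ncyc p = (ncyc p' + (q \notin psupp p'))%N].
Proof.
move=> lL qL pl ep fp' fp.
have lq : l != q by apply: contraNneq qL => <-.
have es : psupp p = l |: (q |: psupp p') by case: ep => ->;
  [case: (psupp_pendant lq pl) | case: (psupp_pendant lq pl)].
have lp : l \notin psupp p' by rewrite inE pl eqxx.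
have cL : #|psupp p :&: L| = #|psupp p' :&: L|.+1.
  rewrite es setIUl (setIidPl _) ?sub1set // setIUl.
  rewrite (_ : [set q] :&: L = set0) ?set0U ?cardsU1 ?inE ?(negbTE lp) //.
    by rewrite pl eqxx.
  by apply/setP => x; rewrite !inE; case: eqP => // ->; rewrite (negbTE qL).
have cH : #|psupp p :&: ~: L| = (#|psupp p' :&: ~: L| + (q \notin psupp p'))%N.
  rewrite es setIUl (_ : [set l] :&: _ = set0) ?set0U; last first.
    by apply/setP => x; rewrite !inE; case: eqP => // ->; rewrite lL.
  rewrite setIUl (setIidPl _) ?sub1set ?inE // cardsU1 addnC; congr (_ + _)%N.
  by rewrite !inE qL andbT.
split=> //; have := cardsID L (psupp p); have := cardsID L (psupp p').
rewrite !setDE cL cH; move: fp fp'; move: (q \notin _) #|_| #|_| #|_| #|_| (ncyc p) (ncyc p').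
clear; lia.
Qed.

(** Induction on the length. A pendant edge of the word commutes with the letters on one
    of its sides, and is moved to the corresponding end of the word. The rest of the
    word is seen by induction in a product of two fans, in which the fan with the leaves
    on the side of l is brought to that end; it absorbs the edge. *)
Lemma forest_pair_val s u w al : forest s -> cross_word s ->
  0 < (ent (word_mx s) u w)@_al -> 0 < (pair_val u w)@_al.
Proof.
have [m] := ubnP (size s); elim: m s u w al => // m IH s u w al sm fs cs h.
have [s0|[z zs]] : s = [::] \/ exists z, z \in verts s.
- by case: (s) => [|d s']; [left | right; exists d.1; rewrite verts_cons eqxx].
- move: h; rewrite s0 /word_mx big_nil ent1; case: eqP => [<-|_]; last by rewrite mcoeff0 ltxx.
  by rewrite /pair_val gen_id pos_permxx coef1 psupp1 set0I cards0.
have [l [q [[s1 [d [s2 [es hd ls hq]]]] _ _ _]]] := forest_pendant fs zs.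
have pw := cross_proper cs.
have ew := word_mx_act pw (lt0r_neq0 h).
pose s' := s1 ++ s2.
have [cs' clq] : cross_word s' /\ (l < k)%N != (q < k)%N.
  move: cs; rewrite es /cross_word !all_cat /= => /and3P[h1 h2 h3]; rewrite h1 h3; split=> //.
  by case: hd h2 => -> //=; rewrite eq_sym.
have pw' := cross_proper cs'.
have [L sL [lL qL]] : exists2 L, side L & l \in L /\ q \notin L.
  have [lk|lk] := ltnP l k.
    by exists (low n k); [left | rewrite !inE lk; move: clq; rewrite lk; case: (q < k)%N].
  exists (high n k); [by right | rewrite !inE lk -ltnNge; move: clq; rewrite ltnNge lk; by case: (q < k)%N].
have lq : l != q by apply: contraNneq qL => <-.
have [pw1 pw2] : proper_word s1 /\ proper_word s2.
  by move: pw'; rewrite /proper_word all_cat => /andP[].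
have [ls1 ls2] : l \notin verts s1 /\ l \notin verts s2.
  by move: ls; rewrite verts_cat negb_or => /andP[].
have ud : uhop d.1 d.2 = uhop l q by case: hd => -> //=; rewrite uhopC.
have sz : size s = (size s').+1 by rewrite es !size_cat /= addnS.
have fcard := forest_card fs.
have pwE : pos_perm u w = prod_word s by rewrite ew pos_perm_act.
have sm' : (size s' < m)%N by move: sm; rewrite sz.
case: hq => [q1|[q2 _]].
  have eW : word_mx s = uhop l q * word_mx s'.
    by rewrite es word_mx_cat word_mx_cons ud mulrA -word_mx_comm // -mulrA -word_mx_cat.
  move: (lt0r_neq0 h); rewrite eW => /entM_coef_neq0[v [be [ga [eal h1 h2]]]].
  have ev := word_mx_act pw' h2.
  have pE : pos_perm v w = prod_word s' by rewrite ev pos_perm_act.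
  have [uv _ _] := uhop_step lq h1.
  have eP : pos_perm u w = (pos_perm v w * tperm l q)%g by rewrite uv -pos_perm_tperm.
  have fs' : forest s'.
    apply: (@forest_cons _ _ (l, q)); rewrite /forest /= prod_word_cons /= -pE -eP pwE -addn1.
    by move: fs; rewrite /forest sz addn1.
  have h3 : 0 < (pair_val v w)@_ga.
    by apply: IH fs' cs' _ => //; rewrite lt_def h2; apply: nonneg_word_mx.
  have h3' := lt0r_neq0 h3.
  have fcard' := forest_card fs'.
  have p'l : pos_perm v w l = l.
    by apply/eqP; rewrite pos_perm_fix ev act_fix // verts_cat negb_or ls1.
  rewrite -pE in fcard'; rewrite -pwE sz in fcard.
  have [cL cH cN] := pendant_counts lL qL p'l (or_intror eP) fcard' fcard.
  have nL := side_le sL h3'; have nH := side_le (side_C sL) h3'.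
  rewrite -(fan_val sL) ?cL ?cH ?cN ?leq_add2r //; last first.
    by rewrite (leq_trans (leq_add nL (leq_b1 _))) // addn1.
  rewrite subnDr eal; apply: (fan_front (v := v)) lL qL (nonneg_fan_mx _ _) _ _ _.
  - move=> X XL cX lX; apply: (has_words_support (x := l) (V := X :|: set0)).
    + exact: has_wordsM (has_words_Phi XL) (@has_words_fan _ _ _).
    + by rewrite cX -addnA subnK // -setDE cardsID.
    + by rewrite setU0.
    by rewrite inE p'l eqxx.
  - by rewrite lt_def h1; apply: nonneg_uhop.
  by rewrite (fan_val sL).
have eW : word_mx s = word_mx s' * uhop l q.
  by rewrite es word_mx_cat word_mx_cons ud word_mx_comm // mulrA -word_mx_cat.
move: (lt0r_neq0 h); rewrite eW => /entM_coef_neq0[v [ga [be [eal h2 h1]]]].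
have ev := word_mx_act pw' h2.
have pE : pos_perm u v = prod_word s' by rewrite ev pos_perm_act.
have [vw _ _] := uhop_step lq h1.
have eP : pos_perm u w = (tperm l q * pos_perm u v)%g by rewrite vw pos_perm_rcoset.
have fs' : forest s'.
  apply: (proj1 (@forest_rcons _ _ (l, q) _)); rewrite /forest size_rcons prod_word_rcons /= -pE -eP pwE.
  by move: fs; rewrite /forest sz.
have h3 : 0 < (pair_val u v)@_ga.
  by apply: IH fs' cs' _ => //; rewrite lt_def h2; apply: nonneg_word_mx.
have h3' := lt0r_neq0 h3.
have fcard' := forest_card fs'.
have p'l : pos_perm u v l = l.
  by apply/eqP; rewrite pos_perm_fix ev act_fix // verts_cat negb_or ls1.
rewrite -pE in fcard'; rewrite -pwE sz in fcard.
have [cL cH cN] := pendant_counts lL qL p'l (or_introl eP) fcard' fcard.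
have nL := side_le sL h3'; have nH := side_le (side_C sL) h3'.
rewrite -(fan_val sL) ?cL ?cH ?cN ?leq_add2r //; last first.
  by rewrite (leq_trans (leq_add nL (leq_b1 _))) // addn1.
rewrite subnDr eal (fan_comm _ _ sL); apply: (fan_back (v := v)) lL qL (nonneg_fan_mx _ _) _ _ _.
- move=> X XL cX lX; apply: (has_words_support (x := l) (V := set0 :|: X)).
  + exact: has_wordsM (@has_words_fan _ _ _) (has_words_Phi XL).
  + by rewrite cX addnAC subnK // addnC -setDE cardsID.
  + by rewrite set0U.
  by rewrite inE p'l eqxx.
- by rewrite -(fan_comm _ _ sL) (fan_val sL).
by rewrite lt_def h1; apply: nonneg_uhop.
Qed.

Lemma pair_val_word u w al : (pair_val u w)@_al != 0 -> exists s,
  [/\ cross_word s, word_ok u s, act u s = w, word_wt u s = al &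
    (size s + nc u w)%N = #|psupp (pos_perm u w)|].
Proof.
move=> h; have sL : side (low n k) by left.
have hH : (nc u w <= moved u w (~: low n k))%N := side_le (side_C sL) h.
move: (h); rewrite -(fan_val sL hH (side_le sL h)) => /entM_coef_neq0[v [be [ga [-> ]]]].
rewrite !ent_sum => /mcoeff_sum_neq0[X /andP[XL /eqP cX]] /(Phi_word (@uhop_step n)
  (apart_fan XL))[s [a1 a2 a3 a4 [a5 _]]].
move=> /mcoeff_sum_neq0[Y /andP[YH /eqP cY]] /(Phi_word (@uhop_step n)
  (apart_fan YH))[t [b1 b2 b3 b4 [b5 _]]].
exists (s ++ t); split; rewrite ?act_cat ?word_ok_cat ?word_wt_cat ?a1 ?a2 ?a3 ?b3 //.
  rewrite /cross_word all_cat; apply/andP; split; apply/allP => d.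
    move=> /a5[/(subsetP XL)]; rewrite mem_enum !inE => d1 d2.
    by rewrite d1; case: (d.2 < k)%N d2.
  move=> /b5[/(subsetP YH)]; rewrite mem_enum !inE negbK => d1 d2.
  by rewrite d2; case: (d.1 < k)%N d1.
by rewrite size_cat a4 b4 cX cY -addnA subnK // -setDE cardsID.
Qed.

End Values.

(** * Chains of the quantum k-Bruhat order *)

Section Chains.
Variables (n k : nat).
Implicit Types (u v w p : 'S_n) (i j l q : 'I_n) (al be ga : 'X_{1..n.-1}) (x y z : qperm n).
Implicit Types (s t : seq ('I_n * 'I_n)) (d : 'I_n * 'I_n).

Lemma mdeg_qexp i j : (i <= j)%N -> mdeg (qexp i j) = (j - i)%N.
Proof.
move=> ij; rewrite mdegE (eq_bigr (fun m : 'I_n.-1 => (i <= m < j)%N : nat)) => [|m _];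
  last by rewrite mnmE.
have h r : (\sum_(m < r) (i <= m < j) = minn r j - minn r i)%N.
  elim: r => [|r IH]; first by rewrite big_ord0 !min0n.
  by rewrite big_ord_recr /= IH; lia.
by rewrite h; have := ltn_ord j; lia.
Qed.

(** Both kinds of covers are moves, and hop_wt is the exponent of q that they collect. *)
Lemma coverP x y : qk_cover k x y <-> exists i j, [/\ (i < k <= j)%N, free_arc x.2 i j,
  y.2 = x.2 ∘p tperm i j & y.1 = (x.1 + hop_wt x.2 i j)%MM].
Proof.
have lij i j : (i < k <= j)%N -> (i < j)%N by case/andP; apply: leq_trans.
split=> [[i [j [kij e2 h]]]|[i [j [kij fa e2 e1]]]]; exists i, j; have ij := lij _ _ kij.
  case: h => -[]; rewrite ?bruhat_stepE ?quantum_stepE // => /andP[uij fa] e1; split=> //; rewrite /hop_wt.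
    by rewrite uij addm0.
  by rewrite ltnNge (ltnW uij).
split=> //; have nij : i != j by rewrite -val_eqE neq_ltn ij.
have := perm_val_neq x.2 nij; rewrite neq_ltn => /orP[h|h]; [left|right];
  rewrite ?bruhat_stepE ?quantum_stepE // h fa; split=> //; rewrite e1 /hop_wt.
  by rewrite h addm0.
by rewrite ltnNge (ltnW h).
Qed.

Lemma cover_qell x y : qk_cover k x y -> qell y = (qell x).+1.
Proof.
case: x y => [al u] [be w] [i [j [/andP[ik kj] /= -> h]]]; rewrite /qell /=.
have ij : (i <= j)%N by apply: ltnW; apply: leq_trans kj.
case: h => -[h ->]; first by rewrite (eqP h) addnS.
by rewrite mdegD mdeg_qexp // mulnDr -addnA [X in (_ + X)%N]addnC -(eqP h) addnS.
Qed.

Lemma word_chain x s : cross_word k s -> word_ok x.2 s ->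
  qk_le k x ((x.1 + word_wt x.2 s)%MM, act x.2 s) /\
  qell ((x.1 + word_wt x.2 s)%MM, act x.2 s) = (qell x + size s)%N.
Proof.
elim/last_ind: s => [_ _|s d IH].
  by rewrite /= addm0 addn0; case: x => al u; split=> //; apply: qk_le_refl.
rewrite -cats1 /cross_word all_cat word_ok_cat word_wt_cat /= andbT addm0 => /andP[cs cd] /andP[oks okd].
have [le1 q1] := IH cs oks; rewrite act_cat /= addmA size_cat addn1 addnS -q1.
set y := (_, act x.2 s) in le1 *; set z := (_, _ ∘p _).
have yz : qk_cover k y z; last by split; [apply: qk_le_cover le1 yz | rewrite (cover_qell yz)].
apply/coverP; move: okd; rewrite /z /y /step_ok /step_wt /=.
have nd : (d.1 : nat) != d.2 by apply: contraNneq cd => ->.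
case: ltngtP nd => // d12 _ fa; [exists d.1, d.2 | exists d.2, d.1]; split=> //; last by rewrite tpermC.
all: rewrite ?andbT in fa; by [exact: fa | move: cd d12; clear; case: (ltnP d.1 k);
  case: (ltnP d.2 k) => //=; lia].
Qed.

Lemma chain_word x y : qk_le k x y -> exists s, [/\ cross_word k s, word_ok x.2 s,
  y.1 = (x.1 + word_wt x.2 s)%MM & y.2 = act x.2 s].
Proof.
elim=> [|{}y z _ [s [cs oks e1 e2]] /coverP[i [j [/andP[ik kj] fa ez2 ez1]]]].
  by exists [::]; rewrite /= addm0.
have ij : (i < j)%N by apply: leq_trans kj.
exists (rcons s (i, j)); rewrite -cats1 word_ok_cat word_wt_cat act_cat /= -e2 /step_ok /step_wt ij fa.
by rewrite addm0 addmA -e1 oks /cross_word all_cat [all _ s]cs /= ik (ltnNge j) kj.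
Qed.

End Chains.

Section Minimal.
Variables (n : nat) (R : comAlgType (Zq n)) (S : 'S_n -> R) (qH : qH_flag S) (k : nat).
Implicit Types (u v w : 'S_n) (al : 'X_{1..n.-1}).

Lemma qell_embed u : qell (embed u) = ell u.
Proof. by rewrite /qell /= mdeg0 muln0. Qed.

Lemma psupp_ncyc_arith (m s p : nat) : (2 * s <= p)%N -> m = (p - s)%N -> (m + s)%N = p.
Proof. lia. Qed.

(** Minimal chains are forest words: their length is the least that the number of cycles
    allows. *)
Lemma minimal_intervalP u w al : minimal_interval k u (al, w) <-> (pair_val k u w)@_al != 0.
Proof.
rewrite /minimal_interval /= pos_perm_conj psupp_conj ncyc_conj; split.
  case=> /chain_word[s [cs oks /= eal ew]].
  have [_ eq] := @word_chain n k (embed u) s cs oks.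
  rewrite /interval_rank eal ew /= qell_embed in eq * => er.
  have fs : forest s.
    rewrite /forest; have := card_porbits (prod_word s); rewrite eq addKn pos_perm_act in er.
    have := psupp_ncyc_arith (ncyc_le _) er.
    by move: #|porbits _| #|psupp _| (ncyc _) (size s) => A B C D; lia.
  rewrite add0m; apply: lt0r_neq0; apply: (forest_pair_val qH fs cs).
  exact: word_mx_gt0 (cross_proper cs) oks.
move=> /(pair_val_word qH)[s [cs oks es eal sz]].
have [le1 eq] := @word_chain n k (embed u) s cs oks.
rewrite /= add0m es eal in le1 eq; split=> //.
by rewrite /interval_rank eq qell_embed addKn -sz addnK.
Qed.

Lemma minimal_rank u w al : (pair_val k u w)@_al != 0 ->
  [/\ (interval_rank u (al, w) + ncyc (pos_perm u w))%N = #|psupp (pos_perm u w)|,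
     ht (w ∘p u^-1%g) = #|psupp (pos_perm u w) :&: low n k| &
     (2 * mdeg al + ell w = ell u + interval_rank u (al, w))%N].
Proof.
move=> h; have [s [cs oks es eal sz]] := pair_val_word qH h.
have [_ eq] := @word_chain n k (embed u) s cs oks; rewrite /= add0m es eal qell_embed in eq.
rewrite /interval_rank eq addKn; split=> //.
by have [_ /turns_ht] := pair_val_nz qH h.
Qed.

End Minimal.

(** * Hooks *)

Section HookShapes.
Variables (n k : nat).
Hypothesis k_range : (0 < k < n)%N.
Implicit Types (u v w p : 'S_n) (i j l q : 'I_n) (a b : nat).
Implicit Types (s t : seq ('I_n * 'I_n)) (d : 'I_n * 'I_n).

(** The one-line notation of the Grassmannian permutation of (b, 1^(a-1)) : only the
    positions from k - a to k + b - 1 move, in one cycle. *)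
Definition hook_val a b (l : nat) : nat :=
  if (l < k - a)%N then l else if (l < k.-1)%N then l.+1 else if l == k.-1 then (k.-1 + b)%N else
  if l == k then (k - a)%N else if (l < k + b)%N then l.-1 else l.

Definition is_hook a b w := forall l, w l = hook_val a b l :> nat.

Lemma hook_val_low a b (m : nat) : (m < k - a)%N -> hook_val a b m = m.
Proof. by rewrite /hook_val => ->. Qed.

Lemma hook_val_last a b : (0 < a)%N -> hook_val a b k.-1 = (k.-1 + b)%N.
Proof. by rewrite /hook_val; do ?case: ifP; lia. Qed.

Lemma hook_val_first a b : hook_val a b k = (k - a)%N.
Proof. by rewrite /hook_val; do ?case: ifP; lia. Qed.

Lemma hook_val_high a b (m : nat) : (0 < b)%N -> (k + b <= m)%N -> hook_val a b m = m.
Proof. by rewrite /hook_val; do ?case: ifP; lia. Qed.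

Lemma card_interval (lo hi : nat) : (hi <= n)%N -> #|[set l : 'I_n | (lo <= l < hi)%N]| = (hi - lo)%N.
Proof.
move=> hn; have h r : (\sum_(l < r) (lo <= l < hi) = minn r hi - minn r lo)%N.
  by elim: r => [|r IH]; [rewrite big_ord0 !min0n | rewrite big_ord_recr /= IH; lia].
rewrite -sum1_card big_mkcond /= (eq_bigr (fun l : 'I_n => (lo <= l < hi)%N : nat)) => [|l _].
  by rewrite h; lia.
by rewrite inE; case: ifP.
Qed.

Lemma hook_psupp a b w : (0 < a <= k)%N -> (0 < b)%N -> is_hook a b w ->
  psupp w = [set l : 'I_n | (k - a <= l < k + b)%N].
Proof.
move=> ha hb hw; apply/setP => l; rewrite !inE -val_eqE /= hw /hook_val.
have := ltn_ord l; do ?case: ifP; lia.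
Qed.

Lemma hook_range a b w : (0 < a <= k)%N -> (0 < b)%N -> is_hook a b w -> (k + b <= n)%N.
Proof.
move=> ha hb hw; have kn : (k.-1 < n)%N by lia.
have := hw (Ordinal kn); have := ltn_ord (w (Ordinal kn)).
rewrite /hook_val /=; do ?case: ifP; lia.
Qed.

Lemma hook_card a b w : (0 < a <= k)%N -> (0 < b)%N -> is_hook a b w -> #|psupp w| = (a + b)%N.
Proof.
move=> ha hb hw; rewrite (hook_psupp ha hb hw) card_interval ?(hook_range ha hb hw) //; lia.
Qed.

Lemma hook_card_low a b w : (0 < a <= k)%N -> (0 < b)%N -> is_hook a b w -> #|psupp w :&: low n k| = a.
Proof.
move=> ha hb hw; rewrite (hook_psupp ha hb hw).
rewrite (_ : _ :&: _ = [set l : 'I_n | (k - a <= l < k)%N]) ?card_interval; try lia.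
by apply/setP => l; rewrite !inE; lia.
Qed.

Lemma hook_start w i j : i = k.-1 :> nat -> j = k :> nat -> w = 1%g ∘p tperm i j -> is_hook 1 1 w.
Proof.
move=> ei ej -> l; have [->|li] := eqVneq l i.
  by rewrite pcomp_tpermL perm1 /hook_val ei ej; do ?case: ifP; lia.
have [->|lj] := eqVneq l j.
  by rewrite pcomp_tpermR perm1 /hook_val ei ej; do ?case: ifP; lia.
rewrite pcomp_tpermD // perm1 /hook_val; move: li lj; rewrite -!val_eqE /= ei ej.
by do ?case: ifP; lia.
Qed.

Lemma hook_tall a b w w' i j : (0 < a < k)%N -> (0 < b)%N -> is_hook a b w ->
  i = (k - a.+1)%N :> nat -> j = k :> nat -> w' = w ∘p tperm i j -> is_hook a.+1 b w'.
Proof.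
move=> ha hb hw ei ej -> l; have [->|li] := eqVneq l i.
  by rewrite pcomp_tpermL hw /hook_val ei ej; do ?case: ifP; lia.
have [->|lj] := eqVneq l j.
  by rewrite pcomp_tpermR hw /hook_val ei ej; do ?case: ifP; lia.
rewrite pcomp_tpermD // hw /hook_val; move: li lj; rewrite -!val_eqE /= ei ej.
by do ?case: ifP; lia.
Qed.

Lemma hook_wide a b w w' i j : (0 < a <= k)%N -> (0 < b)%N -> is_hook a b w ->
  i = k.-1 :> nat -> j = (k + b)%N :> nat -> w' = w ∘p tperm i j -> is_hook a b.+1 w'.
Proof.
move=> ha hb hw ei ej -> l; have [->|li] := eqVneq l i.
  by rewrite pcomp_tpermL hw /hook_val ei ej; do ?case: ifP; lia.
have [->|lj] := eqVneq l j.
  by rewrite pcomp_tpermR hw /hook_val ei ej; do ?case: ifP; lia.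
rewrite pcomp_tpermD // hw /hook_val; move: li lj; rewrite -!val_eqE /= ei ej.
by do ?case: ifP; lia.
Qed.

Lemma start_free i j : (i < k <= j)%N -> free_arc (1%g : 'S_n) i j -> i = k.-1 :> nat /\ j = k :> nat.
Proof.
move=> ij /free_arcP h; have k1 : (k.-1 < n)%N by lia.
have k0 : (k < n)%N by lia.
have := h (Ordinal k1); have := h (Ordinal k0); rewrite !perm1 /arc /=; lia.
Qed.

(** The two free edges join the fixed position next to the hook on one side to the
    position next to the cut on the other side. For any other edge with an end outside
    the hook, an intermediate position carries an intermediate value. *)
Lemma hook_free a b w i j : (0 < a <= k)%N -> (0 < b)%N -> is_hook a b w -> (i < k <= j)%N ->
  (i < k - a)%N || (k + b <= j)%N -> free_arc w i j ->
  (i = (k - a.+1)%N :> nat /\ j = k :> nat) \/ (i = k.-1 :> nat /\ j = (k + b)%N :> nat).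
Proof.
move=> ha hb hw ij out /free_arcP h; have kb := hook_range ha hb hw.
have k1 : (k.-1 < n)%N by lia.
have k0 : (k < n)%N by lia.
have vk := hook_val_first a b.
have [ik|ik] := ltnP i (k - a).
  left; have ka : (k - a.+1 < n)%N by lia.
  have := h (Ordinal ka); have := h (Ordinal k0); rewrite !hw /= vk.
  rewrite (hook_val_low _ ik) (@hook_val_low _ _ (k - a.+1)%N); last lia.
  have : j != k :> nat -> (k <= hook_val a b j)%N by rewrite /hook_val; do ?case: ifP; lia.
  have : j = k :> nat -> hook_val a b j = (k - a)%N by move=> ->.
  by move: ik ij ha; move: (hook_val a b j) (i : nat) (j : nat); clear; rewrite /arc; lia.
right; have jb : (k + b <= j)%N by move: out; rewrite ltnNge ik.
have kbn : (k + b < n)%N by apply: leq_ltn_trans jb (ltn_ord j).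
have := h (Ordinal k1); have := h (Ordinal kbn); rewrite !hw /=.
have vhigh m := @hook_val_high a b m hb.
have vk1 : hook_val a b k.-1 = (k.-1 + b)%N by apply: hook_val_last; case/andP: ha.
have vi : i != k.-1 :> nat -> hook_val a b i = i.+1.
  by move=> ni; rewrite /hook_val; move: ni ij ik; do ?case: ifP; lia.
rewrite (vhigh j jb) (vhigh (k + b)%N) // vk1.
have [ei|ni] := eqVneq (i : nat) k.-1.
  by rewrite ei vk1; move: ij ha jb ei; move: (i : nat) (j : nat); clear; rewrite /arc; lia.
by rewrite vi //; move: ij ha jb ni hb; move: (i : nat) (j : nat); clear; rewrite /arc; lia.
Qed.

End HookShapes.

Section HookWords.
Variables (n k : nat).
Hypothesis k_range : (0 < k < n)%N.
Implicit Types (u v w p : 'S_n) (i j l q : 'I_n) (a b : nat).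
Implicit Types (s t : seq ('I_n * 'I_n)) (d : 'I_n * 'I_n).

Lemma ncyc1_porbit p x y : ncyc p = 1%N -> x \in psupp p -> y \in psupp p -> x \in porbit p y.
Proof.
rewrite /ncyc !inE => /eqP/cards1P[C eC] hx hy.
have cyc z : p z != z -> porbit p z = C.
  move=> hz; apply/set1P; rewrite -eC inE card_porbit_gt1 hz andbT.
  by apply/imsetP; exists z.
by rewrite (cyc y hy) -(cyc x hx) porbit_id.
Qed.

Lemma cross_edge u d : (d.1 < k)%N != (d.2 < k)%N -> exists i j,
  [/\ (i < k <= j)%N, step_ok u d.1 d.2 = free_arc u i j, step_wt u d.1 d.2 = hop_wt u i j,
    tperm d.1 d.2 = tperm i j & forall p, (d.1 \in porbit p d.2) = (i \in porbit p j)].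
Proof.
case: d => x y /=; rewrite /step_ok /step_wt.
case: (ltnP x k) => hx; case: (ltnP y k) => hy; rewrite ?eqxx // => _.
  by exists x, y; rewrite hx hy (leq_trans hx hy).
exists y, x; rewrite hy hx [(x < y)%N]ltnNge (leq_trans (ltnW hy) hx) /=; split=> //; first exact: tpermC.
by move=> p; rewrite porbit_sym.
Qed.

(** A hook is a single cycle, so the next edge of a forest word has an end outside of
    it, and it lengthens the hook by one cell. *)
Lemma forest_hooks s : forest s -> cross_word k s -> word_ok 1%g s -> s != [::] ->
  word_wt 1%g s = 0%MM /\
  exists a b, [/\ (0 < a <= k)%N, (0 < b)%N, is_hook k a b (act 1%g s) & (size s).+1 = (a + b)%N].
Proof.
elim/last_ind: s => // s d IH /forest_rcons[fs nd].
rewrite -cats1 /cross_word all_cat word_ok_cat word_wt_cat act_cat size_cat /= !andbT addm0 addn1.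
move=> /andP[cs /(cross_edge (act 1%g s))[i [j [kij -> -> -> eo]]]] /andP[oks fa] _.
move: nd; rewrite eo => nd.
have [s0|s0] := eqVneq s [::].
  move: fa; rewrite s0 /= => fa; have [ei ej] := start_free k_range kij fa.
  rewrite /hop_wt !perm1 ei ej prednK ?leqnn ?addm0; last by case/andP: k_range.
  split=> //; exists 1%N, 1%N; split=> //; last exact: (hook_start k_range ei ej).
  by case/andP: k_range.
have [e0 [a [b [ha hb hw sz]]]] := IH fs cs oks s0.
have nc1 : ncyc (prod_word s) = 1%N.
  have := forest_card fs; rewrite (hook_card k_range ha hb hw) -sz; lia.
have out : (i < k - a)%N || (k + b <= j)%N.
  apply: contraT; rewrite negb_or -leqNgt -ltnNge => /andP[h1 h2]; case/negP: nd.
  by apply: ncyc1_porbit => //; rewrite (hook_psupp k_range ha hb hw) inE; lia.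
have lt_wt : (act 1%g s i < act 1%g s j)%N -> hop_wt (act 1%g s) i j = 0%MM by rewrite /hop_wt => ->.
case: (hook_free k_range ha hb hw kij out fa) => -[ei ej].
  have ha' : (0 < a < k)%N by lia.
  rewrite e0 lt_wt ?addm0; last first.
    by rewrite !hw ei ej (hook_val_first k_range) hook_val_low; move: ha'; clear; lia.
  split=> //; exists a.+1, b; split=> //; first by lia.
    exact: (hook_tall k_range ha' hb hw ei ej).
  by rewrite sz.
rewrite e0 lt_wt ?addm0; last first.
  by rewrite !hw ei ej (hook_val_last k_range) ?(hook_val_high k_range) //; move: ha k_range; clear; lia.
split=> //; exists a, b.+1; split=> //; last by rewrite sz addnS.
exact: (hook_wide k_range ha hb hw ei ej).
Qed.

Definition flat_word s := [/\ forest s, cross_word k s, word_ok 1%g s & word_wt 1%g s = 0%MM].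

Lemma flat_word_rcons s i j : flat_word s -> (i < k <= j)%N -> free_arc (act 1%g s) i j ->
  (act 1%g s i < act 1%g s j)%N -> act 1%g s i = i \/ act 1%g s j = j -> flat_word (rcons s (i, j)).
Proof.
case=> fs cs oks ws kij fa lt_ij fix_ij.
have ij : (i < j)%N by case/andP: kij; apply: leq_trans.
have nij : i != j by rewrite -val_eqE neq_ltn ij.
split.
- have no : i \notin porbit (prod_word s) j.
    case: fix_ij => [hi|hj].
      have /eqP e : porbit (prod_word s) i == [set i] by rewrite porbit_fix /prod_word hi.
      by rewrite porbit_sym e inE eq_sym.
    have /eqP e : porbit (prod_word s) j == [set j] by rewrite porbit_fix /prod_word hj.
    by rewrite e inE.
  have := tperm_porbits (prod_word s) i j; move: fs; rewrite /forest size_rcons prod_word_rcons no nij /=.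
  by move: #|porbits (_ * _)%g| #|porbits _| (size s) => A B C /eqP; lia.
- by move: cs; rewrite -cats1 /cross_word all_cat => ->; case/andP: kij => /= -> kj; rewrite ltnNge kj.
- by rewrite -cats1 word_ok_cat oks /= /step_ok ij fa.
by rewrite -cats1 word_wt_cat ws /= /step_wt ij /hop_wt lt_ij !addm0.
Qed.

Lemma hook_word a b : (0 < a <= k)%N -> (0 < b)%N -> (k + b <= n)%N ->
  exists2 s, flat_word s & is_hook k a b (act 1%g s).
Proof.
have k1 : (k.-1 < n)%N by lia.
have k0 : (k < n)%N by lia.
have act_rc s i j : act 1%g (rcons s (i, j)) = act 1%g s ∘p tperm i j by rewrite act_rcons.
have base : flat_word [::].
  split=> //; rewrite /forest /= addn0; have := card_porbits (1%g : 'S_n).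
  by rewrite ncyc1 psupp1 cards0 addn0 add0n => ->.
elim: b => // b IHb ha _ kb; have [b0|b0] := posnP b; last first.
  have [|s fs hs] := IHb ha b0; first by lia.
  have kb' : (k + b < n)%N by lia.
  exists (rcons s (Ordinal k1, Ordinal kb')); last exact: (hook_wide k_range ha b0 hs _ _ (act_rc _ _ _)).
  apply: flat_word_rcons => //=; first by lia.
  - by apply/free_arcP => l /=; rewrite /arc !hs /hook_val /=; do ?case: ifP; lia.
  - by rewrite !hs /hook_val /=; do ?case: ifP; lia.
  by right; apply: val_inj; rewrite /= hs /hook_val /=; do ?case: ifP; lia.
rewrite b0 {IHb b0 kb b}; elim: a ha => // a IHa ha; have [a0|a0] := posnP a.
  rewrite a0; exists (rcons [::] (Ordinal k1, Ordinal k0));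
    last by apply: (hook_start (i := Ordinal k1) (j := Ordinal k0) k_range).
  apply: flat_word_rcons => //=; rewrite ?perm1 //=; try lia; last by left.
  by apply/free_arcP => l /=; lia.
have [|s fs hs] := IHa; first by lia.
have ka : (k - a.+1 < n)%N by lia.
have ha' : (0 < a < k)%N by lia.
exists (rcons s (Ordinal ka, Ordinal k0)); last exact: (hook_tall k_range ha' _ hs _ _ (act_rc _ _ _)).
apply: flat_word_rcons => //=; first by lia.
- by apply/free_arcP => l /=; rewrite /arc !hs /hook_val /=; do ?case: ifP; lia.
- by rewrite !hs /hook_val /=; do ?case: ifP; lia.
by left; apply: val_inj; rewrite /= hs /hook_val /=; do ?case: ifP; lia.
Qed.

End HookWords.

(** * Grassmannian permutations *)

Section Grassmannian.
Variable n : nat.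
Implicit Types (u v w q : 'S_n) (i j l : 'I_n).

Lemma monotone_perm_ge q : (forall i j, (i < j)%N -> (q i < q j)%N) -> forall l, (l <= q l)%N.
Proof.
move=> h [m lm] /=; elim: m lm => // m IH lm.
have lm' : (m < n)%N by apply: ltnW.
by apply: leq_ltn_trans (IH lm') (h (Ordinal lm') (Ordinal lm) _) => /=.
Qed.

Lemma monotone_perm_id q : (forall i j, (i < j)%N -> (q i < q j)%N) -> q = 1%g.
Proof.
move=> h; apply/permP => l; rewrite perm1; apply/val_inj/eqP; rewrite eqn_leq (monotone_perm_ge h) andbT.
have h' i j : (i < j)%N -> (q^-1%g i < q^-1%g j)%N.
  move=> ij; rewrite ltnNge leq_eqVlt; apply/negP => /orP[/eqP/val_inj/perm_inj e|/h].
    by rewrite e ltnn in ij.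
  by rewrite !permKV ltnNge (ltnW ij).
by have := monotone_perm_ge h' (q l); rewrite permK.
Qed.

(** The permutation of positions between two candidates fixes the first k positions and
    is increasing on the others. *)
Lemma is_grass_uniq k lam v w : is_grass k lam v -> is_grass k lam w -> v = w.
Proof.
move=> /andP[/forallP v1 /forallP v2] /andP[/forallP w1 /forallP w2].
have lowE l : (l < k)%N -> v l = w l.
  by move=> lk; apply: val_inj; move: (v1 l) (w1 l); rewrite lk /= => /eqP-> /eqP->.
pose q := pos_perm v w.
have vq l : v (q l) = w l := pos_permP v w l.
have qlow l : (l < k)%N -> q l = l by move=> lk; apply: (@perm_inj _ v); rewrite vq lowE.
have qhigh l : (k <= l)%N -> (k <= q l)%N.
  move=> kl; rewrite leqNgt; apply/negP => h; have /perm_inj e := qlow _ h.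
  by move: h; rewrite e ltnNge kl.
suff q1 : q = 1%g by apply/permP => l; rewrite -vq q1 perm1.
apply: monotone_perm_id => i j ij.
have [jk|kj] := ltnP j k; first by rewrite !qlow // (ltn_trans ij).
have [ik|ki] := ltnP i k; first by rewrite qlow // (leq_trans ik) // qhigh.
have wij : (w i < w j)%N by move: (w2 i) => /forallP/(_ j); rewrite ki ij.
rewrite ltnNge; apply/negP; rewrite leq_eqVlt => /orP[/eqP/val_inj/perm_inj e|h].
  by rewrite e ltnn in ij.
have : (v (q j) < v (q i))%N by move: (v2 (q j)) => /forallP/(_ (q i)); rewrite qhigh // h.
by rewrite !vq ltnNge (ltnW wij).
Qed.

Lemma hook_is_grass k a b w : (0 < k < n)%N -> (0 < a <= k)%N -> (0 < b)%N -> is_hook k a b w ->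
  is_grass k (hook b a) w.
Proof.
move=> kr ha hb hw; apply/andP; split.
  apply/forallP => l; apply/implyP => lk; rewrite hw /hook.
  have [e|ne] := eqVneq (k.-1 - l)%N 0%N.
    by rewrite e /= (_ : (l : nat) = k.-1) ?(hook_val_last kr) //; lia.
  rewrite -[(k.-1 - l)%N]prednK ?lt0n //= nth_nseq /hook_val.
  by do ?case: ifP; lia.
apply/forallP => i; apply/forallP => j; apply/implyP => kij; rewrite !hw /hook_val.
by do ?case: ifP; lia.
Qed.

Lemma grass_hook k a b w : (0 < k < n)%N -> (0 < a <= k)%N -> (0 < b)%N -> is_hook k a b w ->
  grass_perm n k (hook b a) = w.
Proof.
move=> kr ha hb hw; have kb := hook_range kr ha hb hw.
apply: is_grass_uniq (hook_is_grass kr ha hb hw); apply: grass_permP; first lia.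
- rewrite /hook /=; case: (a.-1) => //= m; rewrite hb /=; elim: m => //= m ->; by rewrite leqnn.
- rewrite /hook /= size_nseq; lia.
by rewrite /hook /=; lia.
Qed.

End Grassmannian.

(** * The class of a hook *)

Section HookClass.
Variables (n : nat) (R : comAlgType (Zq n)) (S : 'S_n -> R) (qH : qH_flag S) (k : nat).
Hypothesis k_range : (0 < k < n)%N.
Implicit Types (u v w : 'S_n) (al : 'X_{1..n.-1}) (a b : nat).

(** The Schur function of a hook is an alternating sum of products of elementary and
    complete functions; the quantizations eh stand for these products. *)
Definition hook_class a b : R := \sum_(i < b) (-1) ^+ i * eh_class k S (a + i) (b.-1 - i).
Definition hook_mx a b : 'M[Zq n]_#|{: 'S_n}| := \sum_(i < b) (-1) ^+ i * eh_mx n k (a + i) (b.-1 - i).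

Lemma mult_by_hook a b : mult_by S (hook_class a b) (hook_mx a b).
Proof. by apply: mult_by_sum => i _; apply/mult_by_sign/(mult_by_eh k qH). Qed.

(** Multiplication by 1 + X makes the alternating sum of coefficients telescope. *)
Lemma alternating_coefs (A : comNzRingType) (p : {poly A}) (m b : nat) :
  \sum_(i < b) (-1) ^+ i * (p * (1 + 'X))`_(m + i).+1 = p`_m - (-1) ^+ b * p`_(m + b).
Proof.
elim: b => [|b IH]; first by rewrite big_ord0 addn0 expr0 mul1r subrr.
rewrite big_ord_recr /= IH mulrDr mulr1 coefD coefMX /= addnS exprS; ring.
Qed.

(** The remaining coefficient is in degree a - 1 of X^(h-s) (1+X)^(s-1); the last one
    vanishes for degree reasons, because s <= g. *)
Lemma hook_binomial (A : comNzRingType) (x : A) (h g s a b : nat) :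
  (s <= h)%N -> (s <= g)%N -> (0 < a)%N -> (0 < b)%N -> (a + b.-1 + s = h + g)%N -> (0 < s)%N ->
  \sum_(i < b) (-1) ^+ i * (x%:P * ('X^(h - s) * (1 + 'X) ^+ s))`_(a + i) =
  x *+ binz (s - 1) (h%:Z - a%:Z).
Proof.
case: a => // a; case: s => // s sh sg _ b0 e _.
rewrite exprSr !mulrA -[RHS]addr0.
transitivity (\sum_(i < b) (-1) ^+ i * ((x%:P * ('X^(h - s.+1) * (1 + 'X) ^+ s)) * (1 + 'X))`_(a + i).+1).
  by apply: eq_bigr => i _; rewrite !mulrA addSn.
rewrite alternating_coefs; congr (_ + _); last first.
  rewrite (_ : (a + b)%N = (h - s.+1) + (a + b - (h - s.+1)))%N; last by lia.
  by rewrite coef_shape bin_small ?mulr0n ?mulr0 ?oppr0 //; lia.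
rewrite subSS subn0; have [ah|ha] := leqP (h - s.+1) a; last first.
  rewrite coefCM coefXnM ha mulr0 (_ : h%:Z - a.+1%:Z = (h - a.+1)%N); last lia.
  by rewrite /= bin_small //; lia.
rewrite -(subnKC ah) coef_shape subnKC //.
have [ah'|ha'] := leqP a.+1 h.
  rewrite (_ : h%:Z - a.+1%:Z = (h - a.+1)%N); last lia.
  rewrite /= -bin_sub; last lia.
  by congr (_ *+ 'C(_, _)); lia.
rewrite bin_small; last lia.
by have [m ->] : exists m, h%:Z - a.+1%:Z = Negz m by exists (a - h)%N; lia.
Qed.

Lemma ncyc_gt0 (p : 'S_n) : (0 < #|psupp p|)%N -> (0 < ncyc p)%N.
Proof.
case/card_gt0P => x; rewrite inE => px; apply/card_gt0P; exists (porbit p x).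
by rewrite inE card_porbit_gt1 px andbT; apply/imsetP; exists x.
Qed.

Lemma hook_ent a b u w : (0 < a)%N -> (0 < b)%N ->
  ent (hook_mx a b) u w =
  if (a + b.-1 + ncyc (pos_perm u w) == #|psupp (pos_perm u w)|)%N
  then pair_val k u w *+ binz (ncyc (pos_perm u w) - 1) (#|psupp (pos_perm u w) :&: low n k|%:Z - a%:Z)
  else 0.
Proof.
move=> a0 b0; rewrite /hook_mx ent_sum.
have eb (i : 'I_b) : (a + i + (b.-1 - i) = a + b.-1)%N by have := ltn_ord i; lia.
rewrite (eq_bigr (fun i : 'I_b => (-1) ^+ i * (if (a + b.-1 + ncyc (pos_perm u w) == #|psupp (pos_perm u w)|)%N
   then (gen k setT u w)`_(a + i) else 0))) => [|i _]; last by rewrite ent_sign eh_ent eb.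
case: eqP => [e|_]; last by rewrite big1 // => i _; rewrite mulr0.
case: (pair_val_gen qH k u w) => [[-> ->]|[_ sh sg ->]].
  by rewrite mul0rn big1 // => i _; rewrite coef0 mulr0.
apply: (@hook_binomial _ _ _ #|psupp (pos_perm u w) :&: high n k|) => //; first by rewrite e card_low_high.
by apply: ncyc_gt0; rewrite -e; move: a0; clear; lia.
Qed.

Lemma pos_perm1 w : pos_perm 1%g w = w.
Proof. by rewrite /pos_perm invg1 mulg1. Qed.

(** The operator of the hook class applied to the unit: a permutation with a nonzero
    entry is reached from the identity by a minimal word, so it is the permutation of a
    hook (b', 1^(a'-1)); it has one cycle and a' moved positions before the cut, and the
    binomial (0, a' - a) leaves only a' = a. *)
Lemma hook_class_schubert a b : (0 < a <= k)%N -> (0 < b <= n - k)%N ->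
  S (grass_perm n k (hook b a)) = hook_class a b.
Proof.
move=> ha /andP[hb bn]; have kb : (k + b <= n)%N by move: bn k_range; lia.
have a0 : (0 < a)%N by case/andP: ha.
have [s [fs cs oks ws] hw] := hook_word k_range ha hb kb.
set v := act 1%g s in hw; rewrite (grass_hook k_range ha hb hw).
have psv := hook_card k_range ha hb hw; have plv := hook_card_low k_range ha hb hw.
have v1 : v != 1%g by apply: contraTneq a0 => e; move: psv; rewrite e psupp1 cards0; move: hb; clear; lia.
have s0 : s != [::] by apply: contraNneq v1 => e; rewrite /v e.
have [_ [a' [b' [ha' hb' hw' sz]]]] := forest_hooks k_range fs cs oks s0.
have sz' : (size s).+1 = (a + b)%N by rewrite sz -(hook_card k_range ha' hb' hw') psv.
have ncv : ncyc v = 1%N by have := forest_card fs; rewrite -/v psv -sz' -/(prod_word s) /prod_word -/v; lia.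
have pv : pair_val k 1%g v = 1.
  have h : 0 < (pair_val k 1%g v)@_0%MM.
    apply: (forest_pair_val qH fs cs); rewrite -ws; exact: word_mx_gt0 (cross_proper cs) oks.
  by have [-> _ _ _] := pair_val_nz qH (lt0r_neq0 h); rewrite mpolyX0.
rewrite (mult_by_val qH (mult_by_hook a b)) (bigD1 v) //= big1 ?addr0 => [|w wv].
  rewrite hook_ent // pos_perm1 ncv psv plv pv (_ : (_ == _) = true); last by apply/eqP; lia.
  by rewrite subrr subnn /= bin0 scale1r.
rewrite hook_ent // pos_perm1; case: eqP => [ew|_]; last by rewrite scale0r.
have [->|h] := eqVneq (pair_val k 1%g w) 0; first by rewrite mul0rn scale0r.
have [al hal] : exists al, (pair_val k 1%g w)@_al != 0.
  by exists (mlead (pair_val k 1%g w)); rewrite mleadc_eq0.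
have [t [ct okt et _]] := pair_val_word qH hal; rewrite pos_perm1 => szt.
have ft : forest t.
  rewrite /forest /prod_word et; have := card_porbits w; move: szt; clear.
  by move: #|porbits w| #|psupp w| (ncyc w) (size t) => A B C D; lia.
have t0 : t != [::].
  by apply: contraTneq a0 => e; move: szt ew; rewrite e /=; move: hb;
    move: #|psupp w| (ncyc w) => A B; clear; lia.
have [_ [a2 [b2 [ha2 hb2 hw2 sz2]]]] := forest_hooks k_range ft ct okt t0.
rewrite et in hw2; have ps2 := hook_card k_range ha2 hb2 hw2.
rewrite (hook_card_low k_range ha2 hb2 hw2).
have nc2 : ncyc w = 1%N by move: szt sz2; rewrite ps2; clear; lia.
rewrite nc2 subnn; have [ea|na] := eqVneq a2 a.
  have eb : b2 = b by move: ew hb; rewrite nc2 ps2 ea; clear; lia.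
  case/eqP: wv; apply/permP => l; apply: val_inj; rewrite /= hw2 hw ea eb //.
case: (ltngtP a a2) na => // lt_a _.
  by rewrite (_ : a2%:Z - a%:Z = (a2 - a.+1)%N.+1) /= ?bin0n ?mulr0n ?scale0r //; move: lt_a; clear; lia.
have [m ->] : exists m, a2%:Z - a%:Z = Negz m by exists (a - a2.+1)%N; move: lt_a; clear; lia.
by rewrite mulr0n scale0r.
Qed.

End HookClass.

(* An interval of rank a + b - 1 has 2 |alpha| <= ell u + a + b - 1, so the bound
   on |alpha|, which makes the sum finite, excludes no term. *)
Theorem theorem3p2 (n k : nat) (n_ge2 : (2 <= n)%N) (k_range : (1 <= k < n)%N)
    (R : comAlgType (Zq n)) (S : 'S_n -> R) (qH : qH_flag S)
    (u : 'S_n) (a b : nat)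
    (a_range : (1 <= a <= k)%N) (b_range : (1 <= b <= n - k)%N) :
  S u * qSchur S k (hook b a) =
  \sum_(w : 'S_n)
   \sum_(alpha : 'X_{1..n.-1 < ell u + a + b} |
          `[< minimal_interval k u (bmnm alpha, w)
              /\ interval_rank u (bmnm alpha, w) = (a + b - 1)%N >])
     ((binz (ncyc (w ∘p u^-1%g) - 1) ((ht (w ∘p u^-1%g))%:Z - a%:Z))%:R
        * 'X_[bmnm alpha]) *: S w.
Proof.
have [a0 b0] : (0 < a)%N /\ (0 < b)%N by case/andP: a_range => -> _; case/andP: b_range.
rewrite /qSchur (hook_class_schubert qH k_range a_range b_range) (mult_by_hook qH k a b u).
apply: eq_bigr => w _; rewrite (hook_ent qH) // -scaler_suml; congr (_ *: _).
have [p0|p0] := eqVneq (pair_val k u w) 0.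
  rewrite p0 mul0rn if_same big_pred0 // => al; apply/asboolP => -[/(minimal_intervalP qH)].
  by rewrite p0 mcoeff0 eqxx.
have [al hal] : exists al, (pair_val k u w)@_al != 0.
  by exists (mlead (pair_val k u w)); rewrite mleadc_eq0.
have [rk ht_eq md] := minimal_rank qH hal.
have [pv _ _ _] := pair_val_nz qH hal.
case: eqP => [e|ne]; last first.
  rewrite big_pred0 // => be; apply/asboolP => -[/(minimal_intervalP qH) hbe rbe].
  by have [rk' _ _] := minimal_rank qH hbe; case: ne; rewrite -rk' rbe; lia.
have rk1 : interval_rank u (al, w) = (a + b - 1)%N.
  by move: rk; rewrite -e; move: (interval_rank _ _) (ncyc _) => A B; lia.
have bound : (mdeg al < ell u + a + b)%N by move: md; rewrite rk1; lia.
rewrite (big_pred1 (BMultinom bound)) => [|be].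
  by rewrite pos_perm_conj ncyc_conj -pos_perm_conj ht_eq /= pv mulr_natl.
rewrite /= -val_eqE /=; apply/asboolP/eqP => [[/(minimal_intervalP qH)]|->].
  by rewrite pv mcoeffX; case: (al =P _) => [->//|_]; rewrite eqxx.
by split=> //; apply/(minimal_intervalP qH).
Qed.
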